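(* In the regression model $Y_i=f(i/n)+\varepsilon_i$, $1\le i\le n$, let $G(F)=\|F\|^2/n$ for $F\in\mathbb{R}^n$ and $\mathcal{F}(f)=\int_0^1f^2$. Suppose that $f\in\mathcal{W}(\alpha,L)$ for some $L>0$ and $\alpha>1/2$, with $f\ne0$. Let $W$ be the prior on $F=\Phi\theta$ induced by the $\mathcal{N}(0,\gamma_nI_{k_n})$ distribution on $\theta$, for a sequence $(\gamma_n)_{n\ge1}$ of positive numbers such that $1/\sqrt n=o(\gamma_n)$. The sequence $(k_n)_{n\ge1}$ can be chosen such that $k_n=o(\sqrt n)$ and $\sqrt n=o(k_n^{2\alpha})$, and with such a choice, $$E\left[\sup_{I\in\mathcal{I}}\left|W\left(\frac{\sqrt n\left(G(F)-G(Y_{\langle\phi\rangle})\right)}{2\sigma\sqrt{\mathcal{F}(f)}}\in I\ \Big|\ Y\right)-\psi(I)\right|\right]\longrightarrow0\qquad\text{as }n\to\infty$$ and $\dfrac{\sqrt n\left(G(Y_{\langle\phi\rangle})-G(F_{\langle\phi\rangle})\right)}{2\sigma\sqrt{\mathcal{F}(f)}}\to\mathcal{N}(0,1)$ in distribution, as $n\to\infty$. Further, the bias is negligible with respect to the square root of the variance: $$\frac{\sqrt n\left(G(F_{\langle\phi\rangle})-\mathcal{F}(f)\right)}{2\sigma\sqrt{\mathcal{F}(f)}}=o(1).$$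
   Context: Model: for each $n\ge1$ one observes $Y=(Y_1,\dots,Y_n)$ with $Y_i=f(i/n)+\varepsilon_i$, where the $\varepsilon_i$ are i.i.d. $\mathcal{N}(0,\sigma^2)$, $\sigma>0$ known and not depending on $n$; $f:[0,1]\to\mathbb{R}$ is a fixed function; $F_0=(f(i/n))_{1\le i\le n}$, and $E$ and distributions of functions of $Y$ are under $Y\sim\mathcal{N}(F_0,\sigma^2I_n)$. Fourier basis: $\varphi_1\equiv1$, $\varphi_{2m}(x)=\sqrt2\cos(2\pi mx)$, $\varphi_{2m+1}(x)=\sqrt2\sin(2\pi mx)$ for $m\ge1$. Sobolev class: for $\alpha,L>0$, $\mathcal{W}(\alpha,L)$ is the set of $f=\sum_{j\ge1}\theta_j\varphi_j\in L^2([0,1])$ with $\sum_{j\ge1}a_j^2\theta_j^2\le L^2/\pi^{2\alpha}$, where $a_j=j^\alpha$ if $j$ is even and $a_j=(j-1)^\alpha$ if $j$ is odd; for $\alpha>1/2$ the series converges uniformly and $f$ denotes its (continuous) sum. Regressors: $\phi_j=(\varphi_j(i/n))_{1\le i\le n}\in\mathbb{R}^n$, $1\le j\le k_n$, and $\Phi$ is the $n\times k_n$ matrix with columns $\phi_j$ ($k_n\ge 1$ integer; $\Phi$ has rank $k_n$ as soon as $k_n<n$). $\Sigma=\Phi(\Phi^T\Phi)^{-1}\Phi^T$, $Y_{\langle\phi\rangle}=\Sigma Y$, $F_{\langle\phi\rangle}=\Sigma F_0$. The posterior $W(\cdot\mid Y)$ is computed when $F\sim W$ and, conditionally on $F$,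 $Y\sim\mathcal{N}(F,\sigma^2I_n)$. $\|\cdot\|$ is the Euclidean norm; $\mathcal{I}$ is the collection of all intervals of $\mathbb{R}$; $\psi(I)=P(Z\in I)$ with $Z\sim\mathcal{N}(0,1)$. *)

(* Defs.v *)
From HB Require Import structures.
From mathcomp Require Import all_boot all_order all_algebra.
From mathcomp Require Import all_classical all_reals all_analysis.
From mathcomp Require Import measurable_realfun.

Set Implicit Arguments.
Unset Strict Implicit.
Unset Printing Implicit Defensive.

Import Order.TTheory GRing.Theory Num.Theory.
Import numFieldNormedType.Exports.

Local Open Scope classical_set_scope.
Local Open Scope ring_scope.

Section finite_product.
Context d (T : measurableType d) (R : realType).

Definition cons_pair n (x : T * n.-tuple T) : n.+1.-tuple T :=
  [tuple of x.1 :: x.2].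

Lemma measurable_cons_pair n : measurable_fun [set: T * n.-tuple T] (@cons_pair n).
Proof. exact: measurable_cons. Qed.

HB.instance Definition _ n :=
  isMeasurableFun.Build _ _ _ _ (@cons_pair n) (@measurable_cons_pair n).

Fixpoint prod_prob n : ('I_n -> probability T R) -> probability (n.-tuple T) R :=
  if n is n'.+1 then fun P =>
    distribution (P ord0 \x prod_prob (fun i => P (lift ord0 i)))%E
                 (@cons_pair n')
  else fun=> \d_([tuple] : 0.-tuple T).

(* [prod_prob P] is the law under which the coordinates are independent and the
   i-th one has law [P i]. *)
Lemma prod_prob_box n (P : 'I_n -> probability T R) (A : 'I_n -> set T) :
  (forall i, measurable (A i)) ->
  prod_prob P [set t | forall i, A i (tnth t i)] = (\prod_(i < n) P i (A i))%E.
Proof.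
elim: n P A => [|n IH] P A mA /=.
  rewrite big_ord0 diracE mem_set//= => -[]//.
rewrite big_ord_recl /distribution /pushforward/=.
rewrite (_ : _ @^-1` _ =
  A ord0 `*` [set t | forall i, A (lift ord0 i) (tnth t i)]); last first.
  apply/seteqP; split => [[x t] /= h|[x t] /= [h0 h] i].
    by split=> [|i]; [exact: (h ord0)|have := h (lift ord0 i); rewrite tnthS].
  case: (unliftP ord0 i) => [j ->|->]; last exact: h0.
  by rewrite tnthS; exact: h.
rewrite product_measure1E//; last first.
  rewrite (_ : [set _ | _] =
    \bigcap_(i in [set: 'I_n]) ((@tnth n T)^~ i @^-1` A (lift ord0 i))).
    apply: fin_bigcap_measurable => // i _; rewrite -[_ @^-1` _]setTI.
    exact: measurable_tnth.
  by apply/seteqP; split => [t /= h i _|t /= h i]; [exact: h|exact: (h i)].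
by congr (_ * _)%E; exact: IH.
Qed.

End finite_product.

(* R^n with its Borel sigma-algebra; [measurableTypeR R] is R with the
   sigma-algebra on which [normal_prob] and [lebesgue_measure] are defined. *)
Notation vec R n := (n.-tuple (measurableTypeR R)).

Section vectors.
Context (R : realType).

Definition cvec n (t : vec R n) : 'cV[R]_n := \col_i tnth t i.

(* The law N(m, s^2 I_n); s is the standard deviation. *)
Definition gaussian n (m : 'cV[R]_n) (s : R) : probability (vec R n) R :=
  prod_prob (fun i => normal_prob (m i 0) s).

Definition lin_tuple n k (A : 'M[R]_(n, k)) (t : vec R k) : vec R n :=
  [tuple (A *m cvec t) i 0 | i < n].

Lemma measurable_lin_tuple n k (A : 'M[R]_(n, k)) :
  measurable_fun [set: vec R k] (lin_tuple A).
Proof.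
apply/measurable_fun_tnthP => i.
rewrite (_ : _ \o _ = fun t => \sum_(j < k) A i j * tnth t j).
  apply: measurable_sum => j; apply: measurable_funM => //.
  exact: measurable_tnth.
by apply/funext => t /=; rewrite tnth_mktuple mxE; apply: eq_bigr => j _; rewrite mxE.
Qed.

HB.instance Definition _ n k (A : 'M[R]_(n, k)) :=
  isMeasurableFun.Build _ _ _ _ (lin_tuple A) (measurable_lin_tuple A).

Definition sqnorm n (v : 'cV[R]_n) : R := \sum_i v i 0 ^+ 2.

(* The projection onto the column space of A when A has full column rank; a junk
   value otherwise, since invmx is the identity on singular matrices. *)
Definition orth_proj n k (A : 'M[R]_(n, k)) : 'M[R]_n :=
  A *m invmx (A^T *m A) *m A^T.

End vectors.

Section fourier.
Context (R : realType).
Local Notation mu := (@lebesgue_measure R).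

(* Only indices j >= 1 are meaningful. *)
Definition fourier (j : nat) (x : R) : R :=
  if j == 1%N then 1
  else if odd j then Num.sqrt 2 * sin (2 * pi * (j./2)%:R * x)
  else Num.sqrt 2 * cos (2 * pi * (j./2)%:R * x).

Definition sobolev_weight (alpha : R) (j : nat) : R :=
  (if odd j then j.-1%:R else j%:R) `^ alpha.

Definition sobolev_ellipsoid (alpha L : R) (theta : nat -> R) : Prop :=
  (\sum_(1 <= j <oo) (sobolev_weight alpha j ^+ 2 * theta j ^+ 2)%:E
     <= (L ^+ 2 / pi `^ (2 * alpha))%:E)%E.

Definition fourier_psum (theta : nat -> R) (N : nat) (x : R) : R :=
  \sum_(1 <= j < N.+1) theta j * fourier j x.

Definition fourier_L2_sum (theta : nat -> R) (f : R -> R) : Prop :=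
  measurable_fun (`[0, 1] : set R) f /\
  (\int[mu]_(x in `[0%R, 1%R]) ((f x - fourier_psum theta N x) ^+ 2)%:E)%E
    @[N --> \oo] --> 0%E.

Definition sobolev_class (alpha L : R) (f : R -> R) : Prop :=
  exists theta, fourier_L2_sum theta f /\ sobolev_ellipsoid alpha L theta.

(* For alpha > 1/2 every class in [sobolev_class alpha L] has exactly one
   representative on [0, 1] that is the pointwise sum of its Fourier series;
   point values f(i/n) refer to that representative. *)
Definition sobolev_sum (alpha L : R) (f : R -> R) : Prop :=
  exists theta, [/\ fourier_L2_sum theta f, sobolev_ellipsoid alpha L theta &
    forall x, 0 <= x <= 1 -> fourier_psum theta N x @[N --> \oo] --> f x].

Lemma sobolev_sum_class alpha L f : sobolev_sum alpha L f -> sobolev_class alpha L f.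
Proof. by case=> theta [h1 h2 _]; exists theta. Qed.

(* The 0-based index i of 'I_n stands for the design point (i+1)/n. *)
Definition design_pt n (i : 'I_n) : R := i.+1%:R / n%:R.

Definition signal (f : R -> R) n : 'cV[R]_n := \col_i f (design_pt i).

Definition design n k : 'M[R]_(n, k) :=
  \matrix_(i < n, j < k) fourier j.+1 (design_pt i).

Definition L2sq (f : R -> R) : R := (\int[mu]_(x in `[0, 1]) (f x ^+ 2))%R.

End fourier.

Section bayes.
Context (R : realType).

(* The density at Y of N(F, sigma^2 I_n). *)
Definition likelihood (sigma : R) n (F Y : vec R n) : R :=
  \prod_(i < n) normal_pdf (tnth F i) sigma (tnth Y i).

(* Bayes' formula; the model is dominated, with an everywhere positive and
   bounded likelihood, so this is a version of the conditional law of F. *)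
Definition posterior (sigma : R) n (W : probability (vec R n) R)
    (Y : vec R n) (B : set (vec R n)) : R :=
  (\int[W]_(F in B) likelihood sigma F Y) / (\int[W]_F likelihood sigma F Y).

(* The law of F = Phi theta for theta ~ N(0, gamma I_k). *)
Definition prior (gamma : R) n k : probability (vec R n) R :=
  distribution (gaussian (0 : 'cV[R]_k) (Num.sqrt gamma))
               (lin_tuple (design R n k)).

Definition G n (v : 'cV[R]_n) : R := sqnorm v / n%:R.

Definition standardize (sigma : R) (f : R -> R) (n : nat) (c x : R) : R :=
  Num.sqrt n%:R * (x - c) / (2 * sigma * Num.sqrt (L2sq f)).

Definition posterior_error (sigma : R) (f : R -> R) (gamma : R) n k
    (Y : vec R n) : R :=
  sup [set `| posterior sigma (prior gamma n k) Y
                [set F | standardize sigma f n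
                           (G (orth_proj (design R n k) *m cvec Y)) (G (cvec F))
                         \in I]
              - fine (normal_prob 0 1 [set` I]) | | I in [set: interval R]].

Definition cvg_in_distribution (d : nat -> measure_display)
    (T : forall n, measurableType (d n)) (P : forall n, probability (T n) R)
    (X : forall n, T n -> R) (Q : probability (measurableTypeR R) R) : Prop :=
  (forall n, measurable_fun [set: T n] (X n)) /\
  forall x : R, {for x, continuous (fun y : R => Q `]-oo, y]%classic)} ->
    P n (X n @^-1` `]-oo, x]) @[n --> \oo] --> Q `]-oo, x]%classic.

Definition dim_growth (alpha : R) (k : nat -> nat) : Prop :=
  [/\ forall n, (0 < n)%N -> (0 < k n)%N,
      (fun n => (k n)%:R : R) =o_\oo (fun n => Num.sqrt n%:R : R) &
      (fun n => Num.sqrt n%:R : R) =o_\oo (fun n => (k n)%:R `^ (2 * alpha) : R)].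

End bayes.

(* Main.v *)
(* The columns of the design are orthogonal on the grid as soon as k < n, with
   squared norm n, so G is the squared norm of the coefficient vector, and given
   Y the coefficients are N(r th, s^2 I), where th is the least-squares estimate
   and r = n / (n + sigma^2 / gamma).  Both standardized quantities then have
   the form <u, xi> + (constant + <v, xi> + c * sum of k squared N(0, 1)), with xi
   standard Gaussian and u a deterministic unit vector; the bracket is small
   because k = o(sqrt n) and 1 / sqrt n = o(gamma).  A probability of an interval
   moves by at most P(|bracket| > e) + 4 e, uniformly over intervals, and Markov's
   inequality turns this into an explicit bound for every Y; its expectation
   tends to 4 e, for every e > 0.
   For the bias, the least-squares coefficients of f on the grid differ from its
   Fourier coefficients by aliasing of the frequencies above n / 2, which costs
   O(n^(- 2 alpha)) in squared norm, and by Parseval the energy missed beyond k is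
   O(k^(- 2 alpha)) = o(1 / sqrt n). *)

Require Import Defs.
From HB Require Import structures.
From mathcomp Require Import all_boot all_order all_algebra.
From mathcomp Require Import all_classical all_reals all_analysis.
From mathcomp Require Import measurable_realfun zify ring lra.

Set Implicit Arguments.
Unset Strict Implicit.
Unset Printing Implicit Defensive.

Import Order.TTheory GRing.Theory Num.Theory.
Import numFieldNormedType.Exports.

Local Open Scope classical_set_scope.
Local Open Scope ring_scope.

(** * Integration against densities and product measures *)

(** The unit vector [u] comes from the least-squares coefficients [th0] of the noiseless signal. In
    the posterior the natural direction depends on [Y], and so does its length; imposing a
    deterministic [u] puts the discrepancy into [v], and the bound becomes affine in the squared
    error of the estimated coefficients. Its expectation is then a matter of second moments of
    linear forms in a standard Gaussian vector, and the crude value 8 for the second moment of N(0,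
    1) is harmless because each of these terms carries a factor that tends to 0. The standardisation
    uses [L2sq f], whereas the exact scale is the energy [q] of the projected signal; the bias bound
    makes [q / L2sq f] tend to 1. The condition alpha > 1/2 acts in several places: the powers p^(-
    2 alpha) are summable over the blocks, an admissible exponent for [k] exists, and n^(- alpha) =
    o(1 / sqrt n). The last one arises because energies are compared: a squared aliasing error n^(-
    2 alpha) enters through a cross term, at the order of its square root. *)

Section density.
Local Open Scope ereal_scope.
Context d (T : measurableType d) (R : realType).
Variables (mu nu : {measure set T -> \bar R}) (h : T -> R).
Hypotheses (mh : measurable_fun [set: T] h) (h0 : forall x, (0 <= h x)%R).
Hypothesis nuE : forall A, measurable A -> nu A = \int[mu]_(x in A) (h x)%:E.

Import HBNNSimple.

(** Monotone convergence along simple functions increasing to [f] reduces the identity to level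
    sets, where it is [nuE]. It turns integrals against [normal_prob] into Lebesgue integrals. *)
Lemma ge0_integral_density (f : T -> \bar R) : measurable_fun [set: T] f ->
  (forall x, 0 <= f x) -> \int[nu]_x f x = \int[mu]_x (f x * (h x)%:E).
Proof.
move=> mf f0.
have mhE : measurable_fun [set: T] (EFin \o h) by exact/measurable_EFinP.
pose g := nnsfun_approx measurableT mf.
have gf x : EFin \o g^~ x @ \oo --> f x by exact: cvg_nnsfun_approx.
have ndg x : {homo g^~ x : m n / (m <= n)%N >-> (m <= n)%R}.
  by move=> m n mn; exact/lefP/nd_nnsfun_approx.
have mg n : measurable_fun [set: T] (g n) by [].
transitivity (limn (fun n => \int[nu]_x (g n x)%:E)).
  rewrite -monotone_convergence//.
  - by apply: eq_integral => x _; apply/esym/cvg_lim => //; exact: gf.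
  - by move=> n; exact/measurable_EFinP.
  - by move=> n x _; rewrite lee_fin.
  - by move=> x _ m n mn; rewrite lee_fin; exact: ndg.
transitivity (limn (fun n => \int[mu]_x ((g n x)%:E * (h x)%:E))); last first.
  rewrite -monotone_convergence//.
  - apply: eq_integral => x _; apply/cvg_lim => //.
    by apply: cvgeZr => //; exact: gf.
  - by move=> n; apply: emeasurable_funM => //; exact/measurable_EFinP.
  - by move=> n x _; rewrite mule_ge0// lee_fin.
  - by move=> x _ m n mn; rewrite lee_wpmul2r ?lee_fin//; exact: ndg.
congr (limn _); apply/funext => n.
under eq_integral do rewrite fimfunE -fsumEFin//.
rewrite ge0_integral_fsum//; last 2 first.
  - by move=> r; exact/measurable_EFinP/measurableT_comp.
  - by move=> r x _; rewrite EFinM nnfun_muleindic_ge0.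
transitivity (\sum_(r \in range (g n))
   \int[mu]_x ((r * \1_(g n @^-1` [set r]) x)%:E * (h x)%:E)).
  apply: eq_fsbigr => r rg.
  have r0 : (0 <= r)%R by move: rg; rewrite inE => -[x _ <-].
  under eq_integral do rewrite EFinM.
  under [RHS]eq_integral do rewrite EFinM -muleA.
  rewrite !ge0_integralZl//.
  - rewrite integral_indic// setIT nuE// integral_mkcond; congr (_ * _).
    apply: eq_integral => x _; rewrite /patch indicE/=.
    by case: ifP => _; rewrite ?mul1e ?mul0e.
  - by apply: emeasurable_funM => //; exact/measurable_EFinP.
  - by move=> x _; rewrite mule_ge0 ?lee_fin.
  - exact/measurable_EFinP/measurable_indic.
rewrite -ge0_integral_fsum//; last 2 first.
  - move=> r; apply: emeasurable_funM => //.
    exact/measurable_EFinP/measurableT_comp.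
  - by move=> r x _; rewrite mule_ge0 ?lee_fin// -lee_fin EFinM nnfun_muleindic_ge0.
apply: eq_integral => x _; rewrite -ge0_mule_fsuml//; last first.
  by move=> r; rewrite EFinM nnfun_muleindic_ge0.
by rewrite fsumEFin// -fimfunE.
Qed.

End density.

(** * Affine changes of variables for Lebesgue measure *)

Section lebesgue_affine.
Local Open Scope ereal_scope.
Context {R : realType}.
Local Notation mu := (@lebesgue_measure R).

Definition affine (a b x : R) : R := (a * x + b)%R.

Lemma measurable_affine a b :
  measurable_fun [set: measurableTypeR R] (affine a b : _ -> measurableTypeR R).
Proof.
by apply: measurable_funD => //; exact: measurable_funM.
Qed.

Lemma preimage_affine_ocitv a b x y : (0 < a)%R ->
  affine a b @^-1` `]x, y]%classic = `]((x - b) / a)%R, ((y - b) / a)%R]%classic.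
Proof.
move=> a0; apply/seteqP; rewrite /affine.
by split=> z /=; rewrite !in_itv/= ltr_pdivrMr// ler_pdivlMr// ltrBlDr lerBrDr (mulrC a).
Qed.

(** [a] times the image of Lebesgue measure under [affine a b] gives every interval []x, y]] its
    length, hence is Lebesgue measure by uniqueness. *)
Lemma ge0_integral_affine_pos (a b : R) (f : R -> \bar R) : (0 < a)%R ->
  measurable_fun [set: R] f -> (forall x, 0 <= f x) ->
  \int[mu]_x f x = a%:E * \int[mu]_x f (a * x + b)%R.
Proof.
move=> a0 mf f0.
have a0' : (0 <= a)%R by exact: ltW.
pose p : {measure set (measurableTypeR R) -> \bar R} :=
  measure_function_pushforward__canonical__measure_function_Measure
    mu (measurable_affine a b).
transitivity (\int[mscale (NngNum a0') p]_x f x).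
  apply: eq_measure_integral => A mA _; apply: lebesgue_measure_unique => //.
  move=> _ [[x y]] _ <-; rewrite [RHS](_ : _ =
    a%:E * mu (affine a b @^-1` `]x, y]%classic))// preimage_affine_ocitv//.
  rewrite !lebesgue_measure_itv/= !lte_fin ltr_pM2r ?invr_gt0// ltrD2r.
  case: ifPn => _; last by rewrite mule0.
  rewrite -!EFinD -EFinM; congr EFin; field.
  by rewrite gt_eqF.
rewrite ge0_integral_mscale//=; congr (_ * _).
by rewrite /p ge0_integral_pushforward//; exact: measurable_affine.
Qed.

Lemma ge0_integral_lebesgueN (f : R -> \bar R) :
  measurable_fun [set: R] f -> (forall x, 0 <= f x) ->
  \int[mu]_x f x = \int[mu]_x f (- x)%R.
Proof.
move=> mf f0.
have mN : measurable_fun [set: measurableTypeR R]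
    (-%R : _ -> measurableTypeR R) by exact: oppr_measurable.
pose p : {measure set (measurableTypeR R) -> \bar R} :=
  measure_function_pushforward__canonical__measure_function_Measure mu mN.
transitivity (\int[p]_x f x).
  by apply: eq_measure_integral => A mA _; apply/esym/lebesgue_measureN.
by rewrite /p ge0_integral_pushforward.
Qed.

Lemma ge0_integral_affine (a b : R) (f : R -> \bar R) : a != 0%R ->
  measurable_fun [set: R] f -> (forall x, 0 <= f x) ->
  \int[mu]_x f x = `|a|%:E * \int[mu]_x f (a * x + b)%R.
Proof.
move=> a0 mf f0; case: (ltgtP a 0%R) a0 => // a0 _; last first.
  by rewrite gtr0_norm// -ge0_integral_affine_pos.
rewrite ltr0_norm// [LHS](@ge0_integral_affine_pos (- a) b) ?oppr_gt0//.
rewrite [X in _ * X]ge0_integral_lebesgueN//.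
  by congr (_ * _); apply: eq_integral => x _; rewrite mulrNN.
apply: (measurableT_comp mf); exact: measurable_affine.
Qed.

End lebesgue_affine.

Section normal_integral.
Local Open Scope ereal_scope.
Context {R : realType}.
Local Notation mu := (@lebesgue_measure R).
Local Notation MR := (measurableTypeR R).
Implicit Types (f : R -> \bar R) (m s : R).

Lemma ge0_integral_normal_prob m s f : measurable_fun [set: MR] f ->
  (forall x, 0 <= f x) ->
  \int[normal_prob m s]_x f x = \int[mu]_x (f x * (normal_pdf m s x)%:E).
Proof.
move=> mf f0; apply: ge0_integral_density => //.
- exact: measurable_normal_pdf.
- by move=> x; exact: normal_pdf_ge0.
Qed.

Lemma normal_pdf_affine m s x : s != 0%R ->
  (`|s| * normal_pdf m s (s * x + m) = normal_pdf 0 1 x)%R.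
Proof.
move=> s0; rewrite !normal_pdfE ?oner_neq0// /normal_peak /normal_fun.
rewrite addrK subr0 exprMn expr1n mul1r mulrA; congr (_ * expR _)%R.
  rewrite -[(s ^+ 2 * pi *+ 2)%R]mulrnAr sqrtrM ?sqr_ge0// sqrtr_sqr invfM mulrA.
  by rewrite mulfV ?mul1r// normr_eq0.
by field.
Qed.

Lemma ge0_integral_normal_affine m s f : s != 0%R ->
  measurable_fun [set: MR] f -> (forall x, 0 <= f x) ->
  \int[normal_prob m s]_x f x = \int[normal_prob 0%R 1%R]_x f (s * x + m)%R.
Proof.
move=> s0 mf f0.
have mfa : measurable_fun [set: MR] (fun x : MR => f (s * x + m)%R).
  exact: (measurableT_comp mf (measurable_affine s m)).
rewrite [LHS](ge0_integral_normal_prob m s mf f0).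
rewrite [RHS](ge0_integral_normal_prob 0 1 mfa (fun x => f0 _)).
have mg : measurable_fun [set: MR] (fun x => f x * (normal_pdf m s x)%:E).
  by apply: emeasurable_funM => //; apply/measurable_EFinP; exact: measurable_normal_pdf.
rewrite (@ge0_integral_affine _ s m)//; last first.
- by move=> x; rewrite mule_ge0 ?lee_fin ?normal_pdf_ge0.
rewrite -ge0_integralZl//; last 2 first.
- exact: (measurableT_comp mg (measurable_affine s m)).
- by move=> x _; rewrite mule_ge0 ?lee_fin ?normal_pdf_ge0.
by apply: eq_integral => x _; rewrite muleCA -EFinM normal_pdf_affine.
Qed.

(** Completing the square in [y]. The left side is the joint density of [y ~ N(0, 1)] and
    [t | y ~ N(b y, a^2)]; the right side is the marginal density of [t] times the density of [y]
    given [t]. *)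
Lemma normal_pdf_conv (a b t y : R) : a != 0%R ->
  let c := Num.sqrt (a ^+ 2 + b ^+ 2) in
  (normal_pdf (b * y) a t * normal_pdf 0 1 y =
   normal_pdf 0 c t * normal_pdf (b * t / c ^+ 2) (a / c) y)%R.
Proof.
move=> a0 c.
have ab0 : (0 < a ^+ 2 + b ^+ 2)%R.
  by rewrite ltr_wpDr ?sqr_ge0// exprn_even_gt0.
have c0 : c != 0%R by rewrite gt_eqF// sqrtr_gt0.
have c2 : (c ^+ 2 = a ^+ 2 + b ^+ 2)%R by rewrite sqr_sqrtr// ltW.
rewrite !normal_pdfE ?oner_neq0 ?mulf_neq0 ?invr_eq0// /normal_peak /normal_fun.
rewrite mulrACA [RHS]mulrACA -!expRD; congr (_ * expR _)%R.
  have pk u : (0 <= u ^+ 2 * pi *+ 2 :> R)%R.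
    by rewrite mulrn_wge0// mulr_ge0 ?pi_ge0// sqr_ge0.
  rewrite -!invfM -!sqrtrM//.
  by congr ((Num.sqrt _)^-1)%R; field.
rewrite expr_div_n c2; field.
by rewrite a0 gt_eqF.
Qed.

Lemma measurable_fun_lin2 (a b : R) :
  measurable_fun [set: MR * MR] (fun z : MR * MR => (a * z.1 + b * z.2)%R : MR).
Proof.
by apply: measurable_funD; apply: measurable_funM.
Qed.

(* Bayes' rule for the pair: N(by, a^2) against N(0, 1) in y has marginal
   N(0, a^2 + b^2). *)
Lemma ge0_integral_normal_conv (a b : R) f : a != 0%R ->
  measurable_fun [set: MR] f -> (forall x, 0 <= f x) ->
  \int[normal_prob 0%R 1%R]_x \int[normal_prob 0%R 1%R]_y f (a * x + b * y)%R =
  \int[normal_prob 0%R 1%R]_z f (Num.sqrt (a ^+ 2 + b ^+ 2) * z)%R.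
Proof.
move=> a0 mf f0; set c := Num.sqrt _.
have c0 : c != 0%R.
  by rewrite gt_eqF// sqrtr_gt0 ltr_wpDr ?sqr_ge0// exprn_even_gt0.
pose g (z : MR * MR) := f (a * z.1 + b * z.2)%R.
have mg : measurable_fun [set: MR * MR] g.
  exact: (measurableT_comp mf (measurable_fun_lin2 a b)).
rewrite (fubini_tonelli g mg (fun z => f0 _)).
have mpdf m s : measurable_fun [set: MR] (fun x : MR => (normal_pdf m s x)%:E).
  apply/measurable_EFinP; exact: measurable_normal_pdf.
have pdf0 m s x : 0 <= (normal_pdf m s x)%:E by rewrite lee_fin normal_pdf_ge0.
pose h (z : MR * MR) :=
  f z.2 * (normal_pdf (b * z.1) a z.2)%:E * (normal_pdf 0 1 z.1)%:E.
have mh : measurable_fun [set: MR * MR] h.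
  apply: emeasurable_funM; last exact: (measurableT_comp (mpdf 0%R 1%R) measurable_fst).
  apply: emeasurable_funM; first exact: (measurableT_comp mf measurable_snd).
  (* Joint measurability in both variables: the varying mean is moved into the argument, so that a
     fixed density is composed with a linear form. *)
  apply: (eq_measurable_fun (fun z : MR * MR =>
    (normal_pdf 0 a (- b * z.1 + 1 * z.2)%R)%:E)).
    move=> z _ /=; rewrite !normal_pdfE// /normal_fun.
    by have -> : (- b * z.1 + 1 * z.2 - 0 = z.2 - b * z.1)%R by ring.
  exact: (measurableT_comp (mpdf 0%R a) (measurable_fun_lin2 (- b) 1)).
have h0 z : 0 <= h z by apply: mule_ge0 => //; exact: mule_ge0.
have step y : \int[normal_prob 0%R 1%R]_x f (a * x + b * y)%R *
    (normal_pdf 0 1 y)%:E = \int[mu]_t h (y, t).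
  rewrite -(ge0_integral_normal_affine (b * y) a0 mf f0).
  rewrite (ge0_integral_normal_prob (b * y) a mf f0) -ge0_integralZr//.
  - exact: emeasurable_funM.
  - by move=> x _; rewrite mule_ge0.
transitivity (\int[mu]_y \int[mu]_t h (y, t)).
  rewrite ge0_integral_normal_prob//; last 2 first.
  - exact: (@measurable_fun_fubini_tonelli_G _ _ MR MR R (normal_prob 0 1) g
      mg (fun z => f0 _)).
  - by move=> y; apply: integral_ge0 => x _; exact: f0.
  by apply: eq_integral => y _; exact: step.
rewrite (fubini_tonelli h)//=.
transitivity (\int[mu]_t (f t * (normal_pdf 0 c t)%:E)).
  apply: eq_integral => t _.
  transitivity (\int[mu]_y (f t * (normal_pdf 0 c t)%:E *
    (normal_pdf (b * t / c ^+ 2) (a / c) y)%:E)).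
    by apply: eq_integral => y _; rewrite /h/= -!muleA -!EFinM normal_pdf_conv.
  by rewrite ge0_integralZl ?integral_normal_pdf ?mule1// mule_ge0.
rewrite -(ge0_integral_normal_prob 0 c mf f0).
rewrite (ge0_integral_normal_affine 0 c0 mf f0).
by apply: eq_integral => x _; rewrite addr0.
Qed.

End normal_integral.

(** * Integration over product laws, one coordinate at a time *)

Section product_integration.
Local Open Scope ereal_scope.
Context d d' (T : measurableType d) (U : measurableType d') (R : realType).

Lemma ge0_integral_prod_prob n (P : 'I_n.+1 -> probability T R)
    (f : n.+1.-tuple T -> \bar R) :
  measurable_fun [set: n.+1.-tuple T] f -> (forall t, 0 <= f t) ->
  \int[prod_prob P]_t f t =
  \int[P ord0]_x \int[prod_prob (fun i => P (lift ord0 i))]_t f (cons_pair (x, t)).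
Proof.
move=> mf f0; rewrite ge0_integral_distribution//.
rewrite (fubini_tonelli1 (f \o @cons_pair _ T n))//.
  exact: (measurableT_comp mf (@measurable_cons_pair _ T n)).
by move=> x; exact: f0.
Qed.

Lemma measurable_integral_cons_pair n (P : probability (n.-tuple T) R)
    (f : n.+1.-tuple T -> \bar R) :
  measurable_fun [set: n.+1.-tuple T] f -> (forall t, 0 <= f t) ->
  measurable_fun [set: T] (fun x => \int[P]_t f (cons_pair (x, t))).
Proof.
move=> mf f0; apply: (@measurable_fun_fubini_tonelli_F _ _ T (n.-tuple T) R P
  (f \o @cons_pair _ T n)).
  exact: (measurableT_comp mf (@measurable_cons_pair _ T n)).
by move=> x; exact: f0.
Qed.

Lemma measurable_cons_pair1 n x :
  measurable_fun [set: n.-tuple T] (fun t => cons_pair (x, t)).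
Proof.
apply: (measurableT_comp (@measurable_cons_pair _ T n)).
exact: measurable_fun_pair.
Qed.

Definition map_coords n (g : 'I_n -> T -> U) (t : n.-tuple T) : n.-tuple U :=
  [tuple g i (tnth t i) | i < n].

Lemma map_coords_cons n (g : 'I_n.+1 -> T -> U) x (t : n.-tuple T) :
  map_coords g (cons_pair (x, t)) =
  cons_pair (g ord0 x, map_coords (fun i => g (lift ord0 i)) t).
Proof.
apply: eq_from_tnth => i; rewrite tnth_mktuple.
by case: (unliftP ord0 i) => [j ->|->]; rewrite ?tnthS ?tnth_mktuple ?tnth0.
Qed.

Lemma measurable_map_coords n (g : 'I_n -> T -> U) :
  (forall i, measurable_fun [set: T] (g i)) ->
  measurable_fun [set: n.-tuple T] (map_coords g).
Proof.
move=> mg; apply/measurable_fun_tnthP => i.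
rewrite (_ : _ \o _ = g i \o (@tnth n T ^~ i)).
  by apply: measurableT_comp => //; exact: measurable_tnth.
by apply/funext => t /=; rewrite tnth_mktuple.
Qed.

End product_integration.

Section product_change_of_variables.
Local Open Scope ereal_scope.
Context d d' (T : measurableType d) (U : measurableType d') (R : realType).

(** Induction on [n] with Tonelli. It has two uses: with [h = 1] it moves a Gaussian vector to the
    standard one; with [g] the identity and [h] the likelihood of one coefficient it is Bayes' rule
    for all coefficients together, the [C i] being the evidences. *)
Lemma ge0_integral_prod_prob_change n (P : 'I_n -> probability T R)
    (Q : 'I_n -> probability U R) (g : 'I_n -> T -> U) (h : 'I_n -> T -> R)
    (C : 'I_n -> R) (f : n.-tuple U -> \bar R) :
  (forall i, measurable_fun [set: T] (g i)) ->
  (forall i, measurable_fun [set: T] (h i)) ->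
  (forall i x, (0 <= h i x)%R) -> (forall i, (0 <= C i)%R) ->
  (forall i (k : U -> \bar R), measurable_fun [set: U] k ->
     (forall y, 0 <= k y) ->
     \int[P i]_x (k (g i x) * (h i x)%:E) = (C i)%:E * \int[Q i]_y k y) ->
  measurable_fun [set: n.-tuple U] f -> (forall t, 0 <= f t) ->
  \int[prod_prob P]_t (f (map_coords g t) * (\prod_(i < n) h i (tnth t i))%:E) =
  (\prod_(i < n) C i)%:E * \int[prod_prob Q]_t f t.
Proof.
elim: n P Q g h C f => [|n IH] P Q g h C f mg mh h0 C0 PQ mf f0.
  rewrite big_ord0 mul1e.
  under eq_integral do rewrite big_ord0 mule1.
  have -> : (fun t => f (map_coords g t)) = cst (f [tuple]).
    by apply/funext => t; rewrite [map_coords g t]tuple0.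
  have -> : f = cst (f [tuple]) by apply/funext => t; rewrite [t]tuple0.
  by rewrite !integral_cst// !probability_setT.
have mprod : measurable_fun [set: n.+1.-tuple T]
    (fun t => f (map_coords g t) * (\prod_(i < n.+1) h i (tnth t i))%:E).
  apply: emeasurable_funM.
    exact: (measurableT_comp mf (measurable_map_coords mg)).
  apply/measurable_EFinP; apply: measurable_prod => i _.
  by apply: (measurableT_comp (mh i)); exact: measurable_tnth.
have p0 t : 0 <= f (map_coords g t) * (\prod_(i < n.+1) h i (tnth t i))%:E.
  by rewrite mule_ge0// lee_fin prodr_ge0.
rewrite ge0_integral_prod_prob//.
pose P' i := P (lift ord0 i); pose Q' i := Q (lift ord0 i).
pose F y := \int[prod_prob Q']_t f (cons_pair (y, t)).
have F0 y : 0 <= F y by exact: integral_ge0.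
have mF : measurable_fun [set: U] F by exact: measurable_integral_cons_pair.
pose C' := (\prod_(i < n) C (lift ord0 i))%R.
have C'0 : (0 <= C')%R by rewrite prodr_ge0.
transitivity (\int[P ord0]_x (C'%:E * (F (g ord0 x) * (h ord0 x)%:E))).
  apply: eq_integral => x _.
  transitivity (\int[prod_prob P']_t ((h ord0 x)%:E *
     (f (cons_pair (g ord0 x, map_coords (fun i => g (lift ord0 i)) t)) *
      (\prod_(i < n) h (lift ord0 i) (tnth t i))%:E))).
    apply: eq_integral => t _; rewrite map_coords_cons big_ord_recl tnth0.
    rewrite EFinM muleCA; congr (_ * (_ * _%:E)).
    by apply: eq_bigr => i _; rewrite tnthS.
  rewrite ge0_integralZl//; last 3 first.
  - apply: emeasurable_funM.
      apply: (measurableT_comp mf).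
      apply: (measurableT_comp (@measurable_cons_pair _ U n)).
      apply: measurable_fun_pair => //.
      by apply: measurable_map_coords => i; exact: mg.
    apply/measurable_EFinP; apply: measurable_prod => i _.
    by apply: (measurableT_comp (mh _)); exact: measurable_tnth.
  - by move=> t _; rewrite mule_ge0// lee_fin prodr_ge0.
  - by rewrite lee_fin.
  have := IH P' Q' (fun i => g (lift ord0 i)) (fun i => h (lift ord0 i))
    (fun i => C (lift ord0 i)) (fun t => f (cons_pair (g ord0 x, t))).
  move=> /= ->//.
  - by rewrite muleCA -/(F _) (muleC _%:E (F _)).
  - by move=> i k mk k0; exact: PQ.
  - apply: (measurableT_comp mf).
    exact: measurable_cons_pair1.
rewrite ge0_integralZl//; last 2 first.
- apply: emeasurable_funM; first exact: (measurableT_comp mF).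
  exact/measurable_EFinP.
- by move=> x _; rewrite mule_ge0// lee_fin.
rewrite PQ// muleA -EFinM big_ord_recl mulrC; congr (_ * _).
by rewrite ge0_integral_prod_prob.
Qed.

End product_change_of_variables.

(** * Gaussian vectors and perturbation of their laws *)

Lemma integral_probability_cst d (T : measurableType d) (R : realType)
  (P : probability T R) (c : \bar R) : (\int[P]_x cst c x = c)%E.
Proof.
rewrite integral_cst; last exact: measurableT.
by rewrite -[RHS]mule1; congr (_ * _)%E; exact: (probability_setT P).
Qed.

Section gaussian_vectors.
Local Open Scope ereal_scope.
Context {R : realType}.
Local Notation mu := (@lebesgue_measure R).
Local Notation MR := (measurableTypeR R).

Definition stdgauss n : probability (vec R n) R :=
  prod_prob (fun=> normal_prob 0%R 1%R).

Lemma gaussian0E n s :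
  gaussian (0 : 'cV[R]_n) s = prod_prob (fun=> normal_prob 0%R s).
Proof. by congr prod_prob; apply/funext => i; rewrite mxE. Qed.

Lemma ge0_integral_gaussian n (m : 'cV[R]_n) s (f : vec R n -> \bar R) :
  s != 0%R -> measurable_fun [set: vec R n] f -> (forall t, 0 <= f t) ->
  \int[gaussian m s]_t f t =
  \int[stdgauss n]_t f (map_coords (fun i : 'I_n => affine s (m i 0%R)) t).
Proof.
move=> s0 mf f0.
have E : \int[stdgauss n]_t (f (map_coords (fun i : 'I_n => affine s (m i 0%R)) t)
    * (\prod_(i < n) 1%R)%:E) = (\prod_(i < n) 1%R)%:E * \int[gaussian m s]_t f t.
  apply: (@ge0_integral_prod_prob_change _ _ MR MR R n (fun=> normal_prob 0%R 1%R)
    (fun i => normal_prob (m i 0%R) s) (fun i => affine s (m i 0%R))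
    (fun _ => cst 1%R) (fun=> 1%R) f) => //.
  - by move=> i; exact: measurable_affine.
  - move=> i k mk k0; rewrite mul1e.
    transitivity (\int[normal_prob 0%R 1%R]_x k (s * x + m i 0)%R).
      by apply: eq_integral => x _; rewrite mule1.
    exact/esym/(ge0_integral_normal_affine (m i 0%R) s0 mk k0).
have p1 : (\prod_(i < n) 1 = 1 :> R)%R by rewrite big1.
rewrite p1 mul1e in E; rewrite -E.
by apply: eq_integral => t _; rewrite mule1.
Qed.

Definition lincomb n (u : 'I_n -> R) (t : vec R n) : R :=
  (\sum_(i < n) u i * tnth t i)%R.

Lemma measurable_lincomb n (u : 'I_n -> R) :
  measurable_fun [set: vec R n] (lincomb u : _ -> MR).
Proof.
apply: measurable_sum => i; apply: measurable_funM => //.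
exact: measurable_tnth.
Qed.

(** Induction on [n]: the first coordinate is convolved with the normal law of the remaining linear
    form. The scale stands inside the argument of [f], so that [u = 0] is covered without a
    degenerate normal law. *)
Lemma ge0_integral_lincomb n (u : 'I_n -> R) (f : R -> \bar R) :
  measurable_fun [set: MR] f -> (forall x, 0 <= f x) ->
  \int[stdgauss n]_t f (lincomb u t) =
  \int[normal_prob 0%R 1%R]_z f (Num.sqrt (\sum_(i < n) u i ^+ 2) * z)%R.
Proof.
move=> mf f0; elim: n u f mf f0 => [|n IH] u f mf f0.
  rewrite [LHS](_ : _ = \int[stdgauss 0]_t cst (f 0%R) t); last first.
    by apply: eq_integral => t _; rewrite /lincomb big_ord0.
  rewrite [RHS](_ : _ = \int[normal_prob 0%R 1%R]_t cst (f 0%R) t); last first.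
    by apply: eq_integral => t _; rewrite big_ord0 sqrtr0 mul0r.
  by rewrite [LHS]integral_probability_cst [RHS]integral_probability_cst.
have mflin : measurable_fun [set: vec R n.+1] (fun t => f (lincomb u t)).
  exact: (measurableT_comp mf (measurable_lincomb u)).
rewrite ge0_integral_prod_prob//.
pose u' i := u (lift ord0 i).
pose c' := Num.sqrt (\sum_(i < n) u' i ^+ 2)%R.
transitivity (\int[normal_prob 0%R 1%R]_x \int[normal_prob 0%R 1%R]_z
    f (u ord0 * x + c' * z)%R).
  apply: eq_integral => x _.
  transitivity (\int[stdgauss n]_t (fun y => f (u ord0 * x + y)%R) (lincomb u' t)).
    apply: eq_integral => t _; rewrite /lincomb big_ord_recl tnth0.
    by congr (f (_ + _)%R); apply: eq_bigr => i _; rewrite tnthS.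
  rewrite (IH u' (fun y => f (u ord0 * x + y)%R))//.
  apply: (measurableT_comp mf); exact: measurable_funD.
have c'2 : (c' ^+ 2 = \sum_(i < n) u' i ^+ 2)%R.
  by rewrite sqr_sqrtr// sumr_ge0// => i _; rewrite sqr_ge0.
rewrite big_ord_recl -c'2.
(* The convolution identity asks for a nonzero first coefficient; when it vanishes, the first
   coordinate integrates out. *)
have [u0|u0] := eqVneq (u ord0) 0%R; last exact: ge0_integral_normal_conv.
rewrite u0 expr0n/= add0r sqrtr_sqr ger0_norm ?sqrtr_ge0//.
under eq_integral do under eq_integral do rewrite mul0r add0r.
exact: integral_probability_cst.
Qed.

(** Doubling the standard deviation halves the peak and gains a factor [expR (3 / 8 * z ^+ 2)],
    which is at least [3 / 8 * z ^+ 2]; so 8 suffices, as [8 / 2 * (3 / 8) >= 1]. The second moment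
    of N(0, 1) is then bounded by a total mass instead of being computed. *)
Lemma normal_pdf_sqr_le (z : R) :
  (z ^+ 2 * normal_pdf 0 1 z <= 8 * normal_pdf 0 2 z)%R.
Proof.
rewrite !normal_pdfE ?oner_neq0// /normal_peak /normal_fun subr0 expr1n.
have -> : (Num.sqrt (2 ^+ 2 * pi *+ 2) = 2 * Num.sqrt (1 * pi *+ 2) :> R)%R.
  rewrite -mulrnAr sqrtrM ?sqr_ge0// sqrtr_sqr ger0_norm// mul1r//.
rewrite invfM; set q := (Num.sqrt _)^-1%R.
have q0 : (0 <= q)%R by rewrite invr_ge0 sqrtr_ge0.
have -> : (- z ^+ 2 / (2 ^+ 2 *+ 2) = - z ^+ 2 / (1 *+ 2) + 3 / 8 * z ^+ 2)%R.
  by field.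
rewrite expRD; set e := expR (_ / _)%R; set X := expR _.
have e0 : (0 <= e)%R by exact: expR_ge0.
have X0 : (0 <= X)%R by exact: expR_ge0.
have E : (3 / 8 * z ^+ 2 <= X)%R.
  by apply: le_trans (expR_ge1Dx _); rewrite lerDr.
have -> : (8 * (2^-1 * q * (e * X)) = (q * e) * (4 * X))%R by field.
rewrite mulrC; apply: ler_wpM2l; first exact: mulr_ge0.
lra.
Qed.

Lemma normal_second_moment_le :
  \int[normal_prob 0%R 1%R]_z (z ^+ 2)%:E <= (8%:R : R)%:E.
Proof.
have m2 : measurable_fun [set: MR] (fun z : MR => (z ^+ 2)%:E).
  by apply/measurable_EFinP; exact: measurable_funX.
have mpdf m s : measurable_fun [set: MR] (fun x : MR => (normal_pdf m s x)%:E).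
  apply/measurable_EFinP; exact: measurable_normal_pdf.
rewrite (ge0_integral_normal_prob 0 1 m2); last first.
  by move=> x; rewrite lee_fin sqr_ge0.
apply: (@le_trans _ _ (\int[mu]_z (8%:E * (normal_pdf 0 2 z)%:E))).
  apply: ge0_le_integral => //.
  - by move=> x _; rewrite mule_ge0 ?lee_fin ?sqr_ge0 ?normal_pdf_ge0.
  - exact: emeasurable_funM.
  - exact: emeasurable_funM.
  - by move=> x _; rewrite -!EFinM lee_fin normal_pdf_sqr_le.
rewrite ge0_integralZl//; first by rewrite integral_normal_pdf mule1.
by move=> x _; rewrite lee_fin normal_pdf_ge0.
Qed.

Lemma lincomb_second_moment_le n (u : 'I_n -> R) :
  \int[stdgauss n]_t (lincomb u t ^+ 2)%:E <= (8 * \sum_(i < n) u i ^+ 2)%:E.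
Proof.
have m2 : measurable_fun [set: MR] (fun z : MR => (z ^+ 2)%:E).
  by apply/measurable_EFinP; exact: measurable_funX.
have s0 : (0 <= \sum_(i < n) u i ^+ 2)%R.
  by rewrite sumr_ge0// => i _; rewrite sqr_ge0.
rewrite (ge0_integral_lincomb u m2); last by move=> x; rewrite lee_fin sqr_ge0.
rewrite [X in X <= _](_ : _ = (\sum_(i < n) u i ^+ 2)%:E *
   \int[normal_prob 0%R 1%R]_z (z ^+ 2)%:E).
  rewrite mulrC EFinM lee_wpmul2l ?lee_fin//; exact: normal_second_moment_le.
rewrite -ge0_integralZl//.
- by apply: eq_integral => x _; rewrite exprMn sqr_sqrtr.
- by move=> x _; rewrite lee_fin sqr_ge0.
Qed.

Lemma lincomb_normal n (u : 'I_n -> R) (J : set R) :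
  (\sum_(i < n) u i ^+ 2 = 1)%R -> measurable (J : set MR) ->
  stdgauss n (lincomb u @^-1` J) = normal_prob 0%R 1%R J.
Proof.
move=> u1 mJ.
have mI : measurable_fun [set: MR] (fun z : MR => (\1_J z)%:E : \bar R).
  exact/measurable_EFinP/measurable_indic.
have I0 x : (0 : \bar R) <= (\1_J x)%:E by rewrite lee_fin.
have mluJ : measurable (lincomb u @^-1` J).
  by rewrite -[X in measurable X]setTI; exact: (measurable_lincomb u).
have E := ge0_integral_lincomb u mI I0.
transitivity (\int[stdgauss n]_t (\1_J (lincomb u t))%:E).
  rewrite -[X in stdgauss n X]setIT.
  exact/esym/(integral_indic (stdgauss n) measurableT mluJ).
rewrite E; transitivity (\int[normal_prob 0%R 1%R]_z (\1_J z)%:E).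
  by apply: eq_integral => z _; rewrite u1 sqrtr1 mul1r.
rewrite -[X in _ = normal_prob 0%R 1%R X]setIT.
exact: (integral_indic (normal_prob 0%R 1%R) measurableT mJ).
Qed.

End gaussian_vectors.

(** * Probabilities of intervals under small perturbations *)

Section normal_approximation.
Context {R : realType}.
Local Notation MR := (measurableTypeR R).

(** The density of N(0, 1) is at most [1 / sqrt (2 pi) <= 1], so a mass is at most a length. *)
Lemma normal_prob_ball_le (a e : R) : 0 <= e ->
  (normal_prob 0 1 `[(a - e)%R, (a + e)%R]%classic <= (2 * e)%:E)%E.
Proof.
move=> e0; have mpdf : measurable_fun [set: MR] (fun x : MR => (normal_pdf 0 1 x)%:E).
  by apply/measurable_EFinP; exact: measurable_normal_pdf.
apply: (@le_trans _ _ (\int[lebesgue_measure]_(x in `[(a - e)%R, (a + e)%R]) (cst 1%E x))%E).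
  apply: ge0_le_integral => //.
  - by move=> x _; rewrite lee_fin normal_pdf_ge0.
  - exact: measurable_funTS.
  - move=> x _; rewrite lee_fin.
    apply: (le_trans (normal_pdf_ub _ _ _)); first exact: oner_neq0.
    have hp : 1 <= (1 : R) ^+ 2 * pi *+ 2.
      by rewrite expr1n mul1r mulr2n; have := pi_ge2 R; lra.
    rewrite invf_le1 ?sqrtr_gt0 ?(lt_le_trans _ hp)//.
    by rewrite -[leLHS]sqrtr1 ler_sqrt// (le_trans _ hp).
have E := @integral_cst _ MR R (@lebesgue_measure R) `[(a - e)%R, (a + e)%R]%classic
  (measurable_itv _) 1%E.
rewrite E mul1e.
suff : (lebesgue_measure (`[(a - e)%R, (a + e)%R]%classic : set R) <= (2 * e)%:E)%E by [].
rewrite lebesgue_measure_itv/= lte_fin.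
case: ifPn => _; rewrite ?lee_fin ?mulr_ge0//.
by lra.
Qed.

(** Membership in [I] can change between [z] and [w] only across an endpoint, which then lies
    between them. Having just two points, whatever the kind of interval, makes the later bounds
    uniform over intervals. *)
Lemma interval_endpoints (I : interval R) : exists a b : R, forall e z w : R,
  `|w - z| <= e -> (z \in I) != (w \in I) -> `|z - a| <= e \/ `|z - b| <= e.
Proof.
(* An infinite bound gets the value 0, which is harmless: no membership changes there. *)
case: I => l u; pose ep (b : itv_bound R) := if b is BSide _ x then x else 0.
exists (ep l), (ep u) => e z w; rewrite ler_norml => /andP[h1 h2].
have low : (l <= BLeft z)%O != (l <= BLeft w)%O -> `|z - ep l| <= e.
  rewrite /ep; case: l => [[] x|[]]; rewrite ?bnd_simp//.
  - by rewrite ler_norml; case: (leP x z); case: (leP x w) => //= *; apply/andP; split; lra.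
  - by rewrite ler_norml; case: (ltP x z); case: (ltP x w) => //= *; apply/andP; split; lra.
have up : (BRight z <= u)%O != (BRight w <= u)%O -> `|z - ep u| <= e.
  rewrite /ep; case: u => [[] x|[]]; rewrite ?bnd_simp//.
  - by rewrite ler_norml; case: (ltP z x); case: (ltP w x) => //= *; apply/andP; split; lra.
  - by rewrite ler_norml; case: (leP z x); case: (leP w x) => //= *; apply/andP; split; lra.
rewrite !itv_boundlr; move: low up.
by case: (l <= BLeft z)%O; case: (l <= BLeft w)%O; case: (BRight z <= u)%O;
  case: (BRight w <= u)%O => //= low up _; [right; exact: up| | | left; exact: low|..];
  (by left; exact: low) || (by right; exact: up).
Qed.

Lemma probability_symdiff_le d (T : measurableType d) (P : probability T R)
    (A B S : set T) : measurable A -> measurable B -> measurable S ->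
  A `<=` B `|` S -> B `<=` A `|` S ->
  `|fine (P A) - fine (P B)| <= fine (P S).
Proof.
move=> mA mB mS AB BA.
have fp X : measurable X -> P X = (fine (P X))%:E.
  by move=> mX; rewrite fineK// fin_num_measure.
have H X Y : measurable X -> measurable Y -> X `<=` Y `|` S ->
    fine (P X) <= fine (P Y) + fine (P S).
  move=> mX mY XY; rewrite -lee_fin EFinD -!fp//.
  apply: le_trans (measureU2 P mY mS).
  by apply: le_measure; rewrite ?inE//; exact: measurableU.
rewrite ler_norml; have := H _ _ mA mB AB; have := H _ _ mB mA BA.
by move=> ? ?; apply/andP; split; lra.
Qed.

(* W and Z disagree about I only where they are more than e apart or where Z is
   within e of an endpoint of I. *)
Lemma normal_perturbation d (T : measurableType d) (P : probability T R)
    (Z W : T -> R) (I : interval R) (e : R) : 0 <= e ->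
  measurable_fun [set: T] (Z : T -> MR) -> measurable_fun [set: T] (W : T -> MR) ->
  (forall J : set R, measurable (J : set MR) -> P (Z @^-1` J) = normal_prob 0 1 J) ->
  `|fine (P (W @^-1` [set` I])) - fine (normal_prob 0 1 [set` I])| <=
  fine (P [set t | e < `|W t - Z t|]) + 4 * e.
Proof.
move=> e0 mZ mW ZN.
have [a [b ab]] := interval_endpoints I.
have mpre (X : T -> MR) (J : set MR) : measurable_fun setT X -> measurable J ->
    measurable (X @^-1` J) by move=> mX mJ; rewrite -[X in measurable X]setTI; exact: mX.
have mI : measurable ([set` I] : set MR) by exact: measurable_itv.
rewrite -ZN//.
pose ball c : set R := `[c - e, c + e]%classic.
have mball c : measurable (ball c : set MR) by exact: measurable_itv.
have mD : measurable [set t | e < `|W t - Z t|].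
  have -> : [set t | e < `|W t - Z t|] = (fun t => `|W t - Z t|) @^-1` `]e, +oo[%classic.
    by apply/seteqP; split => t /=; rewrite in_itv/= andbT.
  apply: (mpre (fun t => `|W t - Z t|)) => //.
  by apply: measurableT_comp => //; exact: measurable_funB.
have mB c : measurable (Z @^-1` ball c) by exact: mpre.
have PB c : (P (Z @^-1` ball c) <= (2 * e)%:E)%E.
  by rewrite ZN//; exact: normal_prob_ball_le.
pose S := [set t | e < `|W t - Z t|] `|` (Z @^-1` ball a `|` Z @^-1` ball b).
have mS : measurable S by apply: measurableU => //; exact: measurableU.
have inball c z : `|z - c| <= e -> ball c z.
  by rewrite /ball/= in_itv/= ler_norml => /andP[? ?]; apply/andP; split; lra.
have key t : (Z t \in I) != (W t \in I) -> S t.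
  move=> ZW; have [We|We] := ltP e `|W t - Z t|; first by left.
  by right; have [/inball|/inball] := ab _ _ _ We ZW; [left|right].
apply: le_trans (probability_symdiff_le P _ _ mS _ _) _; try exact: mpre.
- move=> t /= WI; have [ZI|ZI] := boolP (Z t \in I); first by left.
  by right; apply: key; rewrite (negbTE ZI) WI.
- move=> t /= ZI; have [WI|WI] := boolP (W t \in I); first by left.
  by right; apply: key; rewrite (negbTE WI) ZI.
have fp X : measurable X -> P X = (fine (P X))%:E.
  by move=> mX; rewrite fineK// fin_num_measure.
rewrite -lee_fin EFinD -!fp//.
apply: (le_trans (measureU2 P mD (measurableU _ _ (mB a) (mB b)))).
rewrite leeD2l//; apply: (le_trans (measureU2 P (mB a) (mB b))).
rewrite (_ : 4 * e = 2 * e + 2 * e); last by ring.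
by rewrite EFinD; apply: leeD; exact: PB.
Qed.

(** Markov's inequality in a form suited to sums: [g] may have several nonnegative terms, of which
    only one has to reach 1 at a given point of [A]. *)
Lemma probability_le_integral d (T : measurableType d) (P : probability T R)
    (A : set T) (g : T -> \bar R) : measurable A ->
  measurable_fun [set: T] g -> (forall t, 0 <= g t)%E ->
  (forall t, A t -> 1 <= g t)%E -> (P A <= \int[P]_t g t)%E.
Proof.
move=> mA mg g0 Ag.
rewrite -[X in P X]setIT -(integral_indic P measurableT mA).
apply: ge0_le_integral => //.
- exact/measurable_EFinP/measurable_indic.
- move=> t _; rewrite indicE; case: (boolP (t \in A)) => [/set_mem/Ag//|_].
  exact: g0.
Qed.

End normal_approximation.

Section gaussian_perturbation.
Context {R : realType}.
Local Notation MR := (measurableTypeR R).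

Lemma measurable_lincomb_sqr n (u : 'I_n -> R) :
  measurable_fun [set: vec R n] (fun t => (lincomb u t ^+ 2)%:E : \bar R).
Proof.
apply/measurable_EFinP; apply: measurable_funX; exact: measurable_lincomb.
Qed.

Lemma integral_sum_lincomb_sqr_le n p (w : 'I_p -> 'I_n -> R) :
  (forall j, \sum_(i < n) w j i ^+ 2 = 1) ->
  (\int[stdgauss n]_t (\sum_(j < p) lincomb (w j) t ^+ 2)%:E <= (8 * p%:R : R)%:E)%E.
Proof.
move=> w1; under eq_integral do rewrite -sumEFin.
rewrite ge0_integral_sum//.
- apply: (@le_trans _ _ (\sum_(j < p) 8%:E)%E); last first.
    by rewrite sumEFin sumr_const card_ord lee_fin -(mulr_natr 8 p).
  apply: lee_sum => j _; apply: (le_trans (lincomb_second_moment_le _)).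
  by rewrite w1 mulr1.
- by move=> j; exact: measurable_lincomb_sqr.
- by move=> j t _; rewrite lee_fin sqr_ge0.
Qed.

(* Markov's inequality on each of the three error terms, with threshold e / 3;
   the factor 8 is the crude bound on the second moment of N(0, 1). *)
Lemma gaussian_perturbation n p (u v : 'I_n -> R) (w : 'I_p -> 'I_n -> R)
    (r c e : R) (I : interval R) (W : vec R n -> R) :
  0 < e -> \sum_(i < n) u i ^+ 2 = 1 ->
  (forall j, \sum_(i < n) w j i ^+ 2 = 1) ->
  (forall t, W t = lincomb u t +
     (r + lincomb v t + c * \sum_(j < p) lincomb (w j) t ^+ 2)) ->
  `|fine (stdgauss n (W @^-1` [set` I])) - fine (normal_prob 0 1 [set` I])| <=
  4 * e + (3 * `|r| / e + 72 * (\sum_(i < n) v i ^+ 2) / e ^+ 2 +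
           24 * `|c| * p%:R / e).
Proof.
move=> e0 u1 w1 WE.
have mZ := measurable_lincomb u.
have mW : measurable_fun [set: vec R n] (W : _ -> MR).
  rewrite (funext WE); apply: measurable_funD => //.
  apply: measurable_funD.
    by apply: measurable_funD => //; exact: measurable_lincomb.
  apply: measurable_funM => //; apply: measurable_sum => j.
  by apply: measurable_funX; exact: measurable_lincomb.
apply: (le_trans (normal_perturbation I (ltW e0) mZ mW _)).
  by move=> J mJ; exact: lincomb_normal.
rewrite addrC lerD2l.
pose S := [set t | e < `|W t - lincomb u t|].
have mS : measurable S.
  have -> : S = (fun t => `|W t - lincomb u t|) @^-1` `]e, +oo[%classic.
    by apply/seteqP; split => t /=; rewrite in_itv/= andbT.
  rewrite -[X in measurable X]setTI.
  have mf : measurable_fun [set: vec R n] (fun t => `|W t - lincomb u t| : MR).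
    by apply: measurableT_comp => //; exact: measurable_funB.
  exact: mf.
have sq0 (x : R) : (0 <= (x ^+ 2)%:E)%E by rewrite lee_fin sqr_ge0.
pose A := 3 * `|r| / e; pose B := 9 / e ^+ 2; pose C := 3 * `|c| / e.
have A0 : 0 <= A by rewrite divr_ge0 ?mulr_ge0// ltW.
have B0 : 0 <= B by rewrite divr_ge0 ?sqr_ge0.
have C0 : 0 <= C by rewrite divr_ge0 ?mulr_ge0// ltW.
pose q t := \sum_(j < p) lincomb (w j) t ^+ 2.
have q0 t : 0 <= q t by rewrite sumr_ge0// => j _; rewrite sqr_ge0.
have mq : measurable_fun [set: vec R n] (fun t => (q t)%:E : \bar R).
  apply/measurable_EFinP; apply: measurable_sum => j.
  by apply: measurable_funX; exact: measurable_lincomb.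
pose g t : \bar R := (A%:E + (B%:E * (lincomb v t ^+ 2)%:E + C%:E * (q t)%:E))%E.
have mBv : measurable_fun [set: vec R n] (fun t => B%:E * (lincomb v t ^+ 2)%:E : \bar R)%E.
  by apply: emeasurable_funM => //; exact: measurable_lincomb_sqr.
have mCq : measurable_fun [set: vec R n] (fun t => C%:E * (q t)%:E : \bar R)%E.
  exact: emeasurable_funM.
have g0 t : (0 <= g t)%E.
  by rewrite /g -!EFinM -!EFinD lee_fin !addr_ge0// mulr_ge0// sqr_ge0.
have mg : measurable_fun [set: vec R n] g.
  by apply: emeasurable_funD => //; exact: emeasurable_funD.
have Sg t : S t -> (1 <= g t)%E.
  rewrite /S/= WE addrC addKr => h.
  rewrite /g -!EFinM -!EFinD lee_fin.
  have e' : e != 0 by rewrite gt_eqF.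
  set l := lincomb v t in h *; rewrite -/(q t) in h.
  have [r1|r1] := leP (e / 3) `|r|.
    apply: ler_wpDr; first by rewrite addr_ge0// mulr_ge0// sqr_ge0.
    by rewrite /A ler_pdivlMr// mul1r; lra.
  have [l1|l1] := leP (e / 3) `|l|.
    apply: ler_wpDl => //; apply: ler_wpDr; first exact: mulr_ge0.
    rewrite /B -(real_normK (num_real l)).
    apply: (@le_trans _ _ (9 / e ^+ 2 * (e / 3) ^+ 2)).
      by rewrite le_eqVlt; apply/orP; left; apply/eqP; field.
    by rewrite ler_wpM2l// lerXn2r ?nnegrE ?divr_ge0// ltW.
  have h2 : e / 3 <= `|c| * q t.
    rewrite -(ger0_norm (q0 t)) -normrM.
    have := ler_normD (r + l) (c * q t); have := ler_normD r l; lra.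
  apply: ler_wpDl => //; apply: ler_wpDl; first by rewrite mulr_ge0// sqr_ge0.
  by rewrite /C mulrAC ler_pdivlMr// mul1r -mulrA; lra.
rewrite -lee_fin fineK; last exact: fin_num_measure.
have PS := @probability_le_integral _ _ _ (stdgauss n) S g mS mg g0 Sg.
apply: (le_trans PS).
rewrite [leLHS](_ : _ = A%:E + (B%:E * \int[stdgauss n]_t (lincomb v t ^+ 2)%:E +
    C%:E * \int[stdgauss n]_t (q t)%:E))%E.
  rewrite -addrA !EFinD; apply: leeD => //; apply: leeD.
    rewrite [in leRHS](_ : 72 * _ / _ = B * (8 * \sum_(i < n) v i ^+ 2)); last first.
      by rewrite /B; field; rewrite gt_eqF.
    by rewrite [leRHS]EFinM lee_wpmul2l ?lee_fin//; exact: lincomb_second_moment_le.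
  rewrite [in leRHS](_ : 24 * _ * _ / _ = C * (8 * p%:R)); last first.
    by rewrite /C; field; rewrite gt_eqF.
  by rewrite [leRHS]EFinM lee_wpmul2l ?lee_fin//; exact: integral_sum_lincomb_sqr_le.
rewrite /g ge0_integralD//.
- congr (_ + _)%E; first exact: (integral_probability_cst (stdgauss n) A%:E).
  rewrite ge0_integralD//.
  + congr (_ + _)%E; rewrite ge0_integralZl//.
    * exact: measurable_lincomb_sqr.
    * by move=> t _; rewrite lee_fin.
  + by move=> t _; rewrite -EFinM lee_fin mulr_ge0// sqr_ge0.
  + by move=> t _; rewrite -EFinM lee_fin mulr_ge0.
- by move=> t _; rewrite -!EFinM -!EFinD lee_fin addr_ge0// mulr_ge0// sqr_ge0.
- exact: emeasurable_funD.
Qed.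

End gaussian_perturbation.

(** * The posterior *)

Section orthogonal_design.
Context {R : realType}.

Lemma sqnormE n (v : 'cV[R]_n) : sqnorm v = (v^T *m v) 0 0.
Proof. by rewrite mxE; apply: eq_bigr => i _; rewrite mxE expr2. Qed.

Lemma sqnorm_ge0 n (v : 'cV[R]_n) : 0 <= sqnorm v.
Proof. by rewrite sumr_ge0// => i _; rewrite sqr_ge0. Qed.

(** This solves the normal equations when [A^T *m A = n%:R%:M]. *)
Definition lsq n k (A : 'M[R]_(n, k)) (Y : 'cV[R]_n) : 'cV[R]_k :=
  n%:R^-1 *: (A^T *m Y).

Variables (n k : nat) (A : 'M[R]_(n, k)).
Hypotheses (n0 : (0 < n)%N) (gramA : A^T *m A = n%:R%:M).

Let n_neq0 : n%:R != 0 :> R. Proof. by rewrite pnatr_eq0 -lt0n. Qed.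

Lemma sqnorm_design (t : 'cV[R]_k) : sqnorm (A *m t) = n%:R * sqnorm t.
Proof.
rewrite !sqnormE trmx_mul -mulmxA (mulmxA A^T) gramA mul_scalar_mx -scalemxAr.
by rewrite mxE.
Qed.

Lemma G_design (t : 'cV[R]_k) : G (A *m t) = sqnorm t.
Proof. by rewrite /G sqnorm_design mulrC mulKf. Qed.

Lemma orth_proj_design (Y : 'cV[R]_n) : orth_proj A *m Y = A *m lsq A Y.
Proof.
rewrite /orth_proj gramA invmx_scalar -mulmxA -mulmxA; congr (_ *m _).
by rewrite mul_scalar_mx.
Qed.

(** Pythagoras: the residual at [lsq A Y] is orthogonal to the columns of [A]. Only the last term
    depends on [t], and it is a sum over coordinates, which is why the likelihood factorises. *)
Lemma sqnorm_sub_design (t : 'cV[R]_k) (Y : 'cV[R]_n) :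
  sqnorm (Y - A *m t) =
  sqnorm Y - n%:R * sqnorm (lsq A Y) + n%:R * sqnorm (t - lsq A Y).
Proof.
have dotC m (x y : 'cV[R]_m) : (x^T *m y) 0 0 = (y^T *m x) 0 0.
  by rewrite !mxE; apply: eq_bigr => i _; rewrite !mxE mulrC.
have sq_sub m (x y : 'cV[R]_m) : sqnorm (x - y) =
    sqnorm x - 2 * (y^T *m x) 0 0 + sqnorm y.
  rewrite /sqnorm mxE mulr_sumr -sumrB -big_split/=.
  by apply: eq_bigr => i _; rewrite !mxE; ring.
rewrite [LHS]sq_sub sqnorm_design [sqnorm (t - _)]sq_sub.
have -> : ((A *m t)^T *m Y) 0 0 = n%:R * (t^T *m lsq A Y) 0 0.
  by rewrite trmx_mul -mulmxA /lsq -scalemxAr [in RHS]mxE mulVKf.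
by rewrite (dotC _ (lsq A Y) t); ring.
Qed.

End orthogonal_design.

Section gaussian_posterior.
Context {R : realType}.
Local Notation MR := (measurableTypeR R).

(** Precisions add: for one coefficient the prior contributes [1 / gamma] and the least-squares
    estimate [n / sigma ^+ 2]. [shrinkage] is the share of the data in the total precision, and
    [post_sd] is the inverse square root of that total. *)
Definition shrinkage (sigma gamma : R) n : R := n%:R / (n%:R + sigma ^+ 2 / gamma).
Definition post_sd (sigma gamma : R) n : R :=
  Num.sqrt (sigma ^+ 2 / (n%:R + sigma ^+ 2 / gamma)).

Variables (sigma gamma : R) (n : nat).
Hypotheses (sigma0 : 0 < sigma) (gamma0 : 0 < gamma) (n0 : (0 < n)%N).

Local Notation r := (shrinkage sigma gamma n).
Local Notation s := (post_sd sigma gamma n).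

Let sigma_neq0 : sigma != 0. Proof. by rewrite gt_eqF. Qed.
Let gamma_neq0 : gamma != 0. Proof. by rewrite gt_eqF. Qed.
Let nR0 : 0 < n%:R :> R. Proof. by rewrite ltr0n. Qed.
Let prec0 : 0 < n%:R + sigma ^+ 2 / gamma.
Proof. by rewrite addr_gt0// divr_gt0// exprn_gt0. Qed.

Lemma post_sd_gt0 : 0 < s.
Proof. by rewrite sqrtr_gt0 divr_gt0// exprn_gt0. Qed.

Lemma post_sd_sqr : s ^+ 2 = sigma ^+ 2 / (n%:R + sigma ^+ 2 / gamma).
Proof. by rewrite sqr_sqrtr// ltW// divr_gt0// exprn_gt0. Qed.

(** The factor of the likelihood carried by one coefficient [x] whose least-squares estimate is [m],
    without normalisation. *)
Definition coord_likelihood (m x : R) : R :=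
  expR (- (n%:R / (2 * sigma ^+ 2) * (x - m) ^+ 2)).

(** The mass of the prior density of [x] multiplied by [coord_likelihood m x]; being free of [x], it
    cancels in Bayes' formula. *)
Definition evidence (m : R) : R :=
  normal_peak (Num.sqrt gamma) / normal_peak s *
  expR (- (n%:R * m ^+ 2 * (1 - r) / (2 * sigma ^+ 2))).

Lemma evidence_gt0 m : 0 < evidence m.
Proof.
rewrite mulr_gt0 ?expR_gt0// divr_gt0// normal_peak_gt0// ?gt_eqF ?post_sd_gt0//.
by rewrite sqrtr_gt0.
Qed.

Lemma normal_conjugate (m x : R) :
  normal_pdf 0 (Num.sqrt gamma) x * coord_likelihood m x =
  evidence m * normal_pdf (r * m) s x.
Proof.
have sg : Num.sqrt gamma != 0 by rewrite gt_eqF// sqrtr_gt0.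
have s0 : s != 0 by rewrite gt_eqF// post_sd_gt0.
rewrite !normal_pdfE// /normal_fun /coord_likelihood /evidence.
have ps : normal_peak s != 0 by rewrite gt_eqF// normal_peak_gt0.
rewrite -[LHS]mulrA [RHS]mulrACA divfK// -!expRD; congr (_ * expR _).
rewrite sqr_sqrtr ?(ltW gamma0)// post_sd_sqr /shrinkage; field.
by rewrite sigma_neq0 gamma_neq0/= gt_eqF// (_ : _ + _ = gamma * (n%:R + sigma ^+ 2 / gamma)) ?mulr_gt0//; field.
Qed.

Lemma measurable_coord_likelihood m :
  measurable_fun [set: MR] (coord_likelihood m : _ -> MR).
Proof.
apply: measurableT_comp => //; apply: measurableT_comp => //.
apply: measurable_funM => //; apply: measurable_funX.
exact: measurable_funB.
Qed.

Lemma ge0_integral_normal_conjugate (m : R) (f : R -> \bar R) :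
  measurable_fun [set: MR] f -> (forall x, 0 <= f x)%E ->
  (\int[normal_prob 0%R (Num.sqrt gamma)]_x (f x * (coord_likelihood m x)%:E) =
  (evidence m)%:E * \int[normal_prob (r * m) s]_x f x)%E.
Proof.
move=> mf f0.
have mL := measurable_coord_likelihood m.
have mfL : measurable_fun [set: MR] (fun x => f x * (coord_likelihood m x)%:E)%E.
  by apply: emeasurable_funM => //; exact/measurable_EFinP.
have fL0 x : (0 <= f x * (coord_likelihood m x)%:E)%E.
  by rewrite mule_ge0// lee_fin expR_ge0.
rewrite (ge0_integral_normal_prob 0 (Num.sqrt gamma) mfL fL0).
rewrite (ge0_integral_normal_prob (r * m) s mf f0).
rewrite -ge0_integralZl//.
- apply: eq_integral => x _; rewrite -muleA -EFinM (mulrC (coord_likelihood _ _)).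
  by rewrite normal_conjugate EFinM muleCA.
- apply: emeasurable_funM => //; apply/measurable_EFinP.
  exact: measurable_normal_pdf.
- by move=> x _; rewrite mule_ge0// lee_fin normal_pdf_ge0.
- by rewrite lee_fin ltW// evidence_gt0.
Qed.

End gaussian_posterior.

Section posterior_law.
Context {R : realType}.
Local Notation MR := (measurableTypeR R).

Lemma cvec_lin_tuple n k (A : 'M[R]_(n, k)) (t : vec R k) :
  cvec (lin_tuple A t) = A *m cvec t.
Proof. by apply/colP => i; rewrite mxE tnth_mktuple. Qed.

Lemma normal_pdf_sym (m s x : R) : s != 0 -> normal_pdf m s x = normal_pdf x s m.
Proof. by move=> s0; rewrite !normal_pdfE// /normal_fun -(sqrrN (x - m)) opprB. Qed.

Lemma likelihood_sqnorm sigma n (F Y : vec R n) : sigma != 0 ->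
  likelihood sigma F Y = normal_peak sigma ^+ n *
    expR (- sqnorm (cvec Y - cvec F) / (2 * sigma ^+ 2)).
Proof.
move=> s0; rewrite /likelihood; under eq_bigr do rewrite normal_pdfE//.
rewrite big_split/= prodr_const card_ord; congr (_ * _).
rewrite /sqnorm mulNr mulr_suml -sumrN expR_sum; apply: eq_bigr => i _.
by rewrite /normal_fun !mxE mulNr mulr_natl.
Qed.

Lemma likelihood_design sigma n k (A : 'M[R]_(n, k)) (t : vec R k) (Y : vec R n) :
  sigma != 0 -> (0 < n)%N -> A^T *m A = n%:R%:M ->
  likelihood sigma (lin_tuple A t) Y =
  normal_peak sigma ^+ n * expR (- (sqnorm (cvec Y) -
      n%:R * sqnorm (lsq A (cvec Y))) / (2 * sigma ^+ 2)) *
  \prod_(j < k) coord_likelihood sigma n (lsq A (cvec Y) j 0) (tnth t j).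
Proof.
move=> s0 n0 gA; rewrite likelihood_sqnorm// cvec_lin_tuple sqnorm_sub_design//.
rewrite -expR_sum -mulrA -expRD; congr (_ * expR _).
rewrite opprD mulrDl; congr (_ + _).
rewrite /sqnorm mulr_sumr -sumrN mulr_suml; apply: eq_bigr => j _.
by rewrite !mxE mulNr mulrAC.
Qed.

(** For every set, the unnormalised Bayes integral is one and the same constant times a Gaussian
    mass, so the constant cancels in the quotient. Writing that Gaussian as an affine image of the
    standard one makes the perturbation bounds for linear forms applicable to the posterior. *)
Lemma posteriorE sigma gamma n k (A : 'M[R]_(n, k)) (Y : vec R n)
    (B : set (vec R n)) :
  0 < sigma -> 0 < gamma -> (0 < n)%N -> A^T *m A = n%:R%:M -> measurable B ->
  posterior sigma (distribution (gaussian (0 : 'cV[R]_k) (Num.sqrt gamma)) (lin_tuple A)) Y B =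
  fine (stdgauss k ((fun xi => lin_tuple A (map_coords (fun j =>
    affine (post_sd sigma gamma n) (shrinkage sigma gamma n * lsq A (cvec Y) j 0)) xi)) @^-1` B)).
Proof.
move=> sigma0 gamma0 n0 gA mB.
have sn0 : sigma != 0 by rewrite gt_eqF.
set r := shrinkage _ _ _; set s := post_sd _ _ _.
set th := lsq A (cvec Y).
pose K := normal_peak sigma ^+ n * expR (- (sqnorm (cvec Y) -
      n%:R * sqnorm th) / (2 * sigma ^+ 2)).
have K0 : 0 < K by rewrite mulr_gt0 ?expR_gt0// exprn_gt0// normal_peak_gt0.
pose C := \prod_(j < k) evidence sigma gamma n (th j 0).
have C0 : 0 < C by rewrite prodr_gt0// => j _; exact: evidence_gt0.
have s0 : s != 0 by rewrite gt_eqF// post_sd_gt0.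
pose Q := gaussian (r *: th) s.
(* [K] collects the factors common to all coefficients and [C] the evidences; this is applied to [B]
   and to the whole space. *)
have likE (D : set (vec R n)) : measurable D ->
  \int[distribution (gaussian (0 : 'cV[R]_k) (Num.sqrt gamma)) (lin_tuple A)]_(F in D)
     likelihood sigma F Y = K * C * fine (Q (lin_tuple A @^-1` D)).
  move=> mD; rewrite /Rintegral; set W := distribution _ _.
  have mlik : measurable_fun [set: vec R n] (fun F => (likelihood sigma F Y)%:E : \bar R).
    apply/measurable_EFinP; apply: measurable_prod => i _.
    apply: (eq_measurable_fun (fun F : vec R n => normal_pdf (tnth Y i) sigma (tnth F i))).
      by move=> F _; exact: normal_pdf_sym.
    apply: (measurableT_comp (@measurable_normal_pdf R (tnth Y i) sigma)).
    exact: measurable_tnth.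
  have mD' : measurable (lin_tuple A @^-1` D).
    by rewrite -[X in measurable X]setTI; exact: (measurable_lin_tuple A).
  have lik0 F : 0 <= likelihood sigma F Y.
    by rewrite prodr_ge0// => i _; exact: normal_pdf_ge0.
  have mI : measurable_fun [set: vec R n] (fun F => (\1_D F)%:E : \bar R).
    exact/measurable_EFinP/measurable_indic.
  have mI' : measurable_fun [set: vec R k] (fun t => (\1_(lin_tuple A @^-1` D) t)%:E : \bar R).
    exact/measurable_EFinP/measurable_indic.
  transitivity (fine (\int[W]_F ((\1_D F)%:E * (likelihood sigma F Y)%:E))%E).
    congr fine; rewrite integral_mkcond; apply: eq_integral => F _.
    by rewrite patchE indicE; case: (F \in D); rewrite ?mul1e ?mul0e.
  rewrite ge0_integral_distribution; last 2 first.
  - exact: emeasurable_funM.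
  - by move=> F; rewrite mule_ge0 ?lee_fin.
  transitivity (fine (\int[gaussian (0 : 'cV[R]_k) (Num.sqrt gamma)]_t (K%:E *
     ((\1_(lin_tuple A @^-1` D) t)%:E *
      (\prod_(j < k) coord_likelihood sigma n (th j 0) (tnth t j))%:E))))%E.
    congr fine; apply: eq_integral => t _.
    by rewrite /= likelihood_design// EFinM muleCA.
  have mL : measurable_fun [set: vec R k] (fun t => (\1_(lin_tuple A @^-1` D) t)%:E *
      (\prod_(j < k) coord_likelihood sigma n (th j 0) (tnth t j))%:E : \bar R)%E.
    apply: emeasurable_funM => //; apply/measurable_EFinP.
    apply: measurable_prod => j _.
    apply: (measurableT_comp (measurable_coord_likelihood sigma n (th j 0))).
    exact: measurable_tnth.
  rewrite ge0_integralZl//; last 2 first.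
  - move=> t _; rewrite mule_ge0 ?lee_fin// prodr_ge0// => j _.
    exact: expR_ge0.
  - by rewrite lee_fin ltW.
  have E : (\int[gaussian (0 : 'cV[R]_k) (Num.sqrt gamma)]_t
     ((\1_(lin_tuple A @^-1` D) t)%:E *
      (\prod_(j < k) coord_likelihood sigma n (th j 0) (tnth t j))%:E) =
     C%:E * \int[Q]_t (\1_(lin_tuple A @^-1` D) t)%:E)%E.
    rewrite gaussian0E.
    have map_id (t : vec R k) : map_coords (fun (_ : 'I_k) (x : MR) => x) t = t.
      by apply: eq_from_tnth => j; rewrite tnth_mktuple.
    have := @ge0_integral_prod_prob_change _ _ MR MR R k
      (fun=> normal_prob 0 (Num.sqrt gamma))
      (fun j => normal_prob ((r *: th) j 0) s) (fun _ x => x)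
      (fun j => coord_likelihood sigma n (th j 0))
      (fun j => evidence sigma gamma n (th j 0))
      (fun t => (\1_(lin_tuple A @^-1` D) t)%:E).
    move=> H; rewrite -[RHS]H; last 7 first.
    + by move=> j; exact: measurable_id.
    + by move=> j; exact: measurable_coord_likelihood.
    + by move=> j x; exact: expR_ge0.
    + by move=> j; rewrite ltW// evidence_gt0.
    + move=> j f mf f0; have -> : (r *: th) j 0 = r * th j 0 by rewrite mxE.
      exact: (ge0_integral_normal_conjugate sigma0 gamma0 n0 (th j 0) mf f0).
    + exact: mI'.
    + by move=> t; rewrite lee_fin.
    by apply: eq_integral => t _; rewrite map_id.
  have IQ : (\int[Q]_t (\1_(lin_tuple A @^-1` D) t)%:E = Q (lin_tuple A @^-1` D))%E.
    rewrite -[X in _ = Q X]setIT; exact: (integral_indic Q measurableT mD').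
  rewrite E IQ muleA -EFinM fineM//; last exact: fin_num_measure.
have QE D : measurable D -> Q D = stdgauss k
    (map_coords (fun j => affine s (r * th j 0)) @^-1` D).
  move=> mD.
  have mI : measurable_fun [set: vec R k] (fun t => (\1_D t)%:E : \bar R).
    exact/measurable_EFinP/measurable_indic.
  have mD' : measurable (map_coords (fun j => affine s (r * th j 0)) @^-1` D).
    rewrite -[X in measurable X]setTI; apply: (measurable_map_coords _ measurableT mD).
    by move=> j; exact: measurable_affine.
  transitivity (\int[Q]_t (\1_D t)%:E)%E.
    rewrite -[X in Q X = _]setIT; exact/esym/(integral_indic Q measurableT mD).
  rewrite (ge0_integral_gaussian _ s0 mI); last by move=> t; rewrite lee_fin.
  rewrite -[X in _ = stdgauss k X]setIT.
  rewrite -[RHS](integral_indic (stdgauss k) measurableT mD').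
  have mE : (fun j => affine s ((r *: th) j 0)) = (fun j => affine s (r * th j 0)).
    by apply/funext => j; rewrite mxE.
  by apply: eq_integral => t _; rewrite mE.
rewrite /posterior !likE// preimage_setT QE; last first.
  by rewrite -[X in measurable X]setTI; exact: (measurable_lin_tuple A).
have -> : fine (Q [set: vec R k]) = 1 by rewrite (probability_setT Q).
rewrite mulr1 mulrC mulKf//.
by rewrite mulf_neq0// gt_eqF.
Qed.

End posterior_law.

(** * The Fourier basis on the grid *)

Section discrete_orthogonality.
Context {R : realType}.
Implicit Types (n m l : nat) (x : R).

Lemma cos_2pin m : cos (2 * pi * m%:R) = 1 :> R.
Proof.
have := periodicn (@cosD2pi R) m 0; rewrite add0r cos0.
by rewrite mulr_natr mulr_natl.
Qed.

Lemma sin_2pin m : sin (2 * pi * m%:R) = 0 :> R.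
Proof.
have := periodicn (@sinD2pi R) m 0; rewrite add0r sin0.
by rewrite mulr_natr mulr_natl.
Qed.

(** [1 - cos x = 2 * sin (x / 2) ^+ 2], and [x / 2] lies strictly between 0 and [pi]. *)
Lemma cos_lt1 x : 0 < x < 2 * pi -> cos x != 1.
Proof.
move=> /andP[x0 x2].
have s0 : 0 < sin (x / 2) by apply: sin_gt0_pi; apply/andP; split; lra.
have -> : x = (x / 2) *+ 2 by rewrite mulr2n; field.
rewrite cos_mulr2n cos2sin2; apply/negP => /eqP h.
have : 0 < sin (x / 2) ^+ 2 by rewrite exprn_gt0.
by move: h; rewrite mulr2n; lra.
Qed.

(** The design points are indexed from 1 to [n]; by periodicity the sums can also run from 0 to
    [n - 1], and this freedom drives the next lemma. *)
Lemma sum_shift (n : nat) (F : nat -> R) : F n = F 0%N ->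
  \sum_(i < n) F i.+1 = \sum_(i < n) F i.
Proof.
move=> Fn; apply: (addIr (F 0%N)).
rewrite addrC -(big_ord_recl n (fun i => F i)) big_ord_recr/= Fn.
by [].
Qed.

(** Moving each grid point by one step permutes the grid modulo the period and rotates the vector
    [(C, S)] by the angle [x = 2 pi m / n]. So [(C, S)] is fixed by a rotation other than the
    identity and vanishes: the geometric sum of roots of unity, in real form. *)
Lemma sum_cos_sin_grid n m : (0 < m < n)%N ->
  \sum_(i < n) cos (2 * pi * m%:R * design_pt R i) = 0 /\
  \sum_(i < n) sin (2 * pi * m%:R * design_pt R i) = 0.
Proof.
move=> /andP[m0 mn]; have n0 : (0 < n)%N by exact: leq_trans mn.
have nR : n%:R != 0 :> R by rewrite pnatr_eq0 -lt0n.
pose x : R := 2 * pi * m%:R / n%:R.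
have E (i : 'I_n) : 2 * pi * m%:R * design_pt R i = x * i.+1%:R.
  by rewrite /design_pt /x; ring.
under eq_bigr do rewrite E; under [in X in _ /\ X = _]eq_bigr do rewrite E.
have xn : x * n%:R = 2 * pi * m%:R by rewrite /x; field.
rewrite (@sum_shift n (fun i => cos (x * i%:R))); last first.
  by rewrite xn cos_2pin mulr0 cos0.
rewrite (@sum_shift n (fun i => sin (x * i%:R))); last first.
  by rewrite xn sin_2pin mulr0 sin0.
set C := \sum_(i < n) _; set S := \sum_(i < n) _.
have EC : C = cos x * C - sin x * S.
  rewrite {1}/C -(@sum_shift n (fun i => cos (x * i%:R))); last first.
    by rewrite xn cos_2pin mulr0 cos0.
  rewrite /C /S !mulr_sumr -sumrB; apply: eq_bigr => i _.
  by rewrite -natr1 mulrDr mulr1 cosD; ring.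
have ES : S = sin x * C + cos x * S.
  rewrite {1}/S -(@sum_shift n (fun i => sin (x * i%:R))); last first.
    by rewrite xn sin_2pin mulr0 sin0.
  rewrite /C /S !mulr_sumr -big_split/=; apply: eq_bigr => i _.
  by rewrite -natr1 mulrDr mulr1 sinD; ring.
have c1 : cos x != 1.
  apply: cos_lt1; apply/andP; split.
    by rewrite /x divr_gt0 ?ltr0n// mulr_gt0 ?ltr0n// mulr_gt0 ?pi_gt0.
  rewrite /x ltr_pdivrMr ?ltr0n// ltr_pM2l ?ltr_nat// mulr_gt0 ?pi_gt0//.
(* [2 * (1 - cos x)] is the determinant of the identity minus the rotation; the combinations below
   solve the fixed-point equations by Cramer's rule. *)
have d0 : 2 * (1 - cos x) != 0 by rewrite mulf_neq0// subr_eq0 eq_sym.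
have cs := cos2Dsin2 x.
split; apply: (mulfI d0); rewrite mulr0.
- transitivity ((1 - cos x) * (C - (cos x * C - sin x * S)) - sin x * (S - (sin x * C + cos x * S))
    + C * (1 - (cos x ^+ 2 + sin x ^+ 2))); first by ring.
  by rewrite -EC -ES cs !subrr !mulr0 subr0 addr0.
- transitivity ((1 - cos x) * (S - (sin x * C + cos x * S)) + sin x * (C - (cos x * C - sin x * S))
    + S * (1 - (cos x ^+ 2 + sin x ^+ 2))); first by ring.
  by rewrite -EC -ES cs !subrr !mulr0 !addr0.
Qed.

Lemma fourier1 x : fourier 1 x = 1. Proof. by []. Qed.

Lemma fourier_even m x : (0 < m)%N ->
  fourier m.*2 x = Num.sqrt 2 * cos (2 * pi * m%:R * x).
Proof.
by move=> m0; rewrite /fourier doubleK odd_double ifF//; case: m m0.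
Qed.

Lemma fourier_odd m x : (0 < m)%N ->
  fourier m.*2.+1 x = Num.sqrt 2 * sin (2 * pi * m%:R * x).
Proof.
move=> m0; rewrite /fourier/= uphalf_double odd_double/= ifF//.
by case: m m0.
Qed.

Let sqrt2 : Num.sqrt 2 * Num.sqrt 2 = 2 :> R.
Proof. by rewrite -expr2 sqr_sqrtr. Qed.

(* M is the average over the grid or over [0, 1]. *)
Lemma fourier_orthonormal_of_mean (M : (R -> R) -> R) (K : nat) :
  (forall (a b : R) (g h : R -> R), continuous g -> continuous h ->
     M (fun x => a * g x + b * h x) = a * M g + b * M h) ->
  M (fun=> 1) = 1 ->
  (forall m, (0 < m < K)%N -> M (fun x => cos (2 * pi * m%:R * x)) = 0 /\
                              M (fun x => sin (2 * pi * m%:R * x)) = 0) ->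
  forall l l', (0 < l)%N -> (0 < l')%N -> (l./2 + l'./2 < K)%N ->
  M (fun x => fourier l x * fourier l' x) = (l == l')%:R.
Proof.
move=> Mlin M1 Mcs.
pose c (m : nat) (x : R) : R := cos (2 * pi * m%:R * x).
pose s (m : nat) (x : R) : R := sin (2 * pi * m%:R * x).
have cc m : continuous (c m).
  move=> x; apply: continuous_comp; last exact: continuous_cos.
  by apply: cvgM; [exact: cvg_cst|exact: cvg_id].
have cs m : continuous (s m).
  move=> x; apply: continuous_comp; last exact: continuous_sin.
  by apply: cvgM; [exact: cvg_cst|exact: cvg_id].
have Mc m : (m < K)%N -> M (c m) = (m == 0%N)%:R.
  case: m => [_|m mK]; last by have [] := Mcs m.+1 mK.
  by rewrite -[RHS]M1; congr M; apply/funext => x; rewrite /c mulr0 mul0r cos0.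
have Ms m : (m < K)%N -> M (s m) = 0.
  case: m => [_|m mK]; last by have [] := Mcs m.+1 mK.
  transitivity (M (fun x => 0 * c 0 x + 0 * c 0 x)).
    by congr M; apply/funext => x; rewrite /s mulr0 mul0r sin0; ring.
  by rewrite Mlin// !mul0r addr0.
(* The distance between two frequencies: at least one of the truncated differences is 0. *)
pose D m m' := ((m - m') + (m' - m))%N.
have DK m m' : (m + m' < K)%N -> (D m m' < K)%N by rewrite /D; lia.
have D0 m m' : (D m m' == 0%N) = (m == m') by rewrite /D; lia.
have cD m m' x : c (D m m') x = c m x * c m' x + s m x * s m' x.
  rewrite /c /s /D -cosB; have [mm|mm] := leqP m' m.
    rewrite (eqP mm) addn0 natrB//; congr cos; ring.
  rewrite (eqP (ltnW mm)) add0n natrB ?(ltnW mm)// -cosN; congr cos; ring.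
have cA m m' x : c (m + m')%N x = c m x * c m' x - s m x * s m' x.
  by rewrite /c /s -cosD natrD; congr cos; ring.
have sA m m' x : s (m + m')%N x = s m x * c m' x + c m x * s m' x.
  by rewrite /c /s -sinD natrD; congr sin; ring.
have McM m m' : (m + m' < K)%N -> M (fun x => c m x * c m' x) =
    2^-1 * (m == m')%:R + 2^-1 * (m + m' == 0)%N%:R.
  move=> mK; rewrite -D0 -!Mc ?DK// -Mlin//; congr M; apply/funext => x.
  by rewrite cD cA; field.
have MsM m m' : (m + m' < K)%N -> M (fun x => s m x * s m' x) =
    2^-1 * (m == m')%:R + - 2^-1 * (m + m' == 0)%N%:R.
  move=> mK; rewrite -D0 -!Mc ?DK// -Mlin//; congr M; apply/funext => x.
  by rewrite cD cA; field.
have Msc m m' : (m + m' < K)%N -> M (fun x => s m x * c m' x) = 0.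
  move=> mK; have sD x : s m x * c m' x - c m x * s m' x =
      (if (m' <= m)%N then 1 else -1) * s (D m m') x.
    rewrite /c /s /D -sinB; have [mm|mm] := leqP m' m.
      by rewrite (eqP mm) addn0 natrB// mul1r; congr sin; ring.
    rewrite (eqP (ltnW mm)) add0n natrB ?(ltnW mm)// mulN1r -sinN; congr sin; ring.
  transitivity (M (fun x => 2^-1 * s (m + m')%N x +
      2^-1 * (if (m' <= m)%N then 1 else -1) * s (D m m') x)).
    by congr M; apply/funext => x; rewrite -mulrA -sD sA; field.
  by rewrite Mlin// !Ms ?DK// !mulr0 addr0.
have split_index l : (0 < l)%N -> l = 1%N \/ exists2 m, (0 < m)%N & l = m.*2 \/ l = m.*2.+1.
  move=> l0; have [lo|lo] := boolP (odd l).
    have [l1|l1] := eqVneq l 1%N; first by left.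
    by right; exists l./2; [lia|right; lia].
  by right; exists l./2; [lia|left; lia].
have scale (a : R) (g : R -> R) : continuous g -> M (fun x => a * g x) = a * M g.
  move=> cg; transitivity (M (fun x => a * g x + 0 * g x)).
    by congr M; apply/funext => x; ring.
  by rewrite Mlin// mul0r addr0.
have ctsM (g h : R -> R) : continuous g -> continuous h -> continuous (fun x => g x * h x : R).
  by move=> cg ch x; apply: cvgM; [exact: cg|exact: ch].
have sym l l' : M (fun x => fourier l x * fourier l' x) = M (fun x => fourier l' x * fourier l x).
  by congr M; apply/funext => x; rewrite mulrC.
have prod2 (a b : R) : Num.sqrt 2 * a * (Num.sqrt 2 * b) = 2 * (a * b).
  by rewrite mulrACA sqrt2.
have one_l l : (0 < l)%N -> (l./2 < K)%N -> M (fun x => fourier 1 x * fourier l x) = (1%N == l)%:R.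
  move=> l0; have [->|[m m0 [->|->]]] := split_index _ l0.
  - by move=> _; rewrite -[RHS]M1; congr M; apply/funext => x; rewrite fourier1 mulr1.
  - rewrite doubleK => mK; transitivity (M (fun x => Num.sqrt 2 * c m x)).
      by congr M; apply/funext => x; rewrite fourier1 mul1r fourier_even.
    by rewrite scale// Mc// gtn_eqF// mulr0 (_ : (1%N == m.*2) = false)//; lia.
  - rewrite /= uphalf_double => mK; transitivity (M (fun x => Num.sqrt 2 * s m x)).
      by congr M; apply/funext => x; rewrite fourier1 mul1r fourier_odd.
    by rewrite scale// Ms// mulr0 (_ : (1%N == m.*2.+1) = false)//; lia.
move=> l l' l0 l'0.
have [->|[m m0 lE]] := split_index _ l0; first by rewrite add0n; exact: one_l.
have [->|[m' m'0 lE']] := split_index _ l'0.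
  by rewrite addn0 sym eq_sym; exact: one_l.
have mm0 : (m + m' == 0)%N = false by lia.
case: lE => ->; case: lE' => ->; rewrite ?doubleK /= ?uphalf_double ?doubleK => mK.
- transitivity (M (fun x => 2 * (c m x * c m' x))).
    by congr M; apply/funext => x; rewrite !fourier_even// prod2.
  rewrite scale; last exact: ctsM.
  rewrite McM// mm0 mulr0 addr0 mulVKf//; congr (_%:R); lia.
- transitivity (M (fun x => 2 * (s m' x * c m x))).
    by congr M; apply/funext => x; rewrite fourier_even// fourier_odd// prod2 [X in 2 * X]mulrC.
  rewrite scale; last exact: ctsM.
  by rewrite Msc ?mulr0 1?addnC// (_ : (_ == _) = false)//; lia.
- transitivity (M (fun x => 2 * (s m x * c m' x))).
    by congr M; apply/funext => x; rewrite fourier_even// fourier_odd// prod2.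
  rewrite scale; last exact: ctsM.
  by rewrite Msc ?mulr0// (_ : (_ == _) = false)//; lia.
- transitivity (M (fun x => 2 * (s m x * s m' x))).
    by congr M; apply/funext => x; rewrite !fourier_odd// prod2.
  rewrite scale; last exact: ctsM.
  rewrite MsM// mm0 mulr0 addr0 mulVKf//; congr (_%:R); lia.
Qed.

(** The product-to-sum formulas produce the sum of the two frequencies as well as their difference;
    staying below [n] keeps both from aliasing to the constant. Bounding the sum, rather than each
    index, later allows one of the two indices to exceed [k]. *)
Lemma fourier_gram n l l' : (0 < l)%N -> (0 < l')%N -> (l./2 + l'./2 < n)%N ->
  \sum_(i < n) fourier l (design_pt R i) * fourier l' (design_pt R i) =
  n%:R * (l == l')%:R.
Proof.
move=> l0 l'0 ln; have n0 : n%:R != 0 :> R by rewrite pnatr_eq0; lia.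
pose M (g : R -> R) := n%:R^-1 * \sum_(i < n) g (design_pt R i).
rewrite -(@fourier_orthonormal_of_mean M n)//; first by rewrite mulVKf.
- move=> a b g h _ _; rewrite /M big_split/= -!mulr_sumr; ring.
- by rewrite /M sumr_const card_ord mulVf.
- by move=> m /sum_cos_sin_grid[c s]; rewrite /M c s mulr0.
Qed.

Lemma gram_design n k : (k < n)%N -> (design R n k)^T *m design R n k = n%:R%:M.
Proof.
move=> kn; apply/matrixP => i j; rewrite !mxE.
under eq_bigr do rewrite !mxE.
rewrite fourier_gram//; last by have := ltn_ord i; have := ltn_ord j; lia.
by rewrite eqSS mulr_natr.
Qed.

End discrete_orthogonality.

(** * Blocks of frequencies on the grid and summable weights *)

Section block_bound.
Context {R : realType}.
Implicit Types (theta : nat -> R) (x : R).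

Definition freq_term theta m x : R :=
  theta m.*2 * fourier m.*2 x + theta m.*2.+1 * fourier m.*2.+1 x.

Definition freq_energy theta m : R := theta m.*2 ^+ 2 + theta m.*2.+1 ^+ 2.

(* On n consecutive frequencies the complex exponentials are orthogonal on the
   grid; the real trigonometric sum is bounded by the modulus of a complex one. *)
Lemma block_sqr_le n theta (a b : nat) : (0 < a)%N -> (b <= a + n)%N ->
  \sum_(i < n) (\sum_(a <= m < b) freq_term theta m (design_pt R i)) ^+ 2 <=
  2 * n%:R * \sum_(a <= m < b) freq_energy theta m.
Proof.
move=> a0 ban.
pose c m (i : 'I_n) : R := cos (2 * pi * m%:R * design_pt R i).
pose s m (i : 'I_n) : R := sin (2 * pi * m%:R * design_pt R i).
(* [A] and [B] are the real and imaginary parts of the sum of [(theta m.*2 - i theta m.*2.+1) * exp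
   (2 pi i m x)] at a grid point [x]. *)
pose A i := \sum_(a <= m < b) (theta m.*2 * c m i + theta m.*2.+1 * s m i).
pose B i := \sum_(a <= m < b) (theta m.*2 * s m i - theta m.*2.+1 * c m i).
have AE i : \sum_(a <= m < b) freq_term theta m (design_pt R i) = Num.sqrt 2 * A i.
  rewrite /A mulr_sumr; apply: eq_big_nat => m /andP[am _].
  by rewrite /freq_term fourier_even ?fourier_odd ?(leq_trans a0)// -/(c m i) -/(s m i); ring.
(* Only differences of frequencies occur in [A ^+ 2 + B ^+ 2], and within a block they stay below
   [n]; the square of [A] alone would also bring in the sums [m + m'], which may alias. *)
have Elt m m' : (a <= m < b)%N -> (a <= m' < b)%N -> (m < m')%N ->
    \sum_(i < n) (c m i * c m' i + s m i * s m' i) = 0 /\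
    \sum_(i < n) (c m i * s m' i - s m i * c m' i) = 0.
  move=> mab mab' mm; have h : (0 < m' - m < n)%N by lia.
  have [hc hs] := @sum_cos_sin_grid R n _ h; split.
    rewrite -[RHS]hc; apply: eq_bigr => i _; rewrite natrB ?(ltnW mm)//.
    by rewrite mulrBr mulrBl cosB /c /s; ring.
  rewrite -[RHS]hs; apply: eq_bigr => i _; rewrite natrB ?(ltnW mm)//.
  by rewrite mulrBr mulrBl sinB /c /s; ring.
have E m m' : (a <= m < b)%N -> (a <= m' < b)%N ->
    \sum_(i < n) (c m i * c m' i + s m i * s m' i) = n%:R * (m == m')%:R /\
    \sum_(i < n) (c m i * s m' i - s m i * c m' i) = 0.
  move=> mab mab'; have [mm|mm|<-] := ltngtP m m'.
  - by have [-> ->] := Elt _ _ mab mab' mm; rewrite mulr0.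
  - have [h1 h2] := Elt _ _ mab' mab mm; rewrite mulr0; split.
      by rewrite -[RHS]h1; apply: eq_bigr => i _; ring.
    by rewrite -[RHS]oppr0 -[in RHS]h2 -sumrN; apply: eq_bigr => i _; ring.
  - split; last by rewrite big1// => i _; ring.
    rewrite mulr1 (eq_bigr (fun=> 1)) ?sumr_const ?card_ord// => i _.
    by rewrite -!expr2 cos2Dsin2.
have AB : \sum_(i < n) (A i ^+ 2 + B i ^+ 2) =
    n%:R * \sum_(a <= m < b) freq_energy theta m.
  transitivity (\sum_(i < n) \sum_(a <= m < b) \sum_(a <= m' < b)
     ((theta m.*2 * theta m'.*2 + theta m.*2.+1 * theta m'.*2.+1) *
        (c m i * c m' i + s m i * s m' i) +
      (theta m.*2 * theta m'.*2.+1 - theta m.*2.+1 * theta m'.*2) *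
        (c m i * s m' i - s m i * c m' i))).
    apply: eq_bigr => i _; rewrite !expr2 /A /B !big_distrlr/= -big_split/=.
    apply: eq_bigr => m _; rewrite -big_split/=; apply: eq_bigr => m' _; ring.
  rewrite exchange_big/= mulr_sumr; apply: eq_big_nat => m mab.
  rewrite exchange_big/= (bigD1_seq m) ?mem_index_iota ?iota_uniq//=.
  rewrite [X in _ + X]big1_seq ?addr0 => [|m' /andP[mm]]; rewrite ?mem_index_iota.
    rewrite big_split/= -!mulr_sumr; have [-> ->] := E _ _ mab mab.
    by rewrite eqxx mulr1 mulr0 addr0 /freq_energy; ring.
  move=> mab'; rewrite big_split/= -!mulr_sumr; have [-> ->] := E _ _ mab mab'.
  by rewrite eq_sym (negbTE mm) !mulr0 addr0.
under eq_bigr do rewrite AE exprMn sqr_sqrtr//.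
rewrite -mulr_sumr -mulrA ler_pM2l// -AB; apply: ler_sum => i _.
by rewrite lerDl sqr_ge0.
Qed.

Lemma sum_pairs (F : nat -> R) a b : (0 < a)%N -> (a <= b)%N ->
  \sum_(1 <= l < b.*2) F l =
  \sum_(1 <= l < a.*2) F l + \sum_(a <= m < b) (F m.*2 + F m.*2.+1).
Proof.
move=> a0 /subnK <-; elim: (b - a)%N => [|d IH]; first by rewrite [X in _ + X]big_geq// addr0.
have h1 : (1 <= (d + a).*2)%N by lia.
rewrite addSn doubleS !big_nat_recr ?leq_addl ?(leq_trans h1)//=.
by rewrite IH !addrA.
Qed.

Lemma sum_blocks N T (F : nat -> R) :
  \sum_(N <= m < T.+1 * N) F m =
  \sum_(1 <= p < T.+1) \sum_(p * N <= m < p.+1 * N) F m.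
Proof.
elim: T => [|T IH]; first by rewrite mul1n !big_geq.
rewrite [RHS]big_nat_recr//= -IH (@big_cat_nat _ _ _ (T.+1 * N))//.
  by rewrite leq_pmull.
by rewrite leq_mul2r leqnSn orbT.
Qed.

(** Induction on [r]. The new cross term [2 * g p * S] is at most [P]: the two summands of [P] have
    product [Z * Q * g p ^+ 2], and [S ^+ 2 <= Z * Q] by induction, so this is the inequality of
    arithmetic and geometric means. *)
Lemma weighted_cauchy_schwarz (I : eqType) (r : seq I) (u g : I -> R) :
  {in r, forall p, 0 < u p} ->
  (\sum_(p <- r) g p) ^+ 2 <= (\sum_(p <- r) (u p)^-1) * \sum_(p <- r) u p * g p ^+ 2.
Proof.
elim: r => [|p r IH] u0; first by rewrite !big_nil expr0n mul0r.
have ur i : i \in r -> 0 < u i by move=> ir; apply: u0; rewrite inE ir orbT.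
have {}IH := IH ur.
rewrite !big_cons; move: IH; set S := \sum_(_ <- r) g _; set Z := \sum_(_ <- r) _^-1.
set Q := \sum_(_ <- r) _ * _ => IH.
have Z0 : 0 <= Z.
  by rewrite /Z big_seq sumr_ge0// => i /ur ui; rewrite invr_ge0 ltW.
have Q0 : 0 <= Q.
  by rewrite /Q big_seq sumr_ge0// => i /ur ui; rewrite mulr_ge0 ?sqr_ge0// ltW.
have up : 0 < u p by rewrite u0// mem_head.
have upn : u p != 0 by rewrite gt_eqF.
pose P := Q / u p + Z * u p * g p ^+ 2.
have P0 : 0 <= P.
  apply: addr_ge0; first by rewrite divr_ge0// ltW.
  by rewrite mulr_ge0 ?sqr_ge0// mulr_ge0// ltW.
have key : 2 * g p * S <= P.
  rewrite leNgt; apply/negP => h.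
  have h2 : P ^+ 2 < (2 * g p * S) ^+ 2 by rewrite ltrXn2r// ltW ?(le_lt_trans P0).
  have : (2 * g p * S) ^+ 2 <= 4 * g p ^+ 2 * (Z * Q).
    by rewrite !exprMn -natrX ler_wpM2l// mulr_ge0 ?sqr_ge0.
  have : 4 * g p ^+ 2 * (Z * Q) <= P ^+ 2.
    rewrite -subr_ge0 (_ : _ - _ = (Q / u p - Z * u p * g p ^+ 2) ^+ 2) ?sqr_ge0//.
    by rewrite /P; field.
  lra.
rewrite (_ : (_ + Z) * _ = g p ^+ 2 + P + Z * Q); last by rewrite /P; field.
by rewrite sqrrD -mulr_natl; lra.
Qed.

(** From [ln (1 + 1 / p) >= 1 / (p + 1)] the ratio [y] of consecutive powers is at least
    [1 + beta / (p + 1)], so the difference is at least [p^(- beta) * beta / (p + 1 + beta)]. The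
    constant comes from [p + 1 + beta <= (2 + beta) * p]. *)
Lemma powR_inv_telescope (beta : R) (p : nat) : 0 < beta -> (0 < p)%N ->
  (p%:R `^ (1 + beta))^-1 <=
  (2 + beta) / beta * ((p%:R `^ beta)^-1 - (p.+1%:R `^ beta)^-1).
Proof.
move=> b0 p0; have pR : 0 < p%:R :> R by rewrite ltr0n.
have p1 : 1 <= p%:R :> R by rewrite ler1n.
have pS : p.+1%:R = p%:R + 1 :> R by rewrite -natr1.
have pS0 : 0 < p%:R + 1 :> R by lra.
pose y : R := (p.+1%:R / p%:R) `^ beta.
have y1 : 1 + beta / (p%:R + 1) <= y.
  rewrite /y /powR pS ifF; last by rewrite gt_eqF// divr_gt0.
  apply: le_trans (expR_ge1Dx _); rewrite lerD2l ler_pM2l//.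
  rewrite -[leRHS]opprK -lnV ?posrE ?divr_gt0// invf_div.
  have -> : p%:R / (p%:R + 1) = 1 + (- (p%:R + 1)^-1) :> R by field; rewrite gt_eqF.
  rewrite lerNr; apply: le_ln1Dx.
  by rewrite ltrN2 invf_lt1//; lra.
have q0 : 0 < p%:R `^ beta by rewrite powR_gt0.
have bp : 0 < beta / (p%:R + 1) by rewrite divr_gt0.
have yE : p.+1%:R `^ beta = p%:R `^ beta * y.
  rewrite /y -powRM ?divr_ge0 ?ler0n//; congr (_ `^ _).
  by rewrite mulrC divfK// gt_eqF.
have y0 : 0 < y by lra.
rewrite yE powRD; last by apply/implyP => _; rewrite gt_eqF.
rewrite (powRr1 (ltW pR)) !invfM.
rewrite (_ : _ - _ = (p%:R `^ beta)^-1 * (1 - y^-1)); last by ring.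
rewrite [leLHS]mulrC [leRHS]mulrCA ler_pM2l ?invr_gt0//.
have h1 : 1 - y^-1 >= beta / (p%:R + 1 + beta).
  have : y^-1 <= (1 + beta / (p%:R + 1))^-1 by rewrite lef_pV2// posrE; lra.
  have -> : (1 + beta / (p%:R + 1))^-1 = 1 - beta / (p%:R + 1 + beta).
    by field; rewrite !gt_eqF//; lra.
  lra.
apply: (@le_trans _ _ ((2 + beta) / beta * (beta / (p%:R + 1 + beta)))); last first.
  by rewrite ler_pM2l// divr_gt0//; lra.
rewrite mulrA divfK ?gt_eqF// ler_pdivlMr; last by lra.
rewrite mulrC ler_pdivrMr//; nra.
Qed.

Lemma powR_inv_sum_bounded (a : R) : 1 < a -> exists2 Z : R, 0 <= Z &
  forall T : nat, \sum_(1 <= p < T.+1) (p%:R `^ a)^-1 <= Z.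
Proof.
move=> a1; pose beta := a - 1; have b0 : 0 < beta by rewrite /beta; lra.
exists ((2 + beta) / beta) => [|T]; first by rewrite divr_ge0//; lra.
have -> : a = 1 + beta by rewrite /beta; ring.
apply: (@le_trans _ _ ((2 + beta) / beta * (1 - (T.+1%:R `^ beta)^-1))).
  elim: T => [|T IH]; first by rewrite big_geq// powR1 invr1 subrr mulr0.
  rewrite big_nat_recr//=.
  by have := @powR_inv_telescope beta T.+1 b0 isT; move: IH; rewrite !mulrBr; lra.
by rewrite ler_piMr// divr_ge0//; lra.
Qed.

End block_bound.

Lemma cvg_sum_ord {R : realType} {T : Type} (F : set_system T) {FF : Filter F}
    n (g : 'I_n -> T -> R) (l : 'I_n -> R) :
  (forall i, g i t @[t --> F] --> l i) ->
  \sum_(i < n) g i t @[t --> F] --> \sum_(i < n) l i.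
Proof.
by move=> gl; apply: cvg_big => //; exact: add_continuous.
Qed.

(** * Aliasing error of the least-squares coefficients *)

Section grid_coefficients.
Context {R : realType}.
Variables (alpha Lw : R) (theta : nat -> R).
Hypothesis alpha_gt : 1 / 2 < alpha.
Hypothesis ellipsoid : forall N,
  \sum_(1 <= l < N) sobolev_weight alpha l ^+ 2 * theta l ^+ 2 <= Lw.

Let weight_term l := sobolev_weight alpha l ^+ 2 * theta l ^+ 2.
Let weight_term_ge0 l : 0 <= weight_term l.
Proof. by rewrite mulr_ge0 ?sqr_ge0. Qed.

Let alpha0 : 0 < alpha. Proof. by move: alpha_gt; lra. Qed.

Lemma sobolev_weight_sqr m :
  sobolev_weight alpha m.*2 ^+ 2 = m.*2%:R `^ (2 * alpha) /\
  sobolev_weight alpha m.*2.+1 ^+ 2 = m.*2%:R `^ (2 * alpha).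
Proof.
have aa : (alpha + alpha == 0) = false by rewrite gt_eqF// addr_gt0.
by rewrite /sobolev_weight/= odd_double/= expr2 -powRD ?aa// -mulr2n mulr_natl.
Qed.

Lemma weighted_freq_energy m :
  weight_term m.*2 + weight_term m.*2.+1 = m.*2%:R `^ (2 * alpha) * freq_energy theta m.
Proof.
by rewrite /weight_term; have [-> ->] := sobolev_weight_sqr m; rewrite -mulrDr.
Qed.

Lemma freq_energy_ge0 m : 0 <= freq_energy theta m.
Proof. by rewrite addr_ge0 ?sqr_ge0. Qed.

(* The frequencies above n / 2 alias; cut them into blocks of uphalf n, use
   orthogonality within a block and Cauchy-Schwarz with weights p^(2 alpha)
   across the blocks. *)
Lemma tail_grid_le Z : (forall T : nat, \sum_(1 <= p < T.+1) (p%:R `^ (2 * alpha))^-1 <= Z) ->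
  forall n T : nat, (0 < n)%N ->
  \sum_(i < n) (\sum_(uphalf n <= m < T.+1 * uphalf n)
      freq_term theta m (design_pt R i)) ^+ 2 <=
  2 * n%:R * Z * Lw / n%:R `^ (2 * alpha).
Proof.
(* Half of [n] rounded up: [N <= n] makes the block bound applicable to [N] consecutive frequencies,
   and [n <= N.*2] bounds the Sobolev weights from below. *)
move=> HZ n T n0; set N := uphalf n.
have N0 : (0 < N)%N by rewrite /N; lia.
have nR : 0 < n%:R :> R by rewrite ltr0n.
pose u (p : nat) : R := p%:R `^ (2 * alpha).
pose g (p : nat) (i : 'I_n) : R :=
  \sum_(p * N <= m < p.+1 * N) freq_term theta m (design_pt R i).
pose e (p : nat) : R := \sum_(p * N <= m < p.+1 * N) freq_energy theta m.
have u0 p : (0 < p)%N -> 0 < u p by move=> p0; rewrite powR_gt0// ltr0n.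
have nu0 : 0 < n%:R `^ (2 * alpha) by rewrite powR_gt0.
have Z0 : 0 <= Z by have := HZ 0%N; rewrite big_geq.
have ur : {in index_iota 1 T.+1, forall p, 0 < u p}.
  by move=> p; rewrite mem_index_iota => /andP[p0 _]; exact: u0.
apply: (@le_trans _ _ (\sum_(i < n) Z * \sum_(1 <= p < T.+1) u p * g p i ^+ 2)).
  apply: ler_sum => i _; rewrite sum_blocks.
  have W := weighted_cauchy_schwarz (g ^~ i) ur.
  apply: (le_trans W).
  apply: ler_wpM2r; last exact: HZ.
  by apply: sumr_ge0 => p _; rewrite mulr_ge0 ?sqr_ge0// powR_ge0.
rewrite -mulr_sumr exchange_big/=.
rewrite (_ : 2 * _ * _ * _ / _ = Z * (2 * n%:R * Lw / n%:R `^ (2 * alpha))); last by ring.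
apply: ler_wpM2l => //.
apply: (@le_trans _ _ (\sum_(1 <= p < T.+1) u p * (2 * n%:R * e p))).
  rewrite !big_seq; apply: ler_sum => p; rewrite mem_index_iota => /andP[p0 _].
  rewrite -mulr_sumr ler_pM2l ?u0//; apply: block_sqr_le; first by rewrite muln_gt0 p0.
  rewrite mulSn addnC leq_add2l /N; lia.
have -> : 2 * n%:R * Lw / n%:R `^ (2 * alpha) = 2 * n%:R / n%:R `^ (2 * alpha) * Lw by ring.
apply: (@le_trans _ _ (2 * n%:R / n%:R `^ (2 * alpha) *
    \sum_(1 <= p < T.+1) \sum_(p * N <= m < p.+1 * N) (weight_term m.*2 + weight_term m.*2.+1))).
  rewrite mulr_sumr; apply: ler_sum_nat => p /andP[p0 _].
  rewrite (_ : u p * _ = 2 * n%:R / n%:R `^ (2 * alpha) *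
    (n%:R `^ (2 * alpha) * u p * e p)); last by field; rewrite gt_eqF.
  apply: ler_wpM2l; first by rewrite divr_ge0// ltW.
  rewrite mulr_sumr; apply: ler_sum_nat => m /andP[pm _].
  rewrite weighted_freq_energy ler_wpM2r ?freq_energy_ge0//.
  (* On block [p] the weights dominate [(n * p)^(2 alpha)], since [n * p <= N.*2 * p <= m.*2]. *)
  rewrite /u -powRM//; apply: ge0_ler_powR; rewrite ?nnegrE//.
    by rewrite mulr_ge0// ltW.
  rewrite -natrM ler_nat; have nN : (n <= N.*2)%N by rewrite /N; lia.
  by apply: (@leq_trans (N.*2 * p)); [rewrite leq_mul2r nN orbT|lia].
rewrite -sum_blocks; apply: ler_wpM2l; first by rewrite divr_ge0// ltW.
have := ellipsoid (T.+1 * N).*2; rewrite (@sum_pairs _ _ N)//; last by rewrite leq_pmull.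
apply: le_trans; rewrite lerDr; apply: sumr_ge0 => l _; exact: weight_term_ge0.
Qed.

(** Bessel's inequality: Pythagoras at the least-squares point, with the residual dropped. *)
Lemma lsq_design_sqr_le n k (Y : 'cV[R]_n) : (k < n)%N ->
  n%:R * sqnorm (lsq (design R n k) Y) <= sqnorm Y.
Proof.
move=> kn; have n0 : (0 < n)%N by lia.
have := sqnorm_sub_design n0 (gram_design (R := R) kn) (lsq (design R n k) Y) Y.
rewrite subrr (_ : sqnorm 0 = 0); last first.
  by rewrite /sqnorm big1// => i _; rewrite mxE expr0n.
have := sqnorm_ge0 (Y - design R n k *m lsq (design R n k) Y); lra.
Qed.

(** Basis functions of frequency below [uphalf n] are orthogonal on the grid to every regressor
    other than themselves, so the grid returns [theta j.+1] exactly and the whole error comes from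
    the frequencies above. *)
Lemma lsq_psum n k T (j : 'I_k) : (k < n)%N ->
  lsq (design R n k) (\col_(i < n) \sum_(1 <= l < (T.+1 * uphalf n).*2)
     theta l * fourier l (design_pt R i)) j 0 =
  theta j.+1 + lsq (design R n k) (\col_(i < n)
    \sum_(uphalf n <= m < T.+1 * uphalf n) freq_term theta m (design_pt R i)) j 0.
Proof.
move=> kn; have nR : n%:R != 0 :> R by rewrite pnatr_eq0; lia.
have N0 : (0 < uphalf n)%N by lia.
have jk := ltn_ord j.
rewrite !mxE -[theta j.+1](mulKf nR) -mulrDr; congr (_ * _).
have -> : n%:R * theta j.+1 = \sum_(i < n) fourier j.+1 (design_pt R i) *
    \sum_(1 <= l < (uphalf n).*2) theta l * fourier l (design_pt R i).
  under eq_bigr do rewrite mulr_sumr.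
  rewrite exchange_big/= (bigD1_seq j.+1) ?iota_uniq ?mem_index_iota//=; last by lia.
  rewrite [X in _ = _ + X]big1_seq ?addr0 => [|l /andP[lj]].
    transitivity (theta j.+1 * \sum_(i < n)
        fourier j.+1 (design_pt R i) * fourier j.+1 (design_pt R i)).
      by rewrite fourier_gram//; [rewrite eqxx mulr1 mulrC|lia].
    by rewrite mulr_sumr; apply: eq_bigr => i _; ring.
  rewrite mem_index_iota => /andP[l0 lN].
  transitivity (theta l * \sum_(i < n)
      fourier j.+1 (design_pt R i) * fourier l (design_pt R i)).
    by rewrite mulr_sumr; apply: eq_bigr => i _; ring.
  by rewrite fourier_gram//; [rewrite eq_sym (negbTE lj) !mulr0|lia].
rewrite -big_split/=; apply: eq_bigr => i _; rewrite !mxE -mulrDr; congr (_ * _).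
by rewrite (@sum_pairs _ _ (uphalf n))// leq_pmull.
Qed.

(** The aliasing bound is uniform in the truncation [T], and the error sees [f] only through its [n]
    grid values; convergence of the partial sums at these points carries the bound over to [f]. Here
    the point values have to be those of the Fourier sum. *)
Lemma lsq_error_le Z n k (f : R -> R) :
  (forall T : nat, \sum_(1 <= p < T.+1) (p%:R `^ (2 * alpha))^-1 <= Z) ->
  (k < n)%N ->
  (forall x, 0 <= x <= 1 -> fourier_psum theta N x @[N --> \oo] --> f x) ->
  \sum_(j < k) (lsq (design R n k) (signal f n) j 0 - theta j.+1) ^+ 2 <=
  2 * Z * Lw / n%:R `^ (2 * alpha).
Proof.
move=> HZ kn fcvg; have n0 : (0 < n)%N by lia.
have nR : 0 < n%:R :> R by rewrite ltr0n.
have N0 : (0 < uphalf n)%N by lia.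
pose P T : 'cV[R]_n := \col_(i < n) \sum_(1 <= l < (T.+1 * uphalf n).*2)
     theta l * fourier l (design_pt R i).
have Pcvg i : P T i 0 @[T --> \oo] --> f (design_pt R i).
  have xi : 0 <= design_pt R i <= 1.
    rewrite /design_pt divr_ge0//= ler_pdivrMr// mul1r ler_nat.
    exact: ltn_ord.
  (* Whole blocks end at the index [(T.+1 * uphalf n).*2.-1], which selects a subsequence of the
     partial sums. *)
  have h : (fun T => (T.+1 * uphalf n).*2.-1) @ \oo --> \oo.
    apply/cvgnyPge => A; near=> T.
    have : (A <= T)%N by near: T; exact: nbhs_infty_ge.
    by nia.
  have := cvg_comp _ _ h (fcvg _ xi).
  apply: cvg_trans; apply: near_eq_cvg; near=> T.
  rewrite /= /fourier_psum mxE prednK//; lia.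
have Scvg : \sum_(j < k) (lsq (design R n k) (P T) j 0 - theta j.+1) ^+ 2 @[T --> \oo]
    --> \sum_(j < k) (lsq (design R n k) (signal f n) j 0 - theta j.+1) ^+ 2.
  have lcvg j : lsq (design R n k) (P T) j 0 @[T --> \oo] --> lsq (design R n k) (signal f n) j 0.
    rewrite !mxE; under eq_fun do rewrite !mxE.
    apply: cvgM; first exact: cvg_cst.
    apply: cvg_sum_ord => i; apply: cvgM; first exact: cvg_cst.
    rewrite [signal f n i 0]mxE; exact: Pcvg.
  apply: cvg_sum_ord => j; apply: cvgM; apply: cvgB; by [exact: lcvg|exact: cvg_cst].
apply: (cvgr_to_le Scvg); near=> T.
pose Q : 'cV[R]_n := \col_(i < n)
    \sum_(uphalf n <= m < T.+1 * uphalf n) freq_term theta m (design_pt R i).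
rewrite (_ : \sum_(_ < _) _ = sqnorm (lsq (design R n k) Q)); last first.
  by apply: eq_bigr => j _; rewrite lsq_psum// addrC addKr.
rewrite -(ler_pM2l nR); apply: (le_trans (lsq_design_sqr_le _ kn)).
have -> : sqnorm Q = \sum_(i < n) (\sum_(uphalf n <= m < T.+1 * uphalf n)
      freq_term theta m (design_pt R i)) ^+ 2 by apply: eq_bigr => i _; rewrite mxE.
apply: (le_trans (@tail_grid_le Z HZ n T n0)).
by rewrite le_eqVlt; apply/orP; left; apply/eqP; ring.
Unshelve. all: by end_near.
Qed.

End grid_coefficients.

(** * Parseval and the bias *)

Section parseval.
Context {R : realType}.
Local Notation mu := (@lebesgue_measure R).
Local Notation I01 := (`[0%R, 1%R]%classic : set R).

Definition mean01 (g : R -> R) : R := (\int[mu]_(x in I01) g x)%R.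

Lemma continuous_integrable01 (g : R -> R) : continuous g ->
  mu.-integrable I01 (EFin \o g).
Proof.
move=> cg; apply: continuous_compact_integrable; first exact: segment_compact.
exact: continuous_subspaceT.
Qed.

Lemma mean01_lin (a b : R) (g h : R -> R) : continuous g -> continuous h ->
  mean01 (fun x => a * g x + b * h x) = a * mean01 g + b * mean01 h.
Proof.
move=> cg ch; have cM (c : R) (k : R -> R) : continuous k -> continuous (fun x => c * k x : R).
  by move=> ck x; apply: cvgM; [exact: cvg_cst|exact: ck].
rewrite /mean01 RintegralD//; last 2 first.
- exact: continuous_integrable01 (cM _ _ cg).
- exact: continuous_integrable01 (cM _ _ ch).
by rewrite !RintegralZl//; exact: continuous_integrable01.
Qed.

Lemma mean01_cst1 : mean01 (fun=> 1) = 1.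
Proof.
have E : mu I01 = 1%:E by rewrite lebesgue_measure_itv/= lte_fin ltr01 oppr0 adde0.
rewrite /mean01 Rintegral_cst// mul1r; transitivity (fine (1%:E : \bar R)) => //.
congr fine; exact: E.
Qed.

Lemma mean01_derive (F g : R -> R) : continuous g ->
  (forall x, is_derive x (1 : R) F (g x)) -> mean01 g = F 1 - F 0.
Proof.
move=> cg dF.
have dF' x : derivable F x 1 by apply: ex_derive; exact: dF.
have cF x : {for x, continuous F}.
  exact/differentiable_continuous/derivable1_diffP.
rewrite /mean01 /Rintegral (@continuous_FTC2 _ g F)//.
- exact: continuous_subspaceT.
- split => //; [exact/cvg_at_right_filter/cF|exact/cvg_at_left_filter/cF].
- by move=> x _; rewrite derive1E; apply: derive_val; exact: dF.
Qed.

Lemma mean01_cos_sin m : (0 < m)%N ->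
  mean01 (fun x => cos (2 * pi * m%:R * x)) = 0 /\
  mean01 (fun x => sin (2 * pi * m%:R * x)) = 0.
Proof.
move=> m0; set c := 2 * pi * m%:R.
have c0 : c != 0 :> R by rewrite gt_eqF// !mulr_gt0 ?pi_gt0// ltr0n.
have ccos : continuous (fun x : R => cos (c * x)).
  move=> x; apply: continuous_comp; last exact: continuous_cos.
  by apply: cvgM; [exact: cvg_cst|exact: cvg_id].
have csin : continuous (fun x : R => sin (c * x)).
  move=> x; apply: continuous_comp; last exact: continuous_sin.
  by apply: cvgM; [exact: cvg_cst|exact: cvg_id].
have dc (x : R) : is_derive x (1 : R) ( *%R c) c.
  have -> : *%R c = (c \*: id) by [].
  by apply: is_derive_eq; rewrite /GRing.scale/= mulr1.
have d1 (x : R) : is_derive x (1 : R) (c^-1 \*: (sin \o ( *%R c))) (cos (c * x)).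
  apply: is_derive_eq; rewrite /GRing.scale/=.
  by rewrite (mulrC (cos _)) mulKf.
have d2 (x : R) : is_derive x (1 : R) ((- c^-1) \*: (cos \o ( *%R c))) (sin (c * x)).
  apply: is_derive_eq; rewrite /GRing.scale/=.
  by rewrite !mulNr mulrN opprK (mulrC (sin _)) mulKf.
split.
- rewrite (mean01_derive ccos d1) /GRing.scale/=.
  by rewrite mulr1 mulr0 sin0 /c sin_2pin subrr.
- rewrite (mean01_derive csin d2) /GRing.scale/=.
  by rewrite mulr1 mulr0 cos0 /c cos_2pin subrr.
Qed.

Lemma continuous_fourier l : continuous (@fourier R l).
Proof.
have cc m : continuous (fun x : R => Num.sqrt 2 * cos (2 * pi * m%:R * x) : R).
  move=> x; apply: cvgM; first exact: cvg_cst.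
  apply: continuous_comp; last exact: continuous_cos.
  by apply: cvgM; [exact: cvg_cst|exact: cvg_id].
have cs m : continuous (fun x : R => Num.sqrt 2 * sin (2 * pi * m%:R * x) : R).
  move=> x; apply: cvgM; first exact: cvg_cst.
  apply: continuous_comp; last exact: continuous_sin.
  by apply: cvgM; [exact: cvg_cst|exact: cvg_id].
rewrite /fourier; case: (l == 1%N); first by move=> x; exact: cvg_cst.
by case: (odd l); [exact: cs|exact: cc].
Qed.

Lemma continuous_seq_sum (r : seq nat) (g : nat -> R -> R) :
  (forall l, continuous (g l)) -> continuous (fun x => \sum_(l <- r) g l x).
Proof.
move=> cg; elim: r => [|l r IH].
  by under eq_fun do rewrite big_nil; move=> x; exact: cvg_cst.
under eq_fun do rewrite big_cons; move=> x; apply: cvgD; [exact: cg|exact: IH].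
Qed.

Lemma mean01_sum (r : seq nat) (g : nat -> R -> R) : (forall l, continuous (g l)) ->
  mean01 (fun x => \sum_(l <- r) g l x) = \sum_(l <- r) mean01 (g l).
Proof.
move=> cg; elim: r => [|l r IH].
  rewrite big_nil -[RHS](mul0r (mean01 (fun=> 1))) -[RHS]addr0 -(mul0r (mean01 (fun=> 1))).
  have c1 : continuous (fun _ : R => 1 : R) by move=> x; exact: cvg_cst.
  rewrite -(mean01_lin _ _ c1 c1); congr mean01; apply/funext => x.
  by rewrite big_nil !mul0r addr0.
rewrite [RHS]big_cons -IH -(mul1r (mean01 (g l))) -[X in _ = _ + X]mul1r.
rewrite -mean01_lin//; last exact: continuous_seq_sum.
by congr mean01; apply/funext => x; rewrite big_cons !mul1r.
Qed.

Lemma mean01_fourier l l' : (0 < l)%N -> (0 < l')%N ->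
  mean01 (fun x => fourier l x * fourier l' x) = (l == l')%:R.
Proof.
move=> l0 l'0; apply: (@fourier_orthonormal_of_mean _ mean01 (l./2 + l'./2).+1) => //.
- by move=> *; exact: mean01_lin.
- exact: mean01_cst1.
- by move=> m /andP[m0 _]; exact: mean01_cos_sin.
Qed.

Lemma mean01_psum_sqr (theta : nat -> R) N :
  mean01 (fun x => fourier_psum theta N x ^+ 2) = \sum_(1 <= l < N.+1) theta l ^+ 2.
Proof.
have cM (a b : R) l l' : continuous (fun x : R => (a * fourier l x) * (b * fourier l' x) : R).
  move=> x; apply: cvgM; apply: cvgM; try exact: cvg_cst; exact: continuous_fourier.
transitivity (mean01 (fun x => \sum_(1 <= l < N.+1) \sum_(1 <= l' < N.+1)
    (theta l * fourier l x) * (theta l' * fourier l' x))).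
  by congr mean01; apply/funext => x; rewrite expr2 /fourier_psum big_distrlr.
rewrite mean01_sum; last by move=> l; exact: continuous_seq_sum.
apply: eq_big_nat => l /andP[l0 lN]; rewrite mean01_sum//.
have E l' : (0 < l')%N -> mean01 (fun x => theta l * fourier l x * (theta l' * fourier l' x)) =
    theta l * theta l' * (l == l')%:R.
  move=> l'0; rewrite -mean01_fourier// -[RHS]addr0 -(mul0r (mean01 (fun=> 1))).
  rewrite -mean01_lin.
  - by congr mean01; apply/funext => x; ring.
  - by move=> x; apply: cvgM; exact: continuous_fourier.
  - by move=> x; exact: cvg_cst.
rewrite (bigD1_seq l) ?mem_index_iota ?l0 ?iota_uniq//= E// eqxx mulr1 -expr2.
rewrite big1_seq ?addr0// => l' /andP[ll']; rewrite mem_index_iota => /andP[l'0 _].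
by rewrite E// eq_sym (negbTE ll') mulr0.
Qed.

(** Expand [a = b + (a - b)] and split the cross term with weight [eta]. Integrated over [0, 1],
    this takes the place of the triangle inequality in L2 and avoids square roots. *)
Lemma sqr_perturb_le (eta a b : R) : 0 < eta ->
  a ^+ 2 <= (1 + eta) * b ^+ 2 + (1 + eta^-1) * (a - b) ^+ 2.
Proof.
move=> e0; rewrite -subr_ge0.
have -> : (1 + eta) * b ^+ 2 + (1 + eta^-1) * (a - b) ^+ 2 - a ^+ 2 =
    (eta * b - (a - b)) ^+ 2 / eta by field; rewrite gt_eqF.
by rewrite divr_ge0 ?sqr_ge0// ltW.
Qed.

Lemma parseval (theta : nat -> R) (f : R -> R) : fourier_L2_sum theta f ->
  \sum_(1 <= l < N.+1) theta l ^+ 2 @[N --> \oo] --> L2sq f.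
Proof.
move=> [mf dcvg].
pose A N := \sum_(1 <= l < N.+1) theta l ^+ 2.
pose d N := (\int[mu]_(x in I01) ((f x - fourier_psum theta N x) ^+ 2)%:E)%E.
pose J := (\int[mu]_(x in I01) (f x ^+ 2)%:E)%E.
have cS N : continuous (fourier_psum theta N).
  apply: continuous_seq_sum => l x; apply: cvgM; first exact: cvg_cst.
  exact: continuous_fourier.
have mS N : measurable_fun I01 (fourier_psum theta N).
  apply: measurable_funTS; exact: continuous_measurable_fun.
have mS2 N : measurable_fun I01 (fun x => (fourier_psum theta N x ^+ 2)%:E : \bar R).
  by apply/measurable_EFinP; exact: measurable_funX.
have mf2 : measurable_fun I01 (fun x => (f x ^+ 2)%:E : \bar R).
  by apply/measurable_EFinP; exact: measurable_funX.
have md2 N : measurable_fun I01 (fun x => ((f x - fourier_psum theta N x) ^+ 2)%:E : \bar R).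
  by apply/measurable_EFinP; apply: measurable_funX; exact: measurable_funB.
have AE N : (\int[mu]_(x in I01) (fourier_psum theta N x ^+ 2)%:E = (A N)%:E)%E.
  rewrite /A -mean01_psum_sqr /mean01 /Rintegral fineK//.
  apply: integrable_fin_num => //; apply: continuous_integrable01 => x.
  by apply: cvgM; exact: cS.
have d0 N : (0 <= d N)%E by apply: integral_ge0 => x _; rewrite lee_fin sqr_ge0.
have J0 : (0 <= J)%E by apply: integral_ge0 => x _; rewrite lee_fin sqr_ge0.
have bound (a b : R -> R) (eta : R) : 0 < eta ->
    measurable_fun I01 (fun x => (a x ^+ 2)%:E : \bar R) ->
    measurable_fun I01 (fun x => (b x ^+ 2)%:E : \bar R) ->
    measurable_fun I01 (fun x => ((a x - b x) ^+ 2)%:E : \bar R) ->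
    (\int[mu]_(x in I01) (a x ^+ 2)%:E <=
     (1 + eta)%:E * \int[mu]_(x in I01) (b x ^+ 2)%:E +
     (1 + eta^-1)%:E * \int[mu]_(x in I01) ((a x - b x) ^+ 2)%:E)%E.
  move=> e0 ma mb mab.
  have e1 : 0 <= 1 + eta by lra.
  have e2 : 0 <= 1 + eta^-1 by rewrite addr_ge0// invr_ge0 ltW.
  have sq0 (y : R) : (0 <= (y ^+ 2)%:E)%E by rewrite lee_fin sqr_ge0.
  rewrite -!ge0_integralZl ?lee_fin// -ge0_integralD//; last 4 first.
  - by move=> x _; rewrite mule_ge0.
  - exact: emeasurable_funM.
  - by move=> x _; rewrite mule_ge0.
  - exact: emeasurable_funM.
  apply: ge0_le_integral => //.
  - by apply: emeasurable_funD; exact: emeasurable_funM.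
  - by move=> x _; rewrite -!EFinM -EFinD lee_fin sqr_perturb_le.
(* [H1] and [H2] compare the two energies in both directions; [eta] is fixed before [N] is taken
   large. *)
have H1 eta N : 0 < eta -> (J <= (1 + eta)%:E * (A N)%:E + (1 + eta^-1)%:E * d N)%E.
  by move=> e0; rewrite -AE; exact: bound.
have H2 eta N : 0 < eta -> ((A N)%:E <= (1 + eta)%:E * J + (1 + eta^-1)%:E * d N)%E.
  move=> e0; rewrite -AE.
  have -> : d N = (\int[mu]_(x in I01) ((fourier_psum theta N x - f x) ^+ 2)%:E)%E.
    by apply: eq_integral => x _; rewrite -sqrrN opprB.
  apply: bound => //; apply: (eq_measurable_fun _ _ (md2 N)) => x _.
  by rewrite -sqrrN opprB.
move/fine_cvgP: dcvg => [dfin dc].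
(* Finite energy of [f] follows from L2 approximation: one [N] at finite distance is enough in
   [H1]. *)
have Jfin : J \is a fin_num.
  have [N dN'] := filter_ex dfin; rewrite ge0_fin_numE//.
  have dN : d N \is a fin_num by [].
  by apply: (le_lt_trans (H1 1 N ltr01)); rewrite -EFinM -(fineK dN) -EFinM -EFinD ltry.
pose j := fine J; have JE : J = j%:E by rewrite fineK.
have j0 : 0 <= j by rewrite fine_ge0.
rewrite (_ : L2sq f = j)//; apply/cvgrPdist_le => e e0.
(* The aim is [eta * j <= e / 4]; [j + 1] guards against [j = 0], and the cap 1 gives
   [eta ^+ 2 * j <= eta * j]. *)
pose eta := Num.min 1 (e / (4 * (j + 1))).
have eta0 : 0 < eta by rewrite lt_min ltr01/= divr_gt0// mulr_gt0//; lra.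
have eta1 : eta <= 1 by rewrite ge_min lexx.
have etaj : eta * j <= e / 4.
  apply: (@le_trans _ _ (e / (4 * (j + 1)) * (j + 1))).
    by rewrite ler_pM ?(ltW eta0)//; [rewrite ge_min lexx orbT|lra].
  by rewrite le_eqVlt; apply/orP; left; apply/eqP; field; rewrite gt_eqF//; lra.
pose c := 1 + eta^-1; have c0 : 0 < c by rewrite addr_gt0// invr_gt0.
have dcl : forall e', 0 < e' -> \forall N \near \oo, `|0 - fine (d N)| <= e'.
  by move/cvgrPdist_le : dc.
near=> N.
have dN : d N \is a fin_num by near: N.
have : `|0 - fine (d N)| <= e / (4 * c).
  by near: N; apply: dcl; rewrite divr_gt0// mulr_gt0.
rewrite sub0r normrN ger0_norm ?fine_ge0// => dNe.
have cd : c * fine (d N) <= e / 4.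
  have -> : e / 4 = c * (e / (4 * c)) by field; rewrite gt_eqF.
  by rewrite ler_pM2l.
have := H1 eta N eta0; have := H2 eta N eta0.
rewrite JE -(fineK dN) -!EFinM -!EFinD !lee_fin -/c => h2 h1.
rewrite ler_norml -/(A N).
have etaA : eta * A N <= eta * ((1 + eta) * j + c * fine (d N)) by rewrite ler_pM2l.
have etaj2 : eta * ((1 + eta) * j) <= 2 * (eta * j).
  have : eta * (eta * j) <= 1 * (eta * j) by rewrite ler_wpM2r// mulr_ge0// ltW.
  lra.
have etad : eta * (c * fine (d N)) <= c * fine (d N).
  by rewrite ler_piMl// mulr_ge0 ?fine_ge0// ltW.
by apply/andP; split; lra.
Unshelve. all: by end_near. Qed.

End parseval.

Section bias.
Context {R : realType}.
Variables (alpha L : R) (theta : nat -> R) (f : R -> R).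
Hypothesis alpha_gt : 1 / 2 < alpha.
Hypothesis f_L2 : fourier_L2_sum theta f.
Hypothesis f_ell : sobolev_ellipsoid alpha L theta.
Hypothesis f_sum :
  forall x, 0 <= x <= 1 -> fourier_psum theta N x @[N --> \oo] --> f x.

Let Lw := L ^+ 2 / pi `^ (2 * alpha).
Let alpha0 : 0 < alpha. Proof. by move: alpha_gt; lra. Qed.

Lemma ellipsoid_psum_le N :
  \sum_(1 <= l < N) sobolev_weight alpha l ^+ 2 * theta l ^+ 2 <= Lw.
Proof.
rewrite -lee_fin -sumEFin; apply: le_trans f_ell.
apply: nneseries_lim_ge => l _ _; by rewrite lee_fin mulr_ge0 ?sqr_ge0.
Qed.

Lemma coef_psum_le N : \sum_(1 <= l < N.+1) theta l ^+ 2 <= L2sq f.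
Proof.
apply: (cvgr_to_ge (parseval f_L2)); near=> M.
have NM : (N <= M)%N by near: M; exact: nbhs_infty_ge.
rewrite [leRHS](@big_cat_nat _ _ _ N.+1)//= lerDl sumr_ge0// => l _.
exact: sqr_ge0.
Unshelve. all: by end_near. Qed.

(** Beyond index [k] every squared weight is at least [k^(2 alpha)], also for odd [l], where the
    weight is built on [l.-1 >= k]. *)
Lemma coef_tail_le k : (0 < k)%N ->
  L2sq f - \sum_(1 <= l < k.+1) theta l ^+ 2 <= Lw / k%:R `^ (2 * alpha).
Proof.
move=> k0; have kw : 0 < k%:R `^ (2 * alpha) :> R by rewrite powR_gt0// ltr0n.
rewrite lerBlDr addrC; apply: (cvgr_to_le (parseval f_L2)); near=> N.
have kN : (k <= N)%N by near: N; exact: nbhs_infty_ge.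
rewrite (@big_cat_nat _ _ _ k.+1 1 N.+1)//= lerD2l ler_pdivlMr// mulr_suml.
apply: le_trans (ellipsoid_psum_le N.+1).
rewrite [leRHS](@big_cat_nat _ _ _ k.+1)//=; apply: ler_wpDl.
  by rewrite sumr_ge0// => l _; rewrite mulr_ge0 ?sqr_ge0.
apply: ler_sum_nat => l /andP[kl _].
rewrite mulrC ler_wpM2r ?sqr_ge0//.
have -> : sobolev_weight alpha l ^+ 2 = (if odd l then l.-1%:R else l%:R) `^ (2 * alpha).
  have aa : (alpha + alpha == 0) = false by rewrite gt_eqF// addr_gt0.
  by rewrite /sobolev_weight expr2 -powRD ?aa// mulrDl mul1r.
apply: ge0_ler_powR; rewrite ?nnegrE ?mulr_ge0 ?(ltW alpha0)//; first by case: ifP.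
by case: ifP => lo; rewrite ler_nat; lia.
Unshelve. all: by end_near. Qed.

(** With zero energy every coefficient is 0, and then the pointwise sum, which is [f], vanishes on
    all of [0, 1]. A conclusion almost everywhere would be too weak: [f] is known to be nonzero at a
    single point. *)
Lemma L2sq_gt0 : (exists2 x, 0 <= x <= 1 & f x != 0) -> 0 < L2sq f.
Proof.
move=> [x x01 fx]; rewrite lt_neqAle; apply/andP; split; last first.
  by apply: Rintegral_ge0 => y _; exact: sqr_ge0.
apply: contra fx => /eqP J0.
have th0 l : (0 < l)%N -> theta l = 0.
  move=> l0; apply/eqP; rewrite -sqrf_eq0 eq_le sqr_ge0 andbT.
  have := coef_psum_le l; rewrite -J0; apply: le_trans.
  by rewrite big_nat_recr//= lerDr sumr_ge0// => i _; rewrite sqr_ge0.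
have := f_sum x01.
rewrite (_ : (fun N => fourier_psum theta N x) = cst 0); last first.
  apply/funext => N; rewrite /fourier_psum big_nat_cond big1// => l /andP[/andP[l0 _] _].
  by rewrite th0// mul0r.
by move/cvg_lim => <-//; rewrite lim_cst.
Qed.

(** With [d = s j - t j] the change is [2 t d + d^2], and [2 |t d| <= eta t^2 + d^2 / eta]; a second
    [d^2 / eta] absorbs [d^2] because [eta <= 1]. *)
Lemma sqnorm_perturb_le k (t s : 'I_k -> R) (eta : R) : 0 < eta -> eta <= 1 ->
  `|\sum_j s j ^+ 2 - \sum_j t j ^+ 2| <=
  eta * (\sum_j t j ^+ 2) + 2 / eta * \sum_j (s j - t j) ^+ 2.
Proof.
move=> e0 e1; rewrite -sumrB; apply: le_trans (ler_norm_sum _ _ _) _.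
rewrite !mulr_sumr -big_split/=; apply: ler_sum => j _.
set a := t j; set d := s j - t j.
have -> : s j = a + d by rewrite /a /d; ring.
have ie : 1 <= eta^-1 by rewrite invf_ge1.
have sq : 2 * `|a| * `|d| <= eta * a ^+ 2 + d ^+ 2 / eta.
  rewrite -subr_ge0 -(real_normK (num_real a)) -(real_normK (num_real d)).
  rewrite (_ : _ - _ = (eta * `|a| - `|d|) ^+ 2 / eta); last by field; rewrite gt_eqF.
  by rewrite divr_ge0 ?sqr_ge0// ltW.
have -> : (a + d) ^+ 2 - a ^+ 2 = 2 * a * d + d ^+ 2 by ring.
apply: (le_trans (ler_normD _ _)).
have -> : `|2 * a * d| = 2 * `|a| * `|d| by rewrite !normrM ger0_norm.
rewrite (ger0_norm (sqr_ge0 d)).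
have : d ^+ 2 <= d ^+ 2 / eta by rewrite ler_peMr ?sqr_ge0.
rewrite (_ : 2 / eta * d ^+ 2 = d ^+ 2 / eta + d ^+ 2 / eta); last by ring.
lra.
Qed.

(** The energy [S] of the first [k] Fourier coefficients stands in between: aliasing separates the
    grid energy from [S], and truncation separates [S] from [L2sq f]. *)
Lemma bias_le : exists2 C : R, 0 <= C & forall n k, (0 < k < n)%N ->
  `|sqnorm (lsq (design R n k) (signal f n)) - L2sq f| <=
  C / n%:R `^ alpha + C / k%:R `^ (2 * alpha).
Proof.
have a1 : 1 < 2 * alpha by move: alpha_gt; lra.
have [Z Z0 HZ] := powR_inv_sum_bounded a1.
have Lw0 : 0 <= Lw by have := ellipsoid_psum_le 0; rewrite big_geq.
have J0 : 0 <= L2sq f by have := coef_psum_le 0; rewrite big_geq.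
have ZL : 0 <= 4 * Z * Lw by apply: mulr_ge0 => //; exact: mulr_ge0.
have JZ : 0 <= L2sq f + 4 * Z * Lw by exact: addr_ge0.
exists (L2sq f + 4 * Z * Lw + Lw); first exact: addr_ge0.
move=> n k /andP[k0 kn]; set C := _ + _ + Lw.
have n0 : (0 < n)%N by lia.
have na1 : 1 <= n%:R `^ alpha :> R.
  by rewrite -[leLHS](powRr0 n%:R) ler_powR ?ler1n// ltW.
have na0 : 0 < n%:R `^ alpha :> R by exact: lt_le_trans na1.
(* This balances [eta] times the energy against the squared aliasing error, of order
   [n^(- 2 alpha)], divided by [eta]. *)
pose eta : R := (n%:R `^ alpha)^-1.
have eta0 : 0 < eta by rewrite invr_gt0.
have eta1 : eta <= 1 by rewrite invf_le1.
have n2 : n%:R `^ (2 * alpha) = eta^-1 ^+ 2 :> R.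
  have aa : (alpha + alpha == 0) = false by rewrite gt_eqF// addr_gt0.
  by rewrite invrK expr2 -powRD ?aa// mulrDl mul1r.
have E := lsq_error_le alpha_gt ellipsoid_psum_le HZ kn f_sum.
have P := sqnorm_perturb_le (fun j : 'I_k => theta j.+1)
  (fun j => lsq (design R n k) (signal f n) j 0) eta0 eta1.
have T := coef_tail_le k0; have A := coef_psum_le k.
have AE : \sum_(j < k) theta j.+1 ^+ 2 = \sum_(1 <= l < k.+1) theta l ^+ 2.
  by rewrite big_add1 big_mkord.
rewrite AE in P.
set S := \sum_(1 <= l < k.+1) _ in P T A *.
have kw : 0 < k%:R `^ (2 * alpha) :> R by rewrite powR_gt0// ltr0n.
have h1 : eta * S <= eta * L2sq f by rewrite ler_pM2l.
have h2 : 2 / eta * \sum_(j < k) (lsq (design R n k) (signal f n) j 0 - theta j.+1) ^+ 2 <=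
    eta * (4 * Z * Lw).
  apply: (@le_trans _ _ (2 / eta * (2 * Z * Lw / n%:R `^ (2 * alpha)))).
    by rewrite ler_pM2l// divr_gt0.
  by rewrite n2 le_eqVlt; apply/orP; left; apply/eqP; field; rewrite gt_eqF.
have h3 : Lw / k%:R `^ (2 * alpha) <= C / k%:R `^ (2 * alpha).
  by rewrite ler_pM2r ?invr_gt0// /C lerDr.
have h4 : eta * L2sq f + eta * (4 * Z * Lw) <= C / n%:R `^ alpha.
  by rewrite -mulrDr mulrC -/eta ler_pM2r// /C lerDl.
have -> : sqnorm (lsq (design R n k) (signal f n)) - L2sq f =
  (sqnorm (lsq (design R n k) (signal f n)) - S) + (S - L2sq f) by ring.
apply: (le_trans (ler_normD _ _)); apply: lerD.
  by apply: (le_trans P); lra.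
by rewrite distrC ger0_norm ?subr_ge0//; apply: (le_trans T).
Qed.

End bias.

(** * Choice of the dimension *)

Section asymptotics.
Context {R : realType}.

Lemma littleoE (g h : nat -> R) : g =o_\oo h <->
  forall e, 0 < e -> \forall n \near \oo, `|g n| <= e * `|h n|.
Proof. by split => [/eqoP//|H]; apply/eqoP. Qed.

Lemma powR_nat_large (c M : R) : 0 < c -> \forall n \near \oo, M <= n%:R `^ c.
Proof.
move=> c0; near=> n; have [M0|M0] := leP M 0; first by rewrite (le_trans M0)// powR_ge0.
have nM : M `^ c^-1 <= n%:R by near: n; exact: nbhs_infty_ger.
have E : M = (M `^ c^-1) `^ c by rewrite -powRrM mulVf ?lt0r_neq0// powRr1// ltW.
rewrite [leLHS]E.
by apply: ge0_ler_powR; rewrite ?nnegrE ?powR_ge0// ltW.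
Unshelve. all: by end_near. Qed.

Lemma sqrt_powR (n : nat) : Num.sqrt n%:R = n%:R `^ 2^-1 :> R.
Proof. by rewrite powR12_sqrt. Qed.

Lemma dim_growth_exists (alpha : R) : 1 / 2 < alpha ->
  exists k : nat -> nat, dim_growth alpha k.
Proof.
move=> a2; have a0 : 0 < alpha by lra.
(* [k n] is about [n^b], and the growth conditions become [b < 1 / 2] and [b * (2 * alpha) > 1 / 2];
   [b] is the midpoint of the admissible range, which is nonempty because [alpha > 1 / 2]. *)
pose b : R := (2^-1 + (4 * alpha)^-1) / 2.
have ia : alpha^-1 < 2 by rewrite invf_plt ?posrE//; lra.
have ia0 : 0 < alpha^-1 by rewrite invr_gt0.
have bE : b = 4^-1 + alpha^-1 / 8 by rewrite /b; field; rewrite gt_eqF.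
have b0 : 0 < b by rewrite bE; lra.
have b2 : b < 2^-1 by rewrite bE; lra.
have ab : 2^-1 < b * (2 * alpha).
  have -> : b * (2 * alpha) = alpha / 2 + 4^-1 by rewrite bE; field; rewrite gt_eqF.
  lra.
(* The successor makes [k n] positive and larger than [n^b]. *)
exists (fun n => (Num.truncn (n%:R `^ b : R)).+1); split => //.
- apply/littleoE => e e0; near=> n.
  have n0 : (0 < n)%N by near: n; exact: nbhs_infty_gt.
  have nb : 1 <= n%:R `^ b :> R.
    by rewrite -[leLHS](powRr0 n%:R) ler_powR ?ler1n// ltW.
  have large : 2 / e <= n%:R `^ (2^-1 - b).
    by near: n; apply: powR_nat_large; rewrite subr_gt0.
  rewrite ger0_norm// ger0_norm ?sqrtr_ge0// -natr1.
  apply: (@le_trans _ _ (2 * n%:R `^ b)).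
    have := Num.Theory.truncn_le (n%:R `^ b : R); rewrite powR_ge0; lra.
  rewrite sqrt_powR -(subrK b 2^-1) powRD; last first.
    by apply/implyP => _; rewrite pnatr_eq0 -lt0n.
  by rewrite mulrA ler_pM2r ?(lt_le_trans ltr01 nb)// -ler_pdivrMl// mulrC.
- apply/littleoE => e e0; near=> n.
  have n0 : (0 < n)%N by near: n; exact: nbhs_infty_gt.
  have large : e^-1 <= n%:R `^ (b * (2 * alpha) - 2^-1).
    by near: n; apply: powR_nat_large; rewrite subr_gt0.
  rewrite ger0_norm ?sqrtr_ge0// ger0_norm ?powR_ge0//.
  apply: (@le_trans _ _ (e * (n%:R `^ b) `^ (2 * alpha))); last first.
    rewrite ler_pM2l//; apply: ge0_ler_powR; rewrite ?nnegrE ?powR_ge0 ?mulr_ge0// ?(ltW a0)//.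
    by rewrite ltW// Num.Theory.truncnS_gt.
  rewrite -powRrM sqrt_powR -(subrK 2^-1 (b * (2 * alpha))) powRD; last first.
    by apply/implyP => _; rewrite pnatr_eq0 -lt0n.
  by rewrite [leRHS]mulrA ler_peMl ?powR_ge0// -ler_pdivrMl// mulr1.
Unshelve. all: by end_near. Qed.

End asymptotics.

(** * Finite-sample bounds *)

Section posterior_error_bound.
Context {R : realType}.
Local Notation MR := (measurableTypeR R).

Lemma measurable_cvec_sqnorm n : measurable_fun [set: vec R n]
  (fun F => sqnorm (cvec F) : MR).
Proof.
apply: measurable_sum => i; apply: measurable_funX.
rewrite (_ : (fun F : vec R n => _) = fun F => tnth F i); first exact: measurable_tnth.
by apply/funext => F; rewrite mxE.
Qed.

Variables (sigma gamma : R) (f : R -> R) (n k : nat).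
Hypotheses (sigma0 : 0 < sigma) (gamma0 : 0 < gamma) (kn : (k < n)%N).
Hypothesis J0 : 0 < L2sq f.

Let n0 : (0 < n)%N. Proof. by lia. Qed.
Let A := design R n k.
Let gA : A^T *m A = n%:R%:M. Proof. exact: gram_design. Qed.
Let r := shrinkage sigma gamma n.
Let s := post_sd sigma gamma n.
Let D := 2 * sigma * Num.sqrt (L2sq f).
Let D0 : 0 < D. Proof. by rewrite !mulr_gt0// sqrtr_gt0. Qed.

(** When the posterior coefficients are [r th + s xi], the standardised functional expands as
    [post_shift th + post_slope <th, xi> + post_quad |xi|^2]; the three definitions are its
    coefficients. *)
Definition post_shift (t : 'cV[R]_k) : R :=
  Num.sqrt n%:R * (r ^+ 2 - 1) * sqnorm t / D.
Definition post_slope : R := 2 * Num.sqrt n%:R * r * s / D.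
Definition post_quad : R := Num.sqrt n%:R * s ^+ 2 / D.

(** The unit vector [u] is left free. The exact linear part [post_slope *: th] depends on [Y]; its
    difference from [u] goes into the perturbation, so that [u] can later be chosen independently of
    [Y]. *)
Lemma posterior_interval_le (Y : vec R n) (u : 'cV[R]_k) (e : R) (I : interval R) :
  0 < e -> sqnorm u = 1 ->
  `| posterior sigma (prior gamma n k) Y
       [set F | standardize sigma f n (G (orth_proj A *m cvec Y)) (G (cvec F)) \in I]
     - fine (normal_prob 0 1 [set` I]) | <=
  4 * e + (3 * `|post_shift (lsq A (cvec Y))| / e +
    72 * sqnorm (post_slope *: lsq A (cvec Y) - u) / e ^+ 2 +
    24 * `|post_quad| * k%:R / e).
Proof.
move=> e0 u1; set th := lsq A (cvec Y).
rewrite orth_proj_design// (G_design n0 gA) -/th.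
set B := [set F | _].
have mstd : measurable_fun [set: vec R n]
    (fun F => standardize sigma f n (sqnorm th) (G (cvec F)) : MR).
  apply: measurable_funM => //; apply: measurable_funM => //.
  apply: measurable_funB => //; apply: measurable_funM => //.
  exact: measurable_cvec_sqnorm.
have mB : measurable B.
  rewrite /B -[X in measurable X]setTI.
  exact: (mstd measurableT [set` I] (measurable_itv I)).
rewrite /prior (posteriorE Y sigma0 gamma0 n0 gA mB).
pose W (xi : vec R k) := standardize sigma f n (sqnorm th)
  (\sum_(j < k) (s * tnth xi j + r * th j 0) ^+ 2).
have -> : (fun xi => lin_tuple A (map_coords (fun j => affine (post_sd sigma gamma n)
    (shrinkage sigma gamma n * lsq A (cvec Y) j 0)) xi)) @^-1` B = W @^-1` [set` I].
  apply/seteqP; suff E xi : standardize sigma f n (sqnorm th) (G (cvec (lin_tuple A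
      (map_coords (fun j => affine (post_sd sigma gamma n)
    (shrinkage sigma gamma n * lsq A (cvec Y) j 0)) xi)))) = W xi.
    by split => xi; rewrite /B/= E.
  rewrite cvec_lin_tuple (G_design n0 gA) /W; congr standardize.
  by apply: eq_bigr => j _; rewrite mxE tnth_mktuple.
have WE xi : W xi = lincomb (fun j => u j 0) xi + (post_shift th +
    lincomb (fun j => (post_slope *: th - u) j 0) xi +
    post_quad * \sum_(j < k) lincomb (fun i => (i == j)%:R) xi ^+ 2).
  have -> : \sum_(j < k) lincomb (fun i => (i == j)%:R) xi ^+ 2 =
      \sum_(j < k) tnth xi j ^+ 2.
    apply: eq_bigr => j _; congr (_ ^+ 2).
    rewrite /lincomb (bigD1 j)//= eqxx mul1r big1 ?addr0// => i ij.
    by rewrite (negbTE ij) mul0r.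
  rewrite /W /standardize -/D.
  have -> : \sum_(j < k) (s * tnth xi j + r * th j 0) ^+ 2 =
      s ^+ 2 * \sum_(j < k) tnth xi j ^+ 2 +
      2 * r * s * lincomb (fun j => th j 0) xi + r ^+ 2 * sqnorm th.
    rewrite /lincomb /sqnorm !mulr_sumr -!big_split/=.
    by apply: eq_bigr => j _; ring.
  have -> : lincomb (fun j => (post_slope *: th - u) j 0) xi =
      post_slope * lincomb (fun j => th j 0) xi - lincomb (fun j => u j 0) xi.
    by rewrite /lincomb mulr_sumr -sumrB; apply: eq_bigr => j _; rewrite !mxE; ring.
  rewrite /post_shift /post_slope /post_quad; ring.
apply: (gaussian_perturbation I e0 _ _ WE).
- by rewrite -u1.
- move=> j; rewrite (bigD1 j)//= eqxx expr1n big1 ?addr0// => i ij.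
  by rewrite (negbTE ij) expr0n.
Qed.

Lemma posterior_error_le (Y : vec R n) (u : 'cV[R]_k) (e : R) :
  0 < e -> sqnorm u = 1 ->
  0 <= posterior_error sigma f gamma k Y <=
  4 * e + (3 * `|post_shift (lsq A (cvec Y))| / e +
    72 * sqnorm (post_slope *: lsq A (cvec Y) - u) / e ^+ 2 +
    24 * `|post_quad| * k%:R / e).
Proof.
move=> e0 u1; set b := 4 * e + _; rewrite /posterior_error; set S := [set _ | _ in _].
have Sb : ubound S b by move=> _ [I _ <-]; exact: posterior_interval_le.
have S0 : S !=set0 by eexists; exists `]0, 0[%R.
apply/andP; split; last exact: ge_sup.
have [x Sx] := S0; apply: (@le_trans _ _ x); first by case: Sx => I _ <-.
by apply: ub_le_sup => //; exists b.
Qed.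

End posterior_error_bound.

Section finite_sample_bounds.
Context {R : realType}.
Local Notation MR := (measurableTypeR R).

(* No measurability: the integral of a nonnegative function is a supremum over
   the simple functions below it. *)
Lemma ge0_le_integral_nonmeasurable d (T : measurableType d)
    (P : {measure set T -> \bar R}) (g h : T -> \bar R) :
  (forall x, 0 <= g x)%E -> (forall x, g x <= h x)%E ->
  (\int[P]_x g x <= \int[P]_x h x)%E.
Proof.
move=> g0 gh; have h0 x : (0 <= h x)%E by exact: le_trans (gh x).
rewrite !ge0_integralTE//; apply: le_ereal_sup => _ [k kg <-]; exists k => //= x.
exact: le_trans (kg x) (gh x).
Qed.

Variables (sigma : R) (f : R -> R) (n k : nat).
Hypotheses (sigma0 : 0 < sigma) (kn : (k < n)%N) (J0 : 0 < L2sq f).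

Let n0 : (0 < n)%N. Proof. by lia. Qed.
Let nR : 0 < n%:R :> R. Proof. by rewrite ltr0n. Qed.
Let A := design R n k.
Let gA : A^T *m A = n%:R%:M. Proof. exact: gram_design. Qed.
Let J := L2sq f.
Let m := signal f n.
Let th0 := lsq A m.
Let q := sqnorm th0.
Hypothesis q0 : 0 < q.

Let sqrtn0 : 0 < Num.sqrt n%:R :> R. Proof. by rewrite sqrtr_gt0. Qed.
Let sqrtn2 : Num.sqrt n%:R ^+ 2 = n%:R :> R. Proof. by rewrite sqr_sqrtr. Qed.
Let sJ0 : 0 < Num.sqrt J. Proof. by rewrite sqrtr_gt0. Qed.
Let sJ2 : Num.sqrt J ^+ 2 = J. Proof. by rewrite sqr_sqrtr// ltW. Qed.
Let sq0 : 0 < Num.sqrt q. Proof. by rewrite sqrtr_gt0. Qed.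
Let sq2 : Num.sqrt q ^+ 2 = q. Proof. by rewrite sqr_sqrtr// ltW. Qed.

Let noise (xi : vec R n) : vec R n := map_coords (fun i : 'I_n => affine sigma (m i 0)) xi.
(** Columns of the design scaled to unit length, so that [lincomb (w j)] is standard normal under
    [stdgauss]. *)
Let w (j : 'I_k) (i : 'I_n) : R := A i j / Num.sqrt n%:R.

Let w_unit j : \sum_(i < n) w j i ^+ 2 = 1.
Proof.
have := congr1 (fun M : 'M[R]_k => M j j) gA.
rewrite mxE [X in _ = X]mxE eqxx => E.
under eq_bigr do rewrite expr_div_n sqrtn2.
rewrite -mulr_suml (_ : \sum_(i < n) _ = n%:R) ?divff ?gt_eqF//.
by rewrite -[RHS]mulr1n -[RHS]E; apply: eq_bigr => i _; rewrite [X in _ = X * _]mxE expr2.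
Qed.

Lemma lsq_noise xi j : lsq A (cvec (noise xi)) j 0 =
  th0 j 0 + sigma / Num.sqrt n%:R * lincomb (w j) xi.
Proof.
rewrite /th0 /lsq !mxE /lincomb !mulr_sumr -big_split/=; apply: eq_bigr => i _.
rewrite !mxE tnth_mktuple /affine /w.
rewrite -[X in X^-1 * (_ * (_ + _))]sqrtn2 -[X in _ = X^-1 * _ + _]sqrtn2.
by rewrite !mxE; field; rewrite gt_eqF.
Qed.

Lemma sqnorm_noise xi : sqnorm (lsq A (cvec (noise xi)) - th0) =
  sigma ^+ 2 / n%:R * \sum_(j < k) lincomb (w j) xi ^+ 2.
Proof.
rewrite /sqnorm mulr_sumr; apply: eq_bigr => j _.
have -> : (lsq A (cvec (noise xi)) - th0) j 0 = lsq A (cvec (noise xi)) j 0 - th0 j 0.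
  by rewrite [LHS]mxE [X in _ + X]mxE.
by rewrite lsq_noise addrAC subrr add0r exprMn expr_div_n sqrtn2.
Qed.

(** With [a] the ratio of the roots, [a ^+ 2 - 1 = (a - 1) * (a + 1)] and [a + 1 >= 1]. This trades
    square roots for the ratio of energies, whose limit is accessible. *)
Lemma sqrt_ratio_le : (Num.sqrt q / Num.sqrt J - 1) ^+ 2 <= (q / J - 1) ^+ 2.
Proof.
set a := Num.sqrt q / Num.sqrt J.
have a0 : 0 < a by rewrite divr_gt0.
have -> : q / J = a ^+ 2 by rewrite expr_div_n sq2 sJ2.
have -> : a ^+ 2 - 1 = (a - 1) * (a + 1) by ring.
by rewrite exprMn ler_peMr ?sqr_ge0// exprn_ege1//; lra.
Qed.

(** With [Y = m + sigma xi] the functional is quadratic in [xi]. Its linear part has length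
    [sqrt q / sqrt J], since the projected signal has energy [q] while the scaling uses [J]; what
    separates it from the unit vector [u] along the projected signal is the perturbation [v]. *)
Lemma projected_clt_le (e : R) (I : interval R) : 0 < e ->
  `| fine (gaussian m sigma ((fun Y => standardize sigma f n (G (orth_proj A *m m))
        (G (orth_proj A *m cvec Y))) @^-1` [set` I])) - fine (normal_prob 0 1 [set` I])| <=
  4 * e + (72 * (q / J - 1) ^+ 2 / e ^+ 2 +
     12 * sigma * (k%:R / Num.sqrt n%:R) / (Num.sqrt J * e)).
Proof.
move=> e0; set X := (fun Y => _).
have XE Y : X Y = standardize sigma f n q (sqnorm (lsq A (cvec Y))).
  by rewrite /X !orth_proj_design// !(G_design n0 gA).
have mX : measurable_fun [set: vec R n] (X : _ -> MR).
  rewrite (funext XE); apply: measurable_funM => //; apply: measurable_funM => //.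
  apply: measurable_funB => //; apply: measurable_sum => j; apply: measurable_funX.
  rewrite (_ : (fun Y : vec R n => _) = fun Y => n%:R^-1 * \sum_(i < n) A i j * tnth Y i).
    apply: measurable_funM => //; apply: measurable_sum => i.
    by apply: measurable_funM => //; exact: measurable_tnth.
  apply/funext => Y; rewrite !mxE; congr (_ * _); apply: eq_bigr => i _.
  by rewrite !mxE.
have mI : measurable (X @^-1` [set` I]).
  by rewrite -[Y in measurable Y]setTI; exact: (mX measurableT _ (measurable_itv I)).
have mnoise : measurable_fun [set: vec R n] noise.
  by apply: measurable_map_coords => i; exact: measurable_affine.
have -> : gaussian m sigma (X @^-1` [set` I]) = stdgauss n ((X \o noise) @^-1` [set` I]).
  have sn : sigma != 0 by rewrite gt_eqF.
  have mi : measurable_fun [set: vec R n] (fun t => (\1_(X @^-1` [set` I]) t)%:E : \bar R).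
    exact/measurable_EFinP/measurable_indic.
  have mI' : measurable ((X \o noise) @^-1` [set` I]).
    by rewrite -[Y in measurable Y]setTI; exact: (mnoise measurableT _ mI).
  transitivity (\int[gaussian m sigma]_t (\1_(X @^-1` [set` I]) t)%:E)%E.
    rewrite -[Y in gaussian m sigma Y]setIT.
    exact/esym/(integral_indic (gaussian m sigma) measurableT mI).
  rewrite (ge0_integral_gaussian _ sn mi); last by move=> t; rewrite lee_fin.
  rewrite -[Y in stdgauss n Y]setIT.
  exact: (integral_indic (stdgauss n) measurableT mI').
pose D := 2 * sigma * Num.sqrt J.
have D0 : D != 0 by rewrite gt_eqF// !mulr_gt0.
pose u i : R := (A *m th0) i 0 / (Num.sqrt n%:R * Num.sqrt q).
pose v i : R := (Num.sqrt q / Num.sqrt J - 1) * u i.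
pose c : R := sigma / (2 * Num.sqrt n%:R * Num.sqrt J).
have u1 : \sum_(i < n) u i ^+ 2 = 1.
  under eq_bigr do rewrite expr_div_n exprMn sqrtn2 sq2.
  rewrite -mulr_suml -/(sqnorm (A *m th0)) (sqnorm_design gA) divff//.
  by rewrite mulf_neq0 ?gt_eqF.
have WE xi : (X \o noise) xi = lincomb u xi +
    (0 + lincomb v xi + c * \sum_(j < k) lincomb (w j) xi ^+ 2).
  have -> : lincomb v xi = (Num.sqrt q / Num.sqrt J - 1) * lincomb u xi.
    by rewrite /lincomb mulr_sumr; apply: eq_bigr => i _; rewrite mulrA.
  rewrite /= XE /standardize.
  have -> : sqnorm (lsq A (cvec (noise xi))) - q =
      2 * (sigma / Num.sqrt n%:R) * \sum_(j < k) th0 j 0 * lincomb (w j) xi +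
      (sigma / Num.sqrt n%:R) ^+ 2 * \sum_(j < k) lincomb (w j) xi ^+ 2.
    rewrite /q /sqnorm !mulr_sumr -sumrB -big_split/=; apply: eq_bigr => j _.
    by rewrite lsq_noise; ring.
  have -> : \sum_(j < k) th0 j 0 * lincomb (w j) xi = Num.sqrt q * lincomb u xi.
    rewrite /lincomb mulr_sumr; under eq_bigr do rewrite mulr_sumr.
    rewrite exchange_big/=; apply: eq_bigr => i _.
    rewrite /u mxE mulr_suml mulr_suml mulr_sumr; apply: eq_bigr => j _.
    by rewrite /w; field; rewrite !gt_eqF.
  by rewrite -/J /c; field; rewrite !gt_eqF.
apply: (le_trans (gaussian_perturbation I e0 u1 w_unit WE)).
rewrite lerD2l normr0 mulr0 mul0r add0r; apply: lerD.
  rewrite ler_pM2r ?invr_gt0 ?exprn_gt0// ler_pM2l//.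
  under eq_bigr do rewrite exprMn.
  by rewrite -mulr_sumr u1 mulr1; exact: sqrt_ratio_le.
rewrite ger0_norm; last by rewrite divr_ge0 ?mulr_ge0// ltW.
by rewrite le_eqVlt; apply/orP; left; apply/eqP; rewrite /c; field; rewrite !gt_eqF.
Qed.

Variable gamma : R.
Hypothesis gamma0 : 0 < gamma.

Let r := shrinkage sigma gamma n.
Let s := post_sd sigma gamma n.
(** The small parameter supplied by [1 / sqrt n = o(gamma)]. [r_close] bounds [1 - r] by
    [sigma ^+ 2 * x / sqrt n], and this [1 / sqrt n] offsets the factor [sqrt n] of the
    standardisation. *)
Let x := (Num.sqrt n%:R * gamma)^-1.

Let prec0 : 0 < n%:R + sigma ^+ 2 / gamma.
Proof. by rewrite addr_gt0// divr_gt0// exprn_gt0. Qed.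

Let r0 : 0 < r. Proof. by rewrite divr_gt0. Qed.
Let r1 : r <= 1.
Proof. by rewrite ler_pdivrMr// mul1r lerDl divr_ge0 ?sqr_ge0// ltW. Qed.
Let s2 : s ^+ 2 = sigma ^+ 2 * r / n%:R.
Proof.
rewrite post_sd_sqr// /r /shrinkage; field; rewrite !gt_eqF//.
by rewrite addr_gt0 ?mulr_gt0 ?exprn_gt0.
Qed.
Let r_close : 1 - r <= sigma ^+ 2 * x / Num.sqrt n%:R.
Proof.
have -> : 1 - r = sigma ^+ 2 / gamma / (n%:R + sigma ^+ 2 / gamma).
  by rewrite /r /shrinkage; field; rewrite !gt_eqF// addr_gt0 ?mulr_gt0 ?exprn_gt0.
have -> : sigma ^+ 2 * x / Num.sqrt n%:R = sigma ^+ 2 / gamma / n%:R.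
  by rewrite /x -[in RHS]sqrtn2; field; rewrite !gt_eqF.
rewrite ler_pM2l ?divr_gt0 ?exprn_gt0// lef_pV2 ?posrE// lerDl.
by rewrite divr_ge0 ?sqr_ge0// ltW.
Qed.
Let x0 : 0 < x. Proof. by rewrite invr_gt0 mulr_gt0. Qed.
Let sqrtn1 : 1 <= Num.sqrt n%:R :> R.
Proof. by rewrite -[leLHS]sqrtr1 ler_sqrt// ler1n. Qed.

Let r_sqr : 1 - r ^+ 2 <= 2 * (1 - r).
Proof. by rewrite -subr_ge0 (_ : _ - _ = (1 - r) ^+ 2) ?sqr_ge0//; ring. Qed.

Let D := 2 * sigma * Num.sqrt J.
Let D0 : 0 < D. Proof. by rewrite !mulr_gt0. Qed.

Lemma post_shift_le (t : 'cV[R]_k) : `|post_shift sigma gamma f n t| <=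
  sigma / Num.sqrt J * x * sqnorm t.
Proof.
have -> : post_shift sigma gamma f n t = - (Num.sqrt n%:R * (1 - r ^+ 2) * sqnorm t / D).
  by rewrite /post_shift -/J -/r -/D; ring.
have r21 : r ^+ 2 <= 1 by rewrite exprn_ile1// ltW.
rewrite normrN ger0_norm; last first.
  by rewrite divr_ge0 ?(ltW D0)// mulr_ge0 ?sqnorm_ge0// mulr_ge0 ?(ltW sqrtn0)// subr_ge0.
have -> : sigma / Num.sqrt J * x * sqnorm t =
    Num.sqrt n%:R * (2 * (sigma ^+ 2 * x / Num.sqrt n%:R)) * sqnorm t / D.
  by rewrite /D; field; rewrite !gt_eqF.
rewrite ler_pM2r ?invr_gt0// ler_wpM2r ?sqnorm_ge0// ler_pM2l//.
by apply: (le_trans r_sqr); rewrite ler_pM2l.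
Qed.

Lemma post_quad_le : `|post_quad sigma gamma f n| <= sigma / (2 * Num.sqrt J * Num.sqrt n%:R).
Proof.
have -> : post_quad sigma gamma f n = sigma / (2 * Num.sqrt J * Num.sqrt n%:R) * r.
  rewrite /post_quad -/s s2 -/J; move: sqrtn2 sqrtn0.
  by set y := Num.sqrt n%:R => <- y0; field; rewrite !gt_eqF.
have c0 : 0 < sigma / (2 * Num.sqrt J * Num.sqrt n%:R) by rewrite divr_gt0// !mulr_gt0.
rewrite ger0_norm; last by rewrite mulr_ge0// ltW.
by rewrite ler_piMr// ltW.
Qed.

Lemma post_slope_sqr : post_slope sigma gamma f n ^+ 2 = r ^+ 3 / J.
Proof.
have -> : post_slope sigma gamma f n ^+ 2 =
    Num.sqrt n%:R ^+ 2 * r ^+ 2 * s ^+ 2 / (sigma ^+ 2 * Num.sqrt J ^+ 2).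
  by rewrite /post_slope -/J -/r -/s; field; rewrite !gt_eqF.
by rewrite s2 sqrtn2 sJ2; field; rewrite !gt_eqF.
Qed.

(** Passing from [c t] to [b th0] through [c th0] and [a th0], with [a = 1 / sqrt J] and
    [b = 1 / sqrt q], costs in turn the estimation error, the shrinkage and the mismatch of
    energies; the factor 3 comes from squaring a sum of three terms. *)
Lemma post_slope_le (t : 'cV[R]_k) :
  sqnorm (post_slope sigma gamma f n *: t - (Num.sqrt q)^-1 *: th0) <=
  3 * (sqnorm (t - th0) / J + 4 * sigma ^+ 4 * x ^+ 2 * q / J + (q / J - 1) ^+ 2).
Proof.
set c := post_slope sigma gamma f n.
have c0 : 0 <= c.
  rewrite /c /post_slope divr_ge0 ?(ltW D0)// mulr_ge0 ?sqrtr_ge0//.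
  by rewrite mulr_ge0 ?(ltW r0)// mulr_ge0 ?sqrtr_ge0.
have c2 : c ^+ 2 = r ^+ 3 / J by exact: post_slope_sqr.
set a := (Num.sqrt J)^-1; set b := (Num.sqrt q)^-1.
have aJ : a ^+ 2 = J^-1 by rewrite exprVn sJ2.
have h1 : c ^+ 2 <= J^-1.
  by rewrite c2 ler_piMl ?invr_ge0 ?(ltW J0)// exprn_ile1// ltW.
have h2 : (c - a) ^+ 2 <= 4 * sigma ^+ 4 * x ^+ 2 / J.
  (* [z] is [r] to the power 3/2; it lies between [r ^+ 2] and 1, so [1 - z <= 1 - r ^+ 2]. *)
  pose z := c * Num.sqrt J.
  have z0 : 0 <= z by rewrite mulr_ge0// ltW.
  have z2 : z ^+ 2 = r ^+ 3 by rewrite exprMn c2 sJ2 divfK// gt_eqF.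
  have zr : r ^+ 2 <= z.
    rewrite -(@ler_pXn2r _ 2)// ?nnegrE ?sqr_ge0// z2 -exprM.
    by rewrite ler_wiXn2l// ltW.
  have z1 : z <= 1.
    by rewrite -(@ler_pXn2r _ 2)// ?nnegrE// z2 expr1n exprn_ile1// ltW.
  have -> : (c - a) ^+ 2 = (1 - z) ^+ 2 / J.
    by rewrite -aJ -exprMn -sqrrN; congr (_ ^+ 2); rewrite /z /a; field; rewrite gt_eqF.
  rewrite ler_pM2r ?invr_gt0//.
  have -> : 4 * sigma ^+ 4 * x ^+ 2 = (2 * (sigma ^+ 2 * x)) ^+ 2 by ring.
  have y0 : 0 <= sigma ^+ 2 * x by apply: mulr_ge0; [exact: sqr_ge0|exact: ltW].
  have y1 : 0 <= 2 * (sigma ^+ 2 * x) by exact: mulr_ge0.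
  have z1' : 0 <= 1 - z by rewrite subr_ge0.
  rewrite ler_pXn2r ?nnegrE//.
  apply: (@le_trans _ _ (1 - r ^+ 2)); first by lra.
  apply: (le_trans r_sqr); rewrite ler_pM2l//; apply: (le_trans r_close).
  by rewrite ler_pdivrMr// ler_peMr.
have h3 : (a - b) ^+ 2 * q <= (q / J - 1) ^+ 2.
  apply: le_trans sqrt_ratio_le; rewrite -[X in _ * X]sq2 -exprMn.
  rewrite le_eqVlt; apply/orP; left; apply/eqP; congr (_ ^+ 2).
  by rewrite /a /b; field; rewrite !gt_eqF.
apply: (@le_trans _ _ (3 * (c ^+ 2 * sqnorm (t - th0) + (c - a) ^+ 2 * q + (a - b) ^+ 2 * q))).
  rewrite /q /sqnorm !mulr_sumr -!big_split/= mulr_sumr.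
  apply: ler_sum => j _; rewrite ![in leLHS]mxE.
  have -> : (t - th0) j 0 = t j 0 - th0 j 0 by rewrite [LHS]mxE [X in _ + X]mxE.
  have cube (y1 y2 y3 : R) : (y1 + y2 + y3) ^+ 2 <= 3 * (y1 ^+ 2 + y2 ^+ 2 + y3 ^+ 2).
    rewrite -subr_ge0 (_ : _ - _ = (y1 - y2) ^+ 2 + (y2 - y3) ^+ 2 + (y1 - y3) ^+ 2).
      by rewrite !addr_ge0 ?sqr_ge0.
    by ring.
  rewrite -!exprMn; apply: le_trans (cube _ _ _).
  rewrite le_eqVlt; apply/orP; left; apply/eqP; congr (_ ^+ 2); rewrite !mxE; ring.
rewrite ler_pM2l//; apply: lerD => //; apply: lerD.
  by rewrite mulrC ler_wpM2l ?sqnorm_ge0.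
rewrite (_ : 4 * _ * _ * q / J = 4 * sigma ^+ 4 * x ^+ 2 / J * q); last by ring.
by rewrite ler_pM2r.
Qed.

(** With [u] the direction of [th0], the error is dominated by an affine function of
    [|lsq A Y - th0|^2], whose expectation is at most [8 sigma^2 k / n]. Besides [e] and the energy
    [q], the result varies only through [k / sqrt n], [x] and [q / J - 1], the quantities that are
    to vanish in the limit. *)
Lemma expected_posterior_error_le (e : R) : 0 < e ->
  (0 <= 'E_(gaussian m sigma)[posterior_error sigma f gamma k] <=
  (4 * e + (6 * (sigma / Num.sqrt J) * x * (q + 8 * sigma ^+ 2 * (k%:R / Num.sqrt n%:R)) / e +
    216 * (8 * sigma ^+ 2 * (k%:R / Num.sqrt n%:R) / J +
           4 * sigma ^+ 4 * x ^+ 2 * q / J + (q / J - 1) ^+ 2) / e ^+ 2 +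
    12 * sigma * (k%:R / Num.sqrt n%:R) / (Num.sqrt J * e)))%:E)%E.
Proof.
move=> e0; set kap := k%:R / Num.sqrt n%:R.
have kap0 : 0 <= kap by rewrite divr_ge0// ltW.
pose u : 'cV[R]_k := (Num.sqrt q)^-1 *: th0.
have u1 : sqnorm u = 1.
  rewrite /sqnorm; under eq_bigr do rewrite /u mxE exprMn exprVn sq2.
  by rewrite -mulr_sumr -/(sqnorm th0) -/q mulVf// gt_eqF.
have PE Y := posterior_error_le sigma0 gamma0 kn J0 Y e0 u1.
pose a1 := 6 * (sigma / Num.sqrt J) * x / e + 216 / (J * e ^+ 2).
pose a0 := 4 * e + (6 * (sigma / Num.sqrt J) * x * q / e +
   216 * (4 * sigma ^+ 4 * x ^+ 2 * q / J + (q / J - 1) ^+ 2) / e ^+ 2 +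
   12 * sigma * kap / (Num.sqrt J * e)).
have sx0 : 0 <= 6 * (sigma / Num.sqrt J) * x.
  by rewrite mulr_ge0 ?(ltW x0)// mulr_ge0// divr_ge0// ltW.
have a1_ge0 : 0 <= a1.
  by rewrite addr_ge0// divr_ge0 ?(ltW e0)// mulr_ge0 ?sqr_ge0// ltW.
have a0_ge0 : 0 <= a0.
  rewrite /a0 addr_ge0 ?mulr_ge0 ?(ltW e0)// addr_ge0//; last first.
    by rewrite divr_ge0 ?mulr_ge0 ?(ltW sigma0) ?(ltW sJ0) ?(ltW e0).
  rewrite addr_ge0//; first by rewrite divr_ge0 ?(ltW e0)// mulr_ge0// ltW.
  rewrite divr_ge0 ?sqr_ge0// mulr_ge0// addr_ge0 ?sqr_ge0// divr_ge0 ?(ltW J0)//.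
  by rewrite mulr_ge0 ?(ltW q0)// mulr_ge0 ?sqr_ge0// mulr_ge0// exprn_ge0// ltW.
pose b (Y : vec R n) := a0 + a1 * sqnorm (lsq A (cvec Y) - th0).
have Pb Y : 0 <= posterior_error sigma f gamma k Y <= b Y.
  have /andP[-> h] := PE Y; apply: (le_trans h); rewrite /b /a0 -[leRHS]addrA lerD2l.
  set t := lsq A (cvec Y).
  have st : sqnorm t <= 2 * q + 2 * sqnorm (t - th0).
    rewrite /q /sqnorm !mulr_sumr -big_split/=; apply: ler_sum => j _.
    have -> : (t - th0) j 0 = t j 0 - th0 j 0 by rewrite [LHS]mxE [X in _ + X]mxE.
    by rewrite -subr_ge0 (_ : _ - _ = (2 * th0 j 0 - t j 0) ^+ 2) ?sqr_ge0//; ring.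
  have e1 : 3 * `|post_shift sigma gamma f n t| / e <=
      6 * (sigma / Num.sqrt J) * x / e * (q + sqnorm (t - th0)).
    rewrite (_ : 6 * _ * x / e * _ =
      3 * (sigma / Num.sqrt J * x * (2 * q + 2 * sqnorm (t - th0))) / e); last by ring.
    rewrite ler_pM2r ?invr_gt0// ler_pM2l//; apply: (le_trans (post_shift_le t)).
    by rewrite ler_wpM2l// mulr_ge0 ?(ltW x0)// divr_ge0// ltW.
  have e2 : 72 * sqnorm (post_slope sigma gamma f n *: t - u) / e ^+ 2 <=
     72 * (3 * (sqnorm (t - th0) / J + 4 * sigma ^+ 4 * x ^+ 2 * q / J + (q / J - 1) ^+ 2)) / e ^+ 2.
    rewrite ler_pM2r ?invr_gt0 ?exprn_gt0// ler_pM2l//; exact: post_slope_le.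
  have e3 : 24 * `|post_quad sigma gamma f n| * k%:R / e <= 12 * sigma * kap / (Num.sqrt J * e).
    rewrite (_ : 12 * _ * _ / _ =
      24 * (sigma / (2 * Num.sqrt J * Num.sqrt n%:R)) * k%:R / e); last first.
      by rewrite /kap; field; rewrite !gt_eqF.
    rewrite ler_pM2r ?invr_gt0// ler_wpM2r// ler_pM2l//; exact: post_quad_le.
  apply: (le_trans (lerD (lerD e1 e2) e3)).
  rewrite le_eqVlt; apply/orP; left; apply/eqP; rewrite /a1; field.
  by rewrite !gt_eqF.
rewrite unlock; apply/andP; split.
  by apply: integral_ge0 => Y _; rewrite lee_fin; have /andP[] := Pb Y.
apply: (@le_trans _ _ (\int[gaussian m sigma]_Y (b Y)%:E)%E).
  apply: ge0_le_integral_nonmeasurable => Y; rewrite lee_fin; by have /andP[] := Pb Y.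
have mb : measurable_fun [set: vec R n] (fun Y => (b Y)%:E : \bar R).
  apply/measurable_EFinP; apply: measurable_funD => //; apply: measurable_funM => //.
  apply: measurable_sum => j; apply: measurable_funX.
  rewrite (_ : (fun Y : vec R n => _) =
      fun Y => n%:R^-1 * (\sum_(i < n) A i j * tnth Y i) - th0 j 0).
    apply: measurable_funB => //; apply: measurable_funM => //; apply: measurable_sum => i.
    by apply: measurable_funM => //; exact: measurable_tnth.
  apply/funext => Y; rewrite [LHS]mxE [X in _ + X]mxE; congr (_ - _); rewrite !mxE.
  by congr (_ * _); apply: eq_bigr => i _; rewrite !mxE.
have sn : sigma != 0 by rewrite gt_eqF.
rewrite (ge0_integral_gaussian m sn mb); last first.
  by move=> Y; rewrite lee_fin addr_ge0// mulr_ge0// sqnorm_ge0.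
rewrite [leLHS](_ : _ = \int[stdgauss n]_xi (a0%:E + (a1 * (sigma ^+ 2 / n%:R))%:E *
    (\sum_(j < k) lincomb (w j) xi ^+ 2)%:E))%E; last first.
  apply: eq_integral => xi _; rewrite -EFinM -EFinD /b.
  by rewrite sqnorm_noise mulrA.
have msum : measurable_fun [set: vec R n]
    (fun xi => (\sum_(j < k) lincomb (w j) xi ^+ 2)%:E : \bar R).
  apply/measurable_EFinP; apply: measurable_sum => j.
  by apply: measurable_funX; exact: measurable_lincomb.
have sum0 xi : (0 <= (\sum_(j < k) lincomb (w j) xi ^+ 2)%:E)%E.
  by rewrite lee_fin sumr_ge0// => j _; rewrite sqr_ge0.
have c0 : 0 <= a1 * (sigma ^+ 2 / n%:R) by rewrite mulr_ge0// divr_ge0 ?sqr_ge0.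
rewrite ge0_integralD//; last 2 first.
- by move=> xi _; rewrite mule_ge0// lee_fin.
- exact: emeasurable_funM.
have E1 := integral_probability_cst (stdgauss n) a0%:E.
rewrite [X in (X + _)%E]E1 ge0_integralZl//.
have E2 := integral_sum_lincomb_sqr_le w_unit.
apply: (@le_trans _ _ (a0%:E + (a1 * (sigma ^+ 2 / n%:R))%:E * (8 * k%:R)%:E)%E).
  by rewrite leeD2l// lee_wpmul2l ?lee_fin.
rewrite -EFinM -EFinD lee_fin.
(* [k / n] is relaxed to [k / sqrt n], the ratio that already governs the quadratic term. *)
apply: (@le_trans _ _ (a0 + a1 * (8 * sigma ^+ 2 * kap))).
  rewrite lerD2l -[leLHS]mulrA ler_wpM2l//.
  rewrite (_ : sigma ^+ 2 / n%:R * _ = 8 * sigma ^+ 2 * (k%:R / n%:R)); last by ring.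
  apply: ler_wpM2l; first by rewrite mulr_ge0// sqr_ge0.
  apply: ler_wpM2l => //; rewrite lef_pV2 ?posrE//.
  by rewrite -[leRHS]sqrtn2 expr2 ler_peMl// ltW.
rewrite le_eqVlt; apply/orP; left; apply/eqP; rewrite /a0 /a1; field.
by rewrite !gt_eqF.
Qed.

End finite_sample_bounds.

(** * Convergence *)

Section limits.
Context {R : realType}.
Local Notation MR := (measurableTypeR R).

Lemma measurable_sqnorm_mulmx n p (M : 'M[R]_(p, n)) :
  measurable_fun [set: vec R n] (fun Y => sqnorm (M *m cvec Y) : MR).
Proof.
apply: measurable_sum => j; apply: measurable_funX.
rewrite (_ : (fun Y : vec R n => _) = fun Y => \sum_(i < n) M j i * tnth Y i).
  by apply: measurable_sum => i; apply: measurable_funM => //; exact: measurable_tnth.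
by apply/funext => Y; rewrite mxE; apply: eq_bigr => i _; rewrite mxE.
Qed.

Variables (sigma alpha L : R) (f : R -> R) (gamma : nat -> R) (k : nat -> nat).
Hypotheses (sigma0 : 0 < sigma) (alpha_gt : 1 / 2 < alpha).
Hypothesis f_sobolev : sobolev_sum alpha L f.
Hypothesis f_neq0 : exists2 x, 0 <= x <= 1 & f x != 0.
Hypothesis gamma0 : forall n, (0 < n)%N -> 0 < gamma n.
Hypothesis gamma_large : (fun n => 1 / Num.sqrt n%:R : R) =o_\oo gamma.
Hypothesis k_growth : dim_growth alpha k.

Let J := L2sq f.
Let J0 : 0 < J.
Proof. by case: f_sobolev => theta [h1 h2 h3]; exact: (L2sq_gt0 h1 h3 f_neq0). Qed.
Let sJ0 : 0 < Num.sqrt J. Proof. by rewrite sqrtr_gt0. Qed.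

Let q n : R := sqnorm (lsq (design R n (k n)) (signal f n)).
Let kap n : R := (k n)%:R / Num.sqrt n%:R.
Let x n : R := (Num.sqrt n%:R * gamma n)^-1.

Let n_gt0 : \forall n \near \oo, (0 < n)%N. Proof. exact: nbhs_infty_gt. Qed.

Let sqrtn_gt0 n : (0 < n)%N -> 0 < Num.sqrt n%:R :> R.
Proof. by move=> n0; rewrite sqrtr_gt0 ltr0n. Qed.

Lemma dim_ratio_cvg0 : kap n @[n --> \oo] --> 0.
Proof.
case: k_growth => _ /littleoE H _; apply/cvgr0Pnorm_le => e e0.
near=> n; have n0 : (0 < n)%N by near: n.
have := near (H e e0) n; rewrite ger0_norm// ger0_norm ?sqrtr_ge0// => h.
rewrite ger0_norm ?divr_ge0 ?sqrtr_ge0// ler_pdivrMr ?sqrtn_gt0//.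
by apply: h.
Unshelve. all: by end_near. Qed.

(** [kap n < 1] gives [k n < sqrt n <= n]; from then on the columns of the design are orthogonal and
    the finite-sample bounds apply. *)
Let k_lt : \forall n \near \oo, (0 < k n < n)%N.
Proof.
have K := dim_ratio_cvg0; move/cvgr0Pnorm_lt : K => /(_ 1 ltr01) H.
near=> n; have n0 : (0 < n)%N by near: n.
case: k_growth => k0 _ _; rewrite k0//=.
have : `|kap n| < 1 by near: n.
rewrite ger0_norm ?divr_ge0 ?sqrtr_ge0// ltr_pdivrMr ?sqrtn_gt0// mul1r => h.
rewrite -(ltr_nat R); apply: (lt_le_trans h).
have sn1 : 1 <= Num.sqrt n%:R :> R by rewrite -[leLHS]sqrtr1 ler_sqrt// ler1n.
by rewrite -[leRHS]sqr_sqrtr// expr2 ler_peMl// sqrtr_ge0.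
Unshelve. all: by end_near. Qed.

Lemma prior_variance_cvg0 : x n @[n --> \oo] --> 0.
Proof.
move/littleoE : gamma_large => H; apply/cvgr0Pnorm_le => e e0.
near=> n; have n0 : (0 < n)%N by near: n.
have g0 := gamma0 n0; have s0 := sqrtn_gt0 n0.
have : `|1 / Num.sqrt n%:R| <= e * `|gamma n| by near: n; exact: H.
rewrite ger0_norm ?divr_ge0 ?sqrtr_ge0// ger0_norm ?(ltW g0)// => h.
rewrite ger0_norm ?invr_ge0 ?mulr_ge0 ?sqrtr_ge0 ?(ltW g0)// /x invfM.
by rewrite ler_pdivrMr// -div1r.
Unshelve. all: by end_near. Qed.

(** [sqrt n] times the aliasing term [n^(- alpha)] vanishes because [alpha > 1 / 2], and [sqrt n]
    times the truncation term [k^(- 2 alpha)] vanishes by the lower growth condition on [k]. *)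
Lemma scaled_bias_cvg0 : Num.sqrt n%:R * (q n - J) @[n --> \oo] --> 0.
Proof.
case: f_sobolev => theta [h1 h2 h3].
have [C C0 HC] := bias_le alpha_gt h1 h2 h3.
case: k_growth => _ _ /littleoE H; apply/cvgr0Pnorm_le => e e0.
pose d := e / (2 * (C + 1)).
have d0 : 0 < d by rewrite divr_gt0// mulr_gt0//; lra.
near=> n; have n0 : (0 < n)%N by near: n.
have kn : (0 < k n < n)%N by near: n.
have s0 := sqrtn_gt0 n0.
have ka0 : 0 < (k n)%:R `^ (2 * alpha) :> R by rewrite powR_gt0// ltr0n; case/andP: kn.
have na0 : 0 < n%:R `^ alpha :> R by rewrite powR_gt0// ltr0n.
have b1 : Num.sqrt n%:R <= d * (k n)%:R `^ (2 * alpha).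
  have : `|Num.sqrt n%:R : R| <= d * `|(k n)%:R `^ (2 * alpha)| by near: n; exact: H.
  by rewrite (gtr0_norm s0) (gtr0_norm ka0).
have b2 : Num.sqrt n%:R <= d * n%:R `^ alpha.
  have large : d^-1 <= n%:R `^ (alpha - 2^-1).
    near: n; apply: powR_nat_large; move: alpha_gt; lra.
  rewrite sqrt_powR -(subrK 2^-1 alpha) powRD; last first.
    by apply/implyP => _; rewrite pnatr_eq0 -lt0n.
  by rewrite [leRHS]mulrA ler_peMl ?powR_ge0// -ler_pdivrMl// mulr1.
rewrite normrM (gtr0_norm s0).
apply: (@le_trans _ _ (Num.sqrt n%:R * (C / n%:R `^ alpha + C / (k n)%:R `^ (2 * alpha)))).
  by rewrite ler_pM2l//; exact: HC.
have c1 : Num.sqrt n%:R * (C / n%:R `^ alpha) <= C * d.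
  rewrite mulrCA ler_wpM2l// ler_pdivrMr//.
have c2 : Num.sqrt n%:R * (C / (k n)%:R `^ (2 * alpha)) <= C * d.
  rewrite mulrCA ler_wpM2l// ler_pdivrMr//.
rewrite mulrDr; apply: (le_trans (lerD c1 c2)).
have -> : e = d * (2 * (C + 1)) by rewrite /d divfK// gt_eqF// mulr_gt0//; lra.
have : C * d <= (C + 1) * d by rewrite ler_pM2r//; lra.
lra.
Unshelve. all: by end_near. Qed.

Lemma energy_cvg : q n @[n --> \oo] --> J.
Proof.
apply/subr_cvg0/cvgr0Pnorm_le => e e0.
have /cvgr0Pnorm_le /(_ e e0) H := scaled_bias_cvg0.
near=> n; have n0 : (0 < n)%N by near: n.
have : `|Num.sqrt n%:R * (q n - J)| <= e by near: n.
apply: le_trans; rewrite normrM ger0_norm ?sqrtr_ge0// ler_peMl//.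
by rewrite -[leLHS]sqrtr1 ler_sqrt// ler1n.
Unshelve. all: by end_near. Qed.

Let q_gt0 : \forall n \near \oo, 0 < q n.
Proof. by apply: cvgr_gt energy_cvg _ J0. Qed.

Lemma bias_negligible : (fun n => standardize sigma f n (L2sq f)
    (G (orth_proj (design R n (k n)) *m signal f n))) =o_\oo (fun=> 1 : R).
Proof.
apply/littleoE => e e0.
have D0 : 0 < 2 * sigma * Num.sqrt J by rewrite !mulr_gt0.
have /cvgr0Pnorm_le := scaled_bias_cvg0.
move=> /(_ (e * (2 * sigma * Num.sqrt J)) (mulr_gt0 e0 D0)) H.
near=> n; have n0 : (0 < n)%N by near: n.
have kn : (0 < k n < n)%N by near: n.
have kn' : (k n < n)%N by case/andP: kn.
rewrite normr1 mulr1 orth_proj_design ?gram_design// G_design ?gram_design//.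
rewrite /standardize normrM [X in _ * X]gtr0_norm ?invr_gt0// ler_pdivrMr//.
by near: n.
Unshelve. all: by end_near. Qed.

Lemma projected_clt : cvg_in_distribution (fun n => gaussian (signal f n) sigma)
  (fun n (Y : vec R n) => standardize sigma f n
     (G (orth_proj (design R n (k n)) *m signal f n))
     (G (orth_proj (design R n (k n)) *m cvec Y)))
  (normal_prob 0 1).
Proof.
split=> [n|y _].
  apply: measurable_funM => //; apply: measurable_funM => //.
  apply: measurable_funB => //; apply: measurable_funM => //.
  exact: measurable_sqnorm_mulmx.
set P := fun n => gaussian _ _ _.
rewrite -[X in _ --> X]fineK; last by apply: fin_num_measure; exact: measurable_itv.
apply/fine_cvgP; split.
  near=> n; apply: fin_num_measure.
  rewrite -[X in measurable X]setTI.
  have mX : measurable_fun [set: vec R n] (fun Y : vec R n => standardize sigma f n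
     (G (orth_proj (design R n (k n)) *m signal f n))
     (G (orth_proj (design R n (k n)) *m cvec Y)) : MR).
    apply: measurable_funM => //; apply: measurable_funM => //.
    apply: measurable_funB => //; apply: measurable_funM => //.
    exact: measurable_sqnorm_mulmx.
  exact: (mX measurableT _ (measurable_itv `]-oo, y])).
(* With this choice [4 * e] is half of [eta]; for fixed [e] the remaining terms tend to 0 and fit
   into the other half. *)
apply/cvgrPdist_le => eta eta0; pose e := eta / 8.
have e0 : 0 < e by rewrite divr_gt0.
have : (72 * (q n / J - 1) ^+ 2 / e ^+ 2 +
     12 * sigma * kap n / (Num.sqrt J * e)) @[n --> \oo] -->
   (72 * (J / J - 1) ^+ 2 / e ^+ 2 + 12 * sigma * 0 / (Num.sqrt J * e)).
  apply: cvgD.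
    apply: cvgMl; apply: cvgMr; apply: cvgM; apply: cvgB; try exact: cvg_cst;
    by apply: cvgMl; exact: energy_cvg.
  by apply: cvgMl; apply: cvgMr; exact: dim_ratio_cvg0.
rewrite divff ?gt_eqF// subrr expr0n/= !mulr0 !mul0r addr0.
move/cvgr0Pnorm_le => /(_ (eta / 2)); rewrite divr_gt0// => /(_ isT) H.
near=> n; have n0 : (0 < n)%N by near: n.
have kn : (0 < k n < n)%N by near: n.
have kn' : (k n < n)%N by case/andP: kn.
have qn : 0 < q n by near: n.
rewrite distrC; apply: (le_trans (projected_clt_le sigma0 kn' J0 qn `]-oo, y] e0)).
have h : `|72 * (q n / J - 1) ^+ 2 / e ^+ 2 +
     12 * sigma * kap n / (Num.sqrt J * e)| <= eta / 2 by near: n.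
have := le_trans (ler_norm _) h; rewrite /kap /q /J /e; lra.
Unshelve. all: by end_near. Qed.

Lemma posterior_error_cvg0 :
  ('E_(gaussian (signal f n) sigma)[posterior_error sigma f (gamma n) (k n)])%E
    @[n --> \oo] --> 0%E.
Proof.
have bound (e : R) n : 0 < e -> (0 < k n < n)%N -> 0 < q n ->
  (0 <= 'E_(gaussian (signal f n) sigma)[posterior_error sigma f (gamma n) (k n)] <=
  (4 * e + (6 * (sigma / Num.sqrt J) * x n * (q n + 8 * sigma ^+ 2 * kap n) / e +
    216 * (8 * sigma ^+ 2 * kap n / J +
           4 * sigma ^+ 4 * x n ^+ 2 * q n / J + (q n / J - 1) ^+ 2) / e ^+ 2 +
    12 * sigma * kap n / (Num.sqrt J * e)))%:E)%E.
  move=> e0 /andP[_ kn] qn; have n0 : (0 < n)%N by lia.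
  exact: (expected_posterior_error_le sigma0 kn J0 qn (gamma0 n0) e0).
have small (eta : R) : 0 < eta -> \forall n \near \oo,
  (0 <= 'E_(gaussian (signal f n) sigma)[posterior_error sigma f (gamma n) (k n)] <=
   eta%:E)%E.
  move=> eta0; pose e := eta / 8; have e0 : 0 < e by rewrite divr_gt0.
  have : (6 * (sigma / Num.sqrt J) * x n * (q n + 8 * sigma ^+ 2 * kap n) / e +
    216 * (8 * sigma ^+ 2 * kap n / J +
           4 * sigma ^+ 4 * (x n * x n) * q n / J + (q n / J - 1) ^+ 2) / e ^+ 2 +
    12 * sigma * kap n / (Num.sqrt J * e)) @[n --> \oo] -->
   (6 * (sigma / Num.sqrt J) * 0 * (J + 8 * sigma ^+ 2 * 0) / e +
    216 * (8 * sigma ^+ 2 * 0 / J +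
           4 * sigma ^+ 4 * (0 * 0) * J / J + (J / J - 1) ^+ 2) / e ^+ 2 +
    12 * sigma * 0 / (Num.sqrt J * e)).
    have cx := prior_variance_cvg0; have cq := energy_cvg; have ck := dim_ratio_cvg0.
    apply: cvgD; [apply: cvgD|].
    - apply: cvgMl; apply: cvgM; first exact: cvgMr.
      by apply: cvgD => //; exact: cvgMr.
    - apply: cvgMl; apply: cvgMr; apply: cvgD; [apply: cvgD|].
      + by apply: cvgMl; exact: cvgMr.
      + by apply: cvgMl; apply: cvgM => //; apply: cvgMr; exact: cvgM.
      + by apply: cvgM; apply: cvgB; try exact: cvg_cst; exact: cvgMl.
    - by apply: cvgMl; exact: cvgMr.
  rewrite divff ?gt_eqF// subrr expr0n/= !(mulr0, mul0r, addr0).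
  move/cvgr0Pnorm_le => /(_ (eta / 2)); rewrite divr_gt0// => /(_ isT) H.
  near=> n; have n0 : (0 < n)%N by near: n.
  have kn : (0 < k n < n)%N by near: n.
  have qn : 0 < q n by near: n.
  have /andP[-> h] := bound e n e0 kn qn; apply: (le_trans h); rewrite lee_fin.
  have : `|6 * (sigma / Num.sqrt J) * x n * (q n + 8 * sigma ^+ 2 * kap n) / e +
    216 * (8 * sigma ^+ 2 * kap n / J +
           4 * sigma ^+ 4 * (x n * x n) * q n / J + (q n / J - 1) ^+ 2) / e ^+ 2 +
    12 * sigma * kap n / (Num.sqrt J * e)| <= eta / 2 by near: n.
  move/(le_trans (ler_norm _)); rewrite -expr2 => h2.
  have -> : eta = 4 * e + eta / 2 by rewrite /e; field.
  by rewrite lerD2l.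
(* Convergence of extended reals to a finite limit includes eventual finiteness, here from the bound
   with [eta = 1]. *)
have fin : \forall n \near \oo,
  ('E_(gaussian (signal f n) sigma)[posterior_error sigma f (gamma n) (k n)])%E
    \is a fin_num.
  near=> n; have /andP[h0 h1] : (0 <= 'E_(gaussian (signal f n) sigma)
      [posterior_error sigma f (gamma n) (k n)] <= 1%:E)%E by near: n; exact: small.
  by rewrite ge0_fin_numE//; apply: (le_lt_trans h1); rewrite ltry.
apply/fine_cvgP; split=> //; apply/cvgr0Pnorm_le => eta eta0.
near=> n; have /andP[h0 h1] : (0 <= 'E_(gaussian (signal f n) sigma)
    [posterior_error sigma f (gamma n) (k n)] <= eta%:E)%E by near: n; exact: small.
have hf : ('E_(gaussian (signal f n) sigma)[posterior_error sigma f (gamma n) (k n)])%E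
    \is a fin_num by near: n.
by rewrite /= ger0_norm ?fine_ge0// -lee_fin fineK.
Unshelve. all: by end_near. Qed.

End limits.

Theorem proposition6 (R : realType) (sigma alpha L : R) (f : R -> R)
    (gamma : nat -> R) (sigma_gt0 : 0 < sigma) (alpha_gt : 1 / 2 < alpha)
    (L_gt0 : 0 < L) (f_sobolev : sobolev_sum alpha L f)
    (f_neq0 : exists2 x, 0 <= x <= 1 & f x != 0)
    (gamma_gt0 : forall n, (0 < n)%N -> 0 < gamma n)
    (gamma_large : (fun n => 1 / Num.sqrt n%:R : R) =o_\oo gamma) :
  (exists k : nat -> nat, dim_growth alpha k) /\
  forall k : nat -> nat, dim_growth alpha k ->
    [/\ ('E_(gaussian (signal f n) sigma)
             [posterior_error sigma f (gamma n) (k n)])%E @[n --> \oo] --> 0%E,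
        cvg_in_distribution
          (fun n => gaussian (signal f n) sigma)
          (fun n (Y : vec R n) =>
             standardize sigma f n
               (G (orth_proj (design R n (k n)) *m signal f n))
               (G (orth_proj (design R n (k n)) *m cvec Y)))
          (normal_prob 0 1)
      & (fun n => standardize sigma f n (L2sq f)
                    (G (orth_proj (design R n (k n)) *m signal f n)))
          =o_\oo (fun=> 1 : R)].
Proof.
split=> [|k kg]; first exact: dim_growth_exists.
split.
- exact: (posterior_error_cvg0 sigma_gt0 alpha_gt f_sobolev f_neq0 gamma_gt0 gamma_large kg).
- exact: (projected_clt sigma_gt0 alpha_gt f_sobolev f_neq0 kg).
- exact: (bias_negligible sigma_gt0 alpha_gt f_sobolev f_neq0 kg).
Qed.
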